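(* (1) Any real function $f\in L_2(S^2)$ has a representation of the form $$f(x,y,z)=\sum_{d=0}^{\infty}\Big\{\lambda_d+\sum_{k=1}^{d}\Big[\prod_{j=1}^{k}\big(a^{(d)}_{kj}x+b^{(d)}_{kj}y+c^{(d)}_{kj}z\big)\Big]\Big\},$$ with real $\lambda_d,a^{(d)}_{kj},b^{(d)}_{kj},c^{(d)}_{kj}$, where the series (over $d$) converges in the $L_2$-norm, and the mutually orthogonal polynomials in the braces $\{\cdot\}$ are among the $d$-th spherical harmonics. This representation is unique up to reordering and rescaling of the linear factors in each of the products. (2) In the space of real continuous functions on $S^2$ there is a dense (in the sup-norm) and $O(3)$-invariant subset $\mathcal F(S^2)$ comprised of the functions that admit a representation in the form of a series $$\lambda+\sum_{d=1}^{\infty}\Big[\prod_{j=1}^{d}(a_{dj}x+b_{dj}y+c_{dj}z)\Big]$$ (with real coefficients) that converges uniformly on the sphere. Each function from $\mathcal F(S^2)$ admits a canonical extension into the interior of the unit ball $D^3$, where it produces a real analytic function.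
   Context: $S^2\subset\mathbb R^3$ is the unit sphere with its standard rotation-invariant measure, and $x,y,z$ are the coordinates of $\mathbb R^3$. A $d$-th spherical harmonic is an eigenfunction of the Laplace operator $\Delta_{S^2}$ with eigenvalue $-d(d+1)$; equivalently, the restriction to $S^2$ of a homogeneous harmonic polynomial of degree $d$ in $x,y,z$. ''Rescaling'' of the linear factors of a product means multiplying the factors by constants whose product is $1$. Some of the linear forms may be zero. The canonical extension of a function in $\mathcal F(S^2)$ is the one defined by the same series, evaluated at points of the open ball.
   Formalization: Uniqueness up to reordering and rescaling fails for products that vanish identically (0·x = 0·y), so any two lists of linear factors that both contain a zero form are identified; for nonzero products the uniqueness is as stated. *)

(* Defs.v *)
From HB Require Import structures.
From mathcomp Require Import all_boot all_order all_fingroup all_algebra.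
(* mpoly must be imported before the analysis files: in the other order some
   notations are rejected as incompatible. *)
From mathcomp Require Import mpoly.
From mathcomp Require Import all_classical all_reals all_analysis.
From mathcomp Require Import measurable_realfun.

Set Implicit Arguments.
Unset Strict Implicit.
Unset Printing Implicit Defensive.
Import Order.TTheory GRing.Theory Num.Theory.
Import numFieldNormedType.Exports.

Local Open Scope classical_set_scope.
Local Open Scope ring_scope.

Section Sphere.
Variable R : realType.

(* Points of R^3 are row vectors.  The library norm on 'rV[R]_3 is the sup
   norm (same topology), so Euclidean lengths are written out. *)
Definition sqnorm (v : 'rV[R]_3) : R := \sum_(i < 3) v 0 i ^+ 2.

Definition unit_sphere : set 'rV[R]_3 := [set v | sqnorm v = 1].

Definition open_ball : set 'rV[R]_3 := [set v | sqnorm v < 1].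

Definition S2 : Type := unit_sphere.

Definition S2val (p : S2) : 'rV[R]_3 := val p.

Definition mkS2 (v : 'rV[R]_3) (hv : unit_sphere v) : S2 :=
  exist _ v (mem_set hv).

Definition row3 (a b c : R) : 'rV[R]_3 := \row_(i < 3) [:: a; b; c]`_i.

Lemma sqnorm_row3 a b c : sqnorm (row3 a b c) = a ^+ 2 + b ^+ 2 + c ^+ 2.
Proof. by rewrite /sqnorm !big_ord_recl big_ord0 !mxE /= addr0 addrA. Qed.

Lemma spherical_proof (u : R * R) :
  unit_sphere (row3 (sin u.2 * cos u.1) (sin u.2 * sin u.1) (cos u.2)).
Proof.
rewrite /unit_sphere /= sqnorm_row3 !exprMn -mulrDr cos2Dsin2 mulr1.
by rewrite addrC cos2Dsin2.
Qed.

(* u = (longitude, colatitude) *)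
Definition spherical (u : R * R) : S2 := mkS2 (spherical_proof u).

HB.instance Definition _ := Choice.on S2.
HB.instance Definition _ := PseudoMetric.on S2.
HB.instance Definition _ := isPointed.Build S2 (spherical (0, 0)).
HB.instance Definition _ :=
  Measurable.copy S2 (g_sigma_algebraType (@open S2)).

End Sphere.

Arguments spherical {R} u.

Section SurfaceMeasure.
Variable R : realType.


Lemma measurable_spherical : measurable_fun [set: R * R] spherical.
Proof.
have mco (i : 'I_3) : measurable_fun [set: R * R] (fun u => S2val (spherical u) 0 i).
  have ms : measurable_fun [set: R] (@sin R).
    by apply: continuous_measurable_fun => x; exact: continuous_sin.
  have mc : measurable_fun [set: R] (@cos R).
    by apply: continuous_measurable_fun => x; exact: continuous_cos.
  case: i => -[|[|[|//]]] i3; rewrite /S2val /=; under eq_fun do rewrite mxE /=.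
  - by apply: measurable_funM; apply: measurableT_comp.
  - by apply: measurable_funM; apply: measurableT_comp.
  - exact: measurableT_comp.
apply: (measurability (@open (S2 R))) => // _ [_ [W oW <-]] <-; rewrite setTI.
pose box (ab : {ffun 'I_3 -> rat * rat}) : set 'rV[R]_3 :=
  [set v | forall i, ratr (ab i).1 < v 0 i < ratr (ab i).2].
pose pre (ab : {ffun 'I_3 -> rat * rat}) : set (R * R) :=
  [set u | box ab (S2val (spherical u)) /\ box ab `<=` W].
rewrite (_ : _ @^-1` _ = \bigcup_ab pre ab).
  apply: countable_bigcupT_measurable => [|ab]; first exact: countableP.
  have [bW|bW] := pselect (box ab `<=` W); last first.
    by rewrite (_ : pre ab = set0)//; apply/seteqP; split => // u [].
  rewrite (_ : pre ab = \bigcap_(i : 'I_3) ((fun u => S2val (spherical u) 0 i) @^-1`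
      `](ratr (ab i).1), (ratr (ab i).2)[%classic)); last first.
    apply/seteqP; split => [u [+ _] i _|u h].
      by move=> /(_ i); rewrite /= in_itv.
    by split => // i; have := h i Logic.I; rewrite /= in_itv.
  apply: fin_bigcap_measurable => // i _; rewrite -[X in measurable X]setTI.
  exact: mco.
apply/seteqP; split => [u Wu|u [ab _ [bu]]]; last exact.
have [e /= e0 eW] : nbhs_ball (S2val (spherical u)) W.
  by apply/nbhs_ballP; exact: open_nbhs_nbhs.
have ex (i : 'I_3) : {ab : rat * rat |
    S2val (spherical u) 0 i - e < ratr ab.1 < S2val (spherical u) 0 i /\
    S2val (spherical u) 0 i < ratr ab.2 < S2val (spherical u) 0 i + e}.
  apply: cid.
  have /rat_in_itvoo[a] : S2val (spherical u) 0 i - e < S2val (spherical u) 0 i.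
    by rewrite ltrBlDr ltrDl.
  rewrite in_itv /= => ha.
  have /rat_in_itvoo[b] : S2val (spherical u) 0 i < S2val (spherical u) 0 i + e.
    by rewrite ltrDl.
  by rewrite in_itv /= => hb; exists (a, b).
exists [ffun i => projT1 (ex i)] => //; split.
  move=> i; rewrite ffunE; case: (ex i) => -[a b] /= [/andP[_ ->] /andP[-> _]] //.
move=> v hv; apply: eW; split=> // i j; rewrite (ord1 i).
have := hv j; rewrite ffunE; case: (ex j) => -[a b] /= [/andP[h1 _] /andP[_ h2]].
move=> /andP[h3 h4]; rewrite /ball /= ltr_distlC.
by rewrite (lt_trans h1 h3) (lt_trans h4 h2).
Qed.

Definition spherical_domain : set (R * R) :=
  `[0, 2 * pi]%classic `*` `[0, pi]%classic.

Local Notation leb2 := (@lebesgue_measure R \x @lebesgue_measure R)%E.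

(* Area element sin(colatitude) d(longitude) d(colatitude), total mass 4 pi. *)
Definition surface_measure (A : set (S2 R)) : \bar R :=
  (\int[leb2]_(u in spherical_domain `&` spherical @^-1` A) (sin u.2)%:E)%E.

Let surface0 : surface_measure set0 = 0%E.
Proof. by rewrite /surface_measure preimage_set0 setI0 integral_set0. Qed.

Let surface_sin_ge0 (A : set (S2 R)) (u : R * R) :
  (spherical_domain `&` spherical @^-1` A) u -> (0 <= (sin u.2)%:E)%E.
Proof.
move=> [[_ /=]]; rewrite in_itv /= => /andP[h0 hpi] _.
by rewrite lee_fin sin_ge0_pi// h0.
Qed.

Let surface_ge0 A : (0 <= surface_measure A)%E.
Proof. by apply: integral_ge0 => u; exact: surface_sin_ge0. Qed.

Let surface_sigma_additive : semi_sigma_additive surface_measure.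
Proof.
move=> F mF tF mUF; rewrite /surface_measure preimage_bigcup setI_bigcupr.
have ms : measurable_fun [set: R * R] (fun u => (sin u.2)%:E : \bar R).
  apply/measurable_EFinP; apply: measurableT_comp => //.
  by apply: continuous_measurable_fun => x; exact: continuous_sin.
rewrite ge0_integral_bigcup//.
- apply: is_cvg_nneseries_cond => n _ _.
  by apply: integral_ge0 => u; exact: surface_sin_ge0.
- move=> n; apply: measurableI; first exact: measurableX.
  by rewrite -[X in measurable X]setTI; exact: measurable_spherical.
- exact: measurable_funTS.
- by move=> u [n _]; exact: surface_sin_ge0.
- move=> i j _ _ [u [[_ Fi] [_ Fj]]]; apply: (tF i j) => //.
  by exists (spherical u).
Qed.

HB.instance Definition _ := isMeasure.Build _ (S2 R) R surface_measure
  surface0 surface_ge0 surface_sigma_additive.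

End SurfaceMeasure.

Section Definitions.
Variable R : realType.
Local Notation S2 := (S2 R).

Definition linform (w v : 'rV[R]_3) : R := \sum_(i < 3) w 0 i * v 0 i.

Definition spherical_harmonic (d : nat) (f : S2 -> R) : Prop :=
  exists P : {mpoly R[3]},
    [/\ P \is d.-homog,
        \sum_(i < 3) (P^`M(i))^`M(i) = 0
      & forall p, f p = P.@[fun i => S2val p 0 i]].

(* In the families L below, L d k j is the coefficient vector
   (a, b, c) of the j-th of the k linear forms in the k-th product of the d-th
   term.  Only the values with 1 <= k <= d are used. *)
Definition brace (lam : nat -> R) (L : nat -> forall k, 'I_k -> 'rV[R]_3)
    (d : nat) (v : 'rV[R]_3) : R :=
  lam d + \sum_(1 <= k < d.+1) \prod_(j < k) linform (L d k j) v.

Definition L2_representation (f : S2 -> R) (lam : nat -> R)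
    (L : nat -> forall k, 'I_k -> 'rV[R]_3) : Prop :=
  (forall d, spherical_harmonic d (fun p => brace lam L d (S2val p))) /\
  'N[@surface_measure R]_2%:E
     [(fun p => (f p - \sum_(0 <= d < N) brace lam L d (S2val p))%:E)]%E
    @[N --> \oo] --> 0%E.

(* When a product vanishes identically (one of its forms is 0), its other forms
   are arbitrary, so all such factor lists are identified. *)
Definition same_factors (k : nat) (u w : 'I_k -> 'rV[R]_3) : Prop :=
  (exists (s : 'S_k) (c : 'I_k -> R),
     \prod_(j < k) c j = 1 /\ forall j, w j = c j *: u (s j)) \/
  ((exists j, u j = 0) /\ (exists j, w j = 0)).

Definition partial_sum (lam : R) (L : forall d, 'I_d -> 'rV[R]_3) (N : nat)
    (v : 'rV[R]_3) : R :=
  lam + \sum_(1 <= d < N.+1) \prod_(j < d) linform (L d j) v.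

Definition uniform_representation (f : S2 -> R) (lam : R)
    (L : forall d, 'I_d -> 'rV[R]_3) : Prop :=
  {uniform, (fun N (p : S2) => partial_sum lam L N (S2val p)) @ \oo --> f}.

Definition calF : set (S2 -> R) :=
  [set f | exists lam L, uniform_representation f lam L].

Lemma orthact_proof (A : 'M[R]_3) (hA : A *m A^T = 1%:M) (p : S2) :
  unit_sphere (S2val p *m A).
Proof.
have sqE (v : 'rV[R]_3) : sqnorm v = (v *m v^T) 0 0.
  by rewrite mxE; apply: eq_bigr => i _; rewrite mxE expr2.
rewrite /unit_sphere /= sqE trmx_mul mulmxA -(mulmxA _ A) hA mulmx1 -sqE.
by have := set_mem (valP p).
Qed.

Definition orthact (A : 'M[R]_3) (hA : A *m A^T = 1%:M) (p : S2) : S2 :=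
  mkS2 (orthact_proof hA p).

(* Only meaningful at points where the series converges. *)
Definition canonical_extension (lam : R) (L : forall d, 'I_d -> 'rV[R]_3)
    (v : 'rV[R]_3) : R :=
  limn (fun N => partial_sum lam L N v).

Definition monomial_term (c : 'X_{1..3} -> R) (v : 'rV[R]_3) (m : 'X_{1..3}) : R :=
  c m * \prod_(i < 3) v 0 i ^+ m i.

(* The power series is summed by total degree; because it is required to
   converge absolutely, the order of summation is irrelevant. *)
Definition real_analytic_at (F : 'rV[R]_3 -> R) (v : 'rV[R]_3) : Prop :=
  exists (r : R) (c : 'X_{1..3} -> R), 0 < r /\
    forall w, `|w - v| < r ->
      cvgn (series (fun n => \sum_(m : 'X_{1..3 < n.+1} | mdeg m == n)
                               `|monomial_term c (w - v) m|)) /\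
      series (fun n => \sum_(m : 'X_{1..3 < n.+1} | mdeg m == n)
                         monomial_term c (w - v) m) @ \oo --> F w.

End Definitions.

Arguments calF {R}.
Arguments surface_measure {R} A.

(* Main.v *)
From HB Require Import structures.
From mathcomp Require Import all_boot all_order all_fingroup all_algebra.
From mathcomp Require Import mpoly.
From mathcomp Require Import complex.
From mathcomp Require Import all_classical all_reals all_analysis.
From mathcomp Require Import measurable_realfun.
From mathcomp Require Import ring lra zify.
Require Import Defs.

(** Every real polynomial on the sphere is a constant plus products of real
    linear forms, one product in each degree, and the reason is Sylvester's.
    The conic x^2 + y^2 + z^2 = 0 in the complex projective plane has no real
    point and is parametrized by the Riemann sphere, on which conjugation acts as
    the antipodal map.  A real form of degree k restricts to a polynomial of
    degree 2 k in the parameter whose roots come in antipodal pairs; a pair is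
    exactly the zero set of a real linear form, so the restriction is a product
    of restrictions of linear forms (star_factor), unique up to order and scaling
    (prod_lquad_unique).  A form that vanishes on the conic is divisible by
    x^2 + y^2 + z^2 (pull_eq0_divisible), hence equals a polynomial of lower
    degree on the sphere.  Induction on the degree gives existence
    (sphere_products) and uniqueness (sphere_products_unique).

    For the mean square expansion the integral of a polynomial over the sphere is
    reduced to moments of sine and cosine, whose recurrences amount to the
    divergence theorem for forms (sphint_deriv) and give the Green formula
    (sphint_green).  Harmonic forms of different degrees are therefore
    orthogonal.  The projection of f to the forms of degree d, minus the one in
    degree d - 2, is harmonic (hcomp_harmonic), and the sum of these components
    up to a given degree is the best approximation of f by polynomials of that
    degree (hsum_best).  It converges to f because polynomials are dense: uniformly
    in the continuous functions, by Bernstein polynomials (sphere_weierstrass),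
    and thence in mean square (L2approx_L2).  By orthogonality the harmonic
    components of f are unique (brace_unique), and so are their factors.

    In a uniformly convergent series of products the d-th term Q_d is a form of
    degree d with |Q_d| <= M on the sphere, hence |Q_d| <= M s^d on a neighbourhood
    of a point of the open ball, for some s < 1.  This gives convergence.  For
    analyticity one needs that the Taylor coefficients of Q_d at that point,
    summed with weights t^|m|, also decay geometrically (analytic_criterion).
    They are bounded through Lagrange interpolation: expanding a polynomial of
    degree d from its values at 2 d + 1 equispaced nodes in each variable costs a
    factor of exponential growth in d, whose rate tends to 0 with t
    (mnorm_ell_node and binomial_bound), so for small t it is compensated by
    s^d. *)

Set Implicit Arguments.
Unset Strict Implicit.
Unset Printing Implicit Defensive.
Import Order.TTheory GRing.Theory Num.Theory.
Import numFieldNormedType.Exports.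
Local Open Scope classical_set_scope.
Local Open Scope ring_scope.

(** * Products of quadratics fixed by the antipodal involution *)

Lemma ord3P (i : 'I_3) : [\/ i = 0, i = 1 | i = 2].
Proof.
case: i => -[|[|[|//]]] hi; [apply: Or31|apply: Or32|apply: Or33]; exact/val_inj.
Qed.

Lemma nat_roots_poly0 (K : numDomainType) (p : {poly K}) :
  (forall n, p.[n%:R] = 0) -> p = 0.
Proof.
move=> p0; apply: (@roots_geq_poly_eq0 _ p [seq (i%:R : K) | i <- iota 0 (size p)]).
- by apply/allP => _ /mapP[n _ ->]; rewrite /root p0.
- by rewrite map_inj_uniq ?iota_uniq //; exact: mulrIn (oner_neq0 _).
- by rewrite size_map size_iota.
Qed.

Lemma eq_cplx (R : rcfType) (x y : R[i]) :
  complex.Re x = complex.Re y -> complex.Im x = complex.Im y -> x = y.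
Proof. by case: x => a b; case: y => c d /= -> ->. Qed.

Section Conic.
Variable R : realType.
Local Notation C := R[i].
Local Notation toC := (real_complex R).

Lemma conjcD (x y : C) : conjc (x + y) = conjc x + conjc y.
Proof. exact: rmorphD. Qed.
Lemma conjcB (x y : C) : conjc (x - y) = conjc x - conjc y.
Proof. exact: rmorphB. Qed.
Lemma conjcN (x : C) : conjc (- x) = - conjc x.
Proof. exact: rmorphN. Qed.
Lemma conjcM (x y : C) : conjc (x * y) = conjc x * conjc y.
Proof. exact: rmorphM. Qed.
Lemma conjcX (x : C) n : conjc (x ^+ n) = conjc x ^+ n.
Proof. exact: rmorphXn. Qed.
Lemma conjcV (x : C) : conjc x^-1 = (conjc x)^-1.
Proof. exact: fmorphV. Qed.

Lemma toCM (x y : R) : toC (x * y) = toC x * toC y.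
Proof. exact: rmorphM. Qed.

(** The quadratic obtained by putting the point (1 - t^2, i (1 + t^2), 2 t) of
    the conic x^2 + y^2 + z^2 = 0 into the linear form w. *)
Definition lquad (w : 'rV[R]_3) : {poly C} :=
  (Complex (w 0 0) (w 0 1))%:P + ((2 * w 0 2)%:C)%C%:P * 'X
    - (conjc (Complex (w 0 0) (w 0 1)))%:P * 'X^2.

(** For p regarded as a polynomial of degree at most 2 k, this is t |->
    (-1)^k t^(2 k) conj (p (antip t)), with antip the antipodal map of the
    Riemann sphere.  Binary forms of degree 2 k fixed by it are the pullbacks of
    real forms of degree k. *)
Definition star (k : nat) (p : {poly C}) : {poly C} :=
  \poly_(j < (k.*2).+1) ((-1) ^+ (k + j) * conjc p`_(k.*2 - j)).

Definition antip (t : C) : C := - (conjc t)^-1.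

Lemma star_horner k (p : {poly C}) t : t != 0 -> (size p <= (k.*2).+1)%N ->
  (star k p).[t] = (-1) ^+ k * t ^+ (k.*2) * conjc p.[antip t].
Proof.
move=> t0 sp; rewrite horner_poly (horner_coef_wide _ sp) (rmorph_sum (@conjc R)) mulr_sumr.
rewrite (reindex_inj rev_ord_inj) /=; apply: eq_bigr => -[j hj] _ /=.
rewrite subSS subKn; last by rewrite -ltnS.
rewrite conjcM conjcX /antip conjcN conjcV conjcK.
have -> : t ^+ k.*2 = t ^+ (k.*2 - j) * t ^+ j by rewrite -exprD subnK.
rewrite (exprNn t^-1) exprVn.
have -> : (-1) ^+ (k + (k.*2 - j)) = (-1) ^+ k * (-1) ^+ j :> C.
  rewrite exprD; congr (_ * _); rewrite -[LHS]signr_odd -[RHS]signr_odd.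
  by rewrite oddB // odd_double.
have tj : t ^+ j != 0 by rewrite expf_neq0.
by field.
Qed.

(** Lets identities between polynomials be checked away from 0, where the
    antipodal map is a genuine function. *)
Lemma poly_eq_punctured (p q : {poly C}) :
  (forall t, t != 0 -> p.[t] = q.[t]) -> p = q.
Proof.
move=> h; apply: (@mulfI _ 'X); first by rewrite polyX_eq0.
apply/eqP; rewrite -subr_eq0; apply/eqP.
apply: nat_roots_poly0 => n; rewrite !hornerE.
have [->|n0] := eqVneq (n%:R : C) 0; first by rewrite !mul0r subrr.
by rewrite h ?subrr.
Qed.

Lemma starM a b (p q : {poly C}) : (size p <= (a.*2).+1)%N -> (size q <= (b.*2).+1)%N ->
  star (a + b) (p * q) = star a p * star b q.
Proof.
move=> sp sq; apply: poly_eq_punctured => t t0.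
rewrite hornerM !star_horner //; last first.
  by apply: leq_trans (size_polyMleq _ _) _; lia.
by rewrite hornerM conjcM doubleD !exprD; ring.
Qed.

Lemma lquad_row3 a b c : lquad (row3 a b c) =
  (Complex a b)%:P + ((2 * c)%:C)%C%:P * 'X - (conjc (Complex a b))%:P * 'X^2.
Proof. by rewrite /lquad !mxE. Qed.

Lemma lquadE w t : (lquad w).[t] = (Complex (w 0 0) (w 0 1)) + (2 * w 0 2)%:C%C * t
    - (conjc (Complex (w 0 0) (w 0 1))) * t ^+ 2.
Proof. by rewrite /lquad !hornerE. Qed.

Lemma size_lquad w : (size (lquad w) <= 3)%N.
Proof.
rewrite /lquad.
apply: leq_trans (size_polyD _ _) _; rewrite geq_max size_polyN; apply/andP; split.
  apply: leq_trans (size_polyD _ _) _; rewrite geq_max; apply/andP; split.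
    by apply: leq_trans (size_polyC_leq1 _) _.
  by rewrite mul_polyC; apply: leq_trans (size_scale_leq _ _) _; rewrite size_polyX.
by rewrite mul_polyC; apply: leq_trans (size_scale_leq _ _) _; rewrite size_polyXn.
Qed.

Lemma star_lquad w : star 1 (lquad w) = lquad w.
Proof.
apply: poly_eq_punctured => t t0; rewrite star_horner // ?size_lquad //.
rewrite !lquadE /antip.
set al := Complex _ _; set c := (2 * _)%:C%C.
have -> : conjc (al + c * - (conjc t)^-1 - conjc al * (- (conjc t)^-1) ^+ 2) =
   conjc al - c * t^-1 - al * t^-1 ^+ 2.
  rewrite conjcB conjcD (conjcM c) (conjcM (conjc al)) conjcX !conjcN conjcV !conjcK.
  by rewrite -/c /c conjc_real; ring.
by rewrite expr1 -muln2 /=; field.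
Qed.

Lemma lquad_eq0 w : (lquad w == 0) = (w == 0).
Proof.
apply/eqP/eqP => [h|->]; last first.
  by apply/polyP => i; rewrite /lquad !mxE mulr0 /= oppr0 !polyC0 !mul0r subr0 addr0.
have h0 := congr1 (fun p => p.[0]) h; have h1 := congr1 (fun p => p.[1]) h.
have h2 := congr1 (fun p => p.[-1]) h.
move: h0 h1 h2; rewrite !lquadE horner0 /= => /eqP + /eqP + _.
rewrite expr0n /= !mulr0 subr0 addr0 eq_complex /= => /andP[/eqP a0 /eqP b0].
rewrite a0 b0 horner0 expr1n !mulr1 eq_complex /= !oppr0 !addr0 add0r.
rewrite eqxx andbT mulf_eq0 pnatr_eq0 /= => /eqP c0.
by apply/rowP => i; rewrite mxE; case: (ord3P i) => ->.
Qed.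

Lemma antip_neq (t : C) : t != 0 -> antip t != t.
Proof.
move=> t0; apply/eqP => h.
have : - 1 = t * conjc t.
  have ct0 : conjc t != 0 by rewrite conjc_eq0.
  by rewrite -{1}h /antip mulNr mulVf.
have /= := mulcJ_ge0 t => + h'; rewrite -h'.
by rewrite oppr_ge0 ler10.
Qed.

(** A multiple of the unit vector that corresponds to t under stereographic
    projection; the quadratic of this form has roots t and antip t. *)
Definition root_axis (t : C) : 'rV[R]_3 :=
  row3 (- complex.Re t) (- complex.Im t)
    ((1 - complex.Re t ^+ 2 - complex.Im t ^+ 2) / 2).

(** Sylvester's argument: the roots of a polynomial fixed by the involution come
    in antipodal pairs, none of which coincide because t * conj t = -1 is
    impossible, and each pair is the root set of the quadratic of a real linear
    form.  Splitting one pair off lowers k by one.  Roots at 0 and infinity are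
    paired with each other, which is the case of a vanishing top coefficient. *)
Lemma star_factor k (p : {poly C}) : (size p <= (k.*2).+1)%N -> star k p = p ->
  exists (c : R) (w : 'I_k -> 'rV[R]_3), p = (toC c)%:P * \prod_j lquad (w j).
Proof.
elim: k p => [|k IH] p sp hp.
  exists (complex.Re p`_0), (fun=> 0); rewrite big_ord0 mulr1.
  have /= := congr1 (fun q : {poly C} => q`_0) hp; rewrite coef_poly /= mul1r => h.
  rewrite [LHS]size1_polyC //; congr (_%:P).
  by move: h; case: (p`_0) => a b /= -[] /eqP; rewrite eqNr => /eqP ->.
have [->|p0] := eqVneq p 0.
  by exists 0, (fun=> 0); rewrite polyC0 mul0r.
suff [w [r [pE sr]]] : exists (w : 'rV[R]_3) (r : {poly C}),
    p = lquad w * r /\ (size r <= (k.*2).+1)%N.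
  have w0 : lquad w != 0 by apply: contraNneq p0 => w0; rewrite pE w0 mul0r.
  have [] := IH r sr.
    apply: (mulfI w0); rewrite -[RHS]pE -[in RHS]hp -[in LHS](star_lquad w).
    by rewrite -starM ?size_lquad // add1n -pE.
  move=> c [v rE].
  exists c, (fun j => if unlift ord0 j is Some i then v i else w).
  rewrite big_ord_recl unlift_none pE rE mulrCA; congr (_ * (_ * _)).
  by apply: eq_bigr => i _; rewrite liftK.
have coefE j : (j <= k.+1.*2)%N ->
    p`_j = (-1) ^+ (k.+1 + j) * conjc p`_(k.+1.*2 - j).
  by move=> hj; rewrite -[in LHS]hp coef_poly ltnS hj.
(* The pair (0, infinity): the corresponding linear form is z / 2. *)
have [ptop|ptop] := eqVneq p`_(k.+1.*2) 0.
  have pbot : p`_0 = 0 by rewrite coefE // subn0 ptop conjc0 mulr0.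
  have /factor_theorem[r pE] : root p 0 by rewrite /root horner_coef0 pbot.
  exists (row3 0 0 2^-1), r; split.
    rewrite pE mulrC; congr (_ * _); rewrite /lquad !mxE /= mulfV ?pnatr_eq0 //.
    have z0 : (Complex 0 0)%:P = 0 :> {poly C} by exact: polyC0.
    have z1 : (1%:C%C)%:P = 1 :> {poly C} by exact: polyC1.
    by rewrite !oppr0 !z0 z1 mul0r subr0 add0r mul1r addr0.
  have r0 : r != 0 by apply: contraNneq p0 => r0; rewrite pE r0 mul0r.
  have szp : (size p <= k.+1.*2)%N.
    apply/leq_sizeP => j; rewrite leq_eqVlt => /predU1P[<- //|hj].
    by apply/(leq_sizeP _ _ sp).
  move: szp; rewrite pE size_Mmonic ?monicXsubC // size_XsubC; lia.
have size_p : size p = (k.+1.*2).+1.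
  by apply/eqP; rewrite eqn_leq sp /= ltnNge; apply: contraNN ptop => /leq_sizeP ->.
have /closed_rootP[t0 rt0] : size p != 1%N by rewrite size_p.
have t0n : t0 != 0.
  apply: contraNneq ptop => t00; move: rt0; rewrite t00 /root horner_coef0.
  by rewrite (coefE k.+1.*2) // subnn mulf_eq0 signr_eq0 conjc_eq0.
have rt1 : root p (antip t0).
  have := star_horner t0n sp; rewrite hp (rootP rt0) => /esym/eqP.
  have nz : (-1) ^+ k.+1 * t0 ^+ k.+1.*2 != 0 by rewrite mulf_neq0 ?signr_eq0 ?expf_neq0.
  by rewrite mulf_eq0 (negPf nz) conjc_eq0.
have [q [pE]] : exists q, p = q * \prod_(z <- [:: t0; antip t0]) ('X - z%:P) /\ True.
  have [||q ->] := @uniq_roots_prod_XsubC _ p [:: t0; antip t0]; last by exists q.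
    by rewrite /= rt0 rt1.
  by rewrite uniq_rootsE /= inE eq_sym antip_neq.
rewrite big_cons big_seq1 in pE *; move=> _.
have ct0 : conjc t0 != 0 by rewrite conjc_eq0.
(* The quadratic of the axis has leading coefficient conj t0. *)
exists (root_axis t0).
exists ((conjc t0)^-1%:P * q); split.
  have -> : lquad (root_axis t0) = (conjc t0)%:P * (('X - t0%:P) * ('X - (antip t0)%:P)).
    rewrite /root_axis lquad_row3.
    have -> : (2 * ((1 - complex.Re t0 ^+ 2 - complex.Im t0 ^+ 2) / 2))%:C%C = 1 - t0 * conjc t0.
      rewrite mulrC divfK ?pnatr_eq0 //.
      by case: (t0) => a b; apply: eq_cplx => /=; ring.
    have -> : Complex (- complex.Re t0) (- complex.Im t0) = - t0 by case: (t0).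
    rewrite conjcN /antip !polyCN polyCB polyCM.
    transitivity ((conjc t0)%:P * 'X^2 + (((conjc t0)%:P * ((conjc t0)^-1)%:P) - t0%:P * (conjc t0)%:P) * 'X
      - t0%:P * ((conjc t0)%:P * ((conjc t0)^-1)%:P) : {poly C}); last by ring.
    have ctE : (conjc t0)%:P * ((conjc t0)^-1)%:P = 1 by rewrite -polyCM mulfV.
    by rewrite ctE; ring.
  by rewrite pE mulrACA -polyCM mulfV // polyC1 mul1r mulrC.
rewrite size_Cmul ?invr_eq0 //.
have q0 : q != 0 by apply: contraNneq p0 => q0; rewrite pE q0 mul0r.
move: size_p; rewrite pE mulrA size_Mmonic ?monicXsubC //; last first.
  by rewrite mulf_neq0 // polyXsubC_eq0.
rewrite size_Mmonic ?monicXsubC // !size_XsubC doubleS !addn2 /= => -[->]; exact: ltnSn.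
Qed.

Lemma lquadZ (c : R) w : lquad (c *: w) = (c%:C%C)%:P * lquad w.
Proof.
apply: poly_eq_punctured => t _; rewrite hornerM hornerC !lquadE !mxE.
by case: t => x y; apply: eq_cplx => /=; ring.
Qed.

Lemma lquad_root w : w != 0 -> exists t, root (lquad w) t.
Proof.
move=> w0; have [a0|a0] := eqVneq (Complex (w 0 0) (w 0 1)) 0.
  by exists 0; rewrite /root lquadE a0 conjc0 mul0r mulr0 subr0 addr0.
apply/closed_rootP; apply/eqP => s1.
have /polyP/(_ 2) := size1_polyC (eq_leq s1).
rewrite /lquad; move: (Complex _ _) a0 => al a0.
rewrite coefC /= !(coefD, coefN, coefCM, coefC, coefX, coefXn) /=.
by rewrite mulr0 mulr1 !add0r => /eqP; rewrite oppr_eq0 conjc_eq0 (negPf a0).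
Qed.

Lemma row3P (u v : 'rV[R]_3) :
  u 0 0 = v 0 0 -> u 0 1 = v 0 1 -> u 0 2 = v 0 2 -> u = v.
Proof.
by move=> h0 h1 h2; apply/rowP => i; case: (ord3P i) => ->.
Qed.

(** A real line in R^3 is determined by one root of its quadratic: the real and
    imaginary parts of the equation force the coefficient vector to be parallel
    to the axis of the root.  Multiplication of the equation by conj t gives the
    combinations e1 and e2 below. *)
Lemma root_lquad_axis w t : root (lquad w) t -> exists c : R, w = c *: root_axis t.
Proof.
case: t => x y; rewrite /root lquadE eq_complex /= => /andP[/eqP h1 /eqP h2].
set a := w 0 0 in h1 h2 *; set b := w 0 1 in h1 h2 *; set c := w 0 2 in h1 h2 *.
set n := x ^+ 2 + y ^+ 2.
have n0 : 0 <= n by rewrite addr_ge0 ?sqr_ge0.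
have n1 : 1 + n != 0 by lra.
have e1 : a * y - b * x = 0.
  apply: (mulIf n1); rewrite mul0r /n.
  have -> : (a * y - b * x) * (1 + (x ^+ 2 + y ^+ 2)) =
    y * (a + (2 * c * x - 0 * y) - (a * (x * x - y * y) - - b * (x * y + y * x)))
    - x * (b + (2 * c * y + 0 * x) - (a * (x * y + y * x) + - b * (x * x - y * y))) by ring.
  by rewrite h1 h2; ring.
have e2 : (a * x + b * y) * (1 - n) + 2 * c * n = 0.
  rewrite /n.
  have -> : (a * x + b * y) * (1 - (x ^+ 2 + y ^+ 2)) + 2 * c * (x ^+ 2 + y ^+ 2) =
    x * (a + (2 * c * x - 0 * y) - (a * (x * x - y * y) - - b * (x * y + y * x)))
    + y * (b + (2 * c * y + 0 * x) - (a * (x * y + y * x) + - b * (x * x - y * y))) by ring.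
  by rewrite h1 h2; ring.
have [e3 e4] : a * (1 - n) + 2 * c * x = 0 /\ b * (1 - n) + 2 * c * y = 0.
  have [n00|nn0] := eqVneq n 0.
    have x0 : x = 0 by apply/eqP; rewrite -sqrf_eq0; apply/eqP; move: n00 (sqr_ge0 x) (sqr_ge0 y); rewrite /n; lra.
    have y0 : y = 0 by apply/eqP; rewrite -sqrf_eq0; apply/eqP; move: n00 (sqr_ge0 x) (sqr_ge0 y); rewrite /n; lra.
    move: h1 h2; rewrite n00 x0 y0; lra.
  split; apply: (mulIf nn0); rewrite mul0r.
    transitivity (x * ((a * x + b * y) * (1 - n) + 2 * c * n) + y * (1 - n) * (a * y - b * x)).
      by rewrite {3}/n /n; ring.
    by rewrite e1 e2; ring.
  transitivity (y * ((a * x + b * y) * (1 - n) + 2 * c * n) - x * (1 - n) * (a * y - b * x)).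
    by rewrite /n; ring.
  by rewrite e1 e2; ring.
set d2 := (1 - x ^+ 2 - y ^+ 2) / 2.
have dn : (1 + n) ^+ 2 != 0 by rewrite expf_neq0.
exists (4 * (a * (- x) + b * (- y) + c * d2) / (1 + n) ^+ 2).
apply: row3P; rewrite !mxE /= -/a -/b -/c -/d2; apply: (mulIf dn);
  rewrite mulrAC divfK //.
- transitivity (4 * (a * - x + b * - y + c * d2) * - x
     + 4 * y * (a * y - b * x) + 4 * d2 / 2 * (a * (1 - n) + 2 * c * x)).
    by rewrite /n /d2; field.
  by rewrite e1 e3; ring.
- transitivity (4 * (a * - x + b * - y + c * d2) * - y
     - 4 * x * (a * y - b * x) + 4 * d2 / 2 * (b * (1 - n) + 2 * c * y)).
    by rewrite /n /d2; field.
  by rewrite e1 e4; ring.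
- transitivity (4 * (a * - x + b * - y + c * d2) * d2
     + 2 * x * (a * (1 - n) + 2 * c * x) + 2 * y * (b * (1 - n) + 2 * c * y)).
    by rewrite /n /d2; field.
  by rewrite e3 e4; ring.
Qed.

Lemma lquad_parallel u w t : root (lquad u) t -> root (lquad w) t -> u != 0 -> w != 0 ->
  exists2 c : R, c != 0 & w = c *: u.
Proof.
move=> /root_lquad_axis[a ->] /root_lquad_axis[b ->].
rewrite !scaler_eq0 !negb_or => /andP[a0 _] /andP[b0 _].
exists (b / a); first by rewrite mulf_neq0 // invr_eq0.
by rewrite scalerA divfK.
Qed.

(** Any root of the right-hand product is a root of some quadratic on the left,
    and a common root makes the two linear forms proportional. *)
Lemma prod_lquad_unique (a : R) (us ws : seq 'rV[R]_3) : size us = size ws ->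
  \prod_(u <- us) lquad u = (a%:C%C)%:P * \prod_(w <- ws) lquad w ->
  \prod_(u <- us) lquad u != 0 ->
  exists2 vs, perm_eq us vs &
    forall i, (i < size ws)%N -> exists c : R, nth 0 ws i = c *: nth 0 vs i.
Proof.
elim: ws a us => [|w ws IH] a us.
  by move=> /size0nil -> _ _; exists [::].
move=> /= sz pE p0.
have w0 : w != 0.
  by apply: contraNneq p0; rewrite pE big_cons => /eqP; rewrite -lquad_eq0 => /eqP ->; rewrite mul0r mulr0.
have [t rt] := lquad_root w0.
have : root (\prod_(u <- us) lquad u) t.
  by rewrite pE big_cons mulrCA rootM rt.
rewrite /root horner_prod prodf_seq_eq0 => /hasP[u us_u /= ru].
have usE : perm_eq us (u :: rem u us) by exact: perm_to_rem.
have u0 : u != 0.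
  apply: contraNneq p0 => u0; rewrite (perm_big _ usE) big_cons mulf_eq0.
  by rewrite lquad_eq0 u0 eqxx.
have [c c0 wE] := lquad_parallel ru rt u0 w0.
have := IH (a * c) (rem u us).
move: pE p0; rewrite (perm_big _ usE) !big_cons /= => pE p0.
case.
- by rewrite size_rem // sz.
- have : lquad u != 0 by rewrite lquad_eq0.
  move=> /mulfI; apply; rewrite pE wE lquadZ toCM polyCM; ring.
- by apply: contraNneq p0 => ->; rewrite mulr0.
move=> vs hvs hnth; exists (u :: vs); first by rewrite (perm_trans usE) // perm_cons.
by case=> [_|i hi] /=; [exists c|exact: hnth].
Qed.
End Conic.

(** * Pulling back to the isotropic conic *)

Lemma sum3 (V : nmodType) (F : 'I_3 -> V) : \sum_(i < 3) F i = F 0 + F 1 + F 2.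
Proof.
rewrite !big_ord_recl big_ord0 addr0 addrA.
by congr (_ + F _ + F _); apply/val_inj.
Qed.

Lemma prod3 (V : comNzRingType) (F : 'I_3 -> V) : \prod_(i < 3) F i = F 0 * F 1 * F 2.
Proof.
rewrite !big_ord_recl big_ord0 mulr1 mulrA.
by congr (_ * F _ * F _); apply/val_inj.
Qed.

Lemma msizeM_bound (n : nat) (K : idomainType) (p q : {mpoly K[n]}) (a b : nat) :
  (msize p <= a.+1)%N -> (msize q <= b)%N -> (msize (p * q) <= a + b)%N.
Proof.
have bound (x y : nat) : (x <= a.+1)%N -> (y <= b)%N -> ((x + y).-1 <= a + b)%N by lia.
move=> hp hq.
have [->|p0] := eqVneq p 0; first by rewrite mul0r mmeasure0.
have [->|q0] := eqVneq q 0; first by rewrite mulr0 mmeasure0.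
by rewrite msizeM //; exact: bound.
Qed.

Section Pullback.
Variable R : realType.
Local Notation C := R[i].
Local Notation toC := (real_complex R).

(** The real structure that a pullback carries: stable k p says that p is the
    restriction to the conic of a real form of degree k. *)
Definition stable (k : nat) (p : {poly C}) := (size p <= (k.*2).+1)%N /\ star k p = p.

Lemma stableM a b p q : stable a p -> stable b q -> stable (a + b) (p * q).
Proof.
move=> [sp hp] [sq hq]; split; last by rewrite starM // hp hq.
by apply: leq_trans (size_polyMleq _ _) _; lia.
Qed.

Lemma stable1 : stable 0 1.
Proof.
split; first by rewrite size_poly1.
apply/polyP => -[|j]; rewrite coef_poly !coef1 //=.
by rewrite mul1r -[LHS]/(conjc 1) conjc1.
Qed.

Lemma stable_lquad w : stable 1 (lquad w : {poly C}).
Proof. by split; [exact: size_lquad|exact: star_lquad]. Qed.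

Lemma stable0 k : stable k 0.
Proof.
split; first by rewrite size_poly0.
by apply/polyP => j; rewrite coef_poly !coef0 conjc0 mulr0 if_same.
Qed.

Lemma stableD k p q : stable k p -> stable k q -> stable k (p + q).
Proof.
move=> [sp hp] [sq hq]; split.
  by apply: leq_trans (size_polyD _ _) _; rewrite geq_max sp sq.
rewrite -[in RHS]hp -[in RHS]hq; apply/polyP => j; rewrite coefD !coef_poly.
by case: ifP => // _; rewrite ?addr0 // coefD conjcD mulrDr.
Qed.

Lemma stableZ k (c : R) p : stable k p -> stable k ((toC c)%:P * p).
Proof.
move=> [sp hp]; split.
  by rewrite mul_polyC; apply: leq_trans (size_scale_leq _ _) _.
rewrite -[in RHS]hp; apply/polyP => j; rewrite coefCM !coef_poly.
by case: ifP => _; rewrite ?mulr0 // coefCM conjcM conjc_real mulrCA.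
Qed.

Lemma stable_prod (I : Type) (r : seq I) (k : I -> nat) (p : I -> {poly C}) :
  (forall i, stable (k i) (p i)) -> stable (\sum_(i <- r) k i) (\prod_(i <- r) p i).
Proof.
move=> h; elim: r => [|i r IH]; first by rewrite !big_nil; exact: stable1.
by rewrite !big_cons; exact: stableM.
Qed.

Lemma stableX n w : stable n (lquad w ^+ n : {poly C}).
Proof.
elim: n => [|n IH]; first exact: stable1.
by rewrite exprS -[X in stable X]add1n; apply: stableM => //; exact: stable_lquad.
Qed.

Definition basis3 (i : 'I_3) : 'rV[R]_3 := \row_j (j == i)%:R.

Definition toCP (c : R) : {poly C} := (toC c)%:P.

HB.instance Definition _ := GRing.RMorphism.copy toCP (polyC \o toC).

(** Restriction of a real polynomial to the conic x^2 + y^2 + z^2 = 0. *)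
Definition pull (P : {mpoly R[3]}) : {poly C} :=
  mmap toCP (fun i => lquad (basis3 i)) P.

HB.instance Definition _ := GRing.RMorphism.copy pull
  (mmap toCP (fun i => lquad (basis3 i))).

Lemma stable_pull d (P : {mpoly R[3]}) : P \is d.-homog -> stable d (pull P).
Proof.
move=> /dhomogP hP; rewrite /pull /mmap big_seq.
apply: (big_ind (stable d)); [exact: stable0|exact: stableD|].
move=> m /hP /= <-; apply: stableZ; rewrite /mmap1 mdegE.
by apply: stable_prod => i; exact: stableX.
Qed.

Definition mlin (w : 'rV[R]_3) : {mpoly R[3]} := \sum_(i < 3) w 0 i *: 'X_i.

Lemma mlin_homog w : mlin w \is 1.-homog.
Proof.
by apply: rpred_sum => i _; apply: rpredZ; rewrite dhomogX /= mdeg1.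
Qed.

Lemma mlinE w (v : 'I_3 -> R) : (mlin w).@[v] = \sum_(i < 3) w 0 i * v i.
Proof.
by rewrite raddf_sum /=; apply: eq_bigr => i _; rewrite mevalZ mevalXU.
Qed.

Lemma prod_homog k (P : 'I_k -> {mpoly R[3]}) :
  (forall j, P j \is 1.-homog) -> \prod_j P j \is k.-homog.
Proof.
elim: k P => [|k IH] P h; first by rewrite big_ord0 dhomog1.
by rewrite big_ord_recl; exact: (dhomogM (h ord0) (IH _ (fun j => h (lift ord0 j)))).
Qed.

Lemma pull_mlin w : pull (mlin w) = lquad w.
Proof.
rewrite /mlin raddf_sum /=.
apply: poly_eq_punctured => t _; rewrite horner_sum.
under eq_bigr do rewrite /pull mmapZ mmapX mmap1U hornerM hornerC lquadE !mxE.
rewrite sum3 lquadE /=.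
by case: t => x y; apply: eq_cplx => /=; ring.
Qed.

Definition conic (t : C) (i : 'I_3) : C := (lquad (basis3 i)).[t].

Lemma conic0 t : conic t 0 = 1 - t ^+ 2.
Proof.
rewrite /conic lquadE !mxE /=.
by case: t => x y; apply: eq_cplx => /=; ring.
Qed.

Lemma conic1 t : conic t 1 = 'i%C * (1 + t ^+ 2).
Proof.
rewrite /conic lquadE !mxE /=.
by case: t => x y; apply: eq_cplx => /=; ring.
Qed.

Lemma conic2 t : conic t 2 = 2 * t.
Proof.
rewrite /conic lquadE !mxE /=.
by case: t => x y; apply: eq_cplx => /=; ring.
Qed.

(** Complexification, needed because the conic has no real point. *)
Definition cmpoly (P : {mpoly R[3]}) : {mpoly C[3]} := map_mpoly toC P.

Lemma cmpolyE (P : {mpoly R[3]}) (z : 'I_3 -> C) :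
  (cmpoly P).@[z] = \sum_(m <- msupp P) toC P@_m * \prod_i z i ^+ m i.
Proof.
rewrite [in LHS](mpolyE P) /cmpoly (raddf_sum (map_mpoly toC)) (raddf_sum (meval z)).
apply: eq_bigr => m _ /=.
by rewrite map_mpolyZ map_mpolyX mevalZ mevalX.
Qed.

Lemma pull_horner (P : {mpoly R[3]}) t : (pull P).[t] = (cmpoly P).@[conic t].
Proof.
rewrite cmpolyE /pull /mmap horner_sum; apply: eq_bigr => m _.
rewrite hornerM hornerC /mmap1 horner_prod; congr (_ * _); apply: eq_bigr => i _.
by rewrite horner_exp.
Qed.

Lemma cmpoly_real (P : {mpoly R[3]}) (v : 'I_3 -> R) :
  (cmpoly P).@[fun i => toC (v i)] = toC P.@[v].
Proof.
rewrite cmpolyE mevalE (rmorph_sum toC); apply: eq_bigr => m _.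
rewrite /= toCM; congr (_ * _); rewrite (rmorph_prod toC); apply: eq_bigr => i _ /=.
by rewrite -[RHS]/(toC _) (rmorphXn toC).
Qed.

(* In the coordinates xi = x + i y, eta = x - i y, zeta = z the quadratic form is
   xi * eta + zeta^2, so modulo it the product xi * eta can be eliminated. *)
Definition xi : {mpoly C[3]} := 'X_0 + 'i%C *: 'X_1.
Definition eta : {mpoly C[3]} := 'X_0 - 'i%C *: 'X_1.
Definition zeta : {mpoly C[3]} := 'X_2.
Definition quad : {mpoly C[3]} := xi * eta + zeta ^+ 2.

(** The monomials without a factor xi * eta, indexed so that the j-th one
    restricts to a multiple of t^j on the conic; those of degree d therefore
    restrict to a basis of the polynomials of degree at most 2 d. *)
Definition ebase (d j : nat) : {mpoly C[3]} :=
  if (j <= d)%N then eta ^+ (d - j) * zeta ^+ j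
  else xi ^+ (j - d) * zeta ^+ (d.*2 - j).

(** The normal form of a form of degree d modulo the quadratic form, with a
    bound on the degree of the quotient. *)
Definition divisible_form (d : nat) (F : {mpoly C[3]}) :=
  exists (a : nat -> C) (Q : {mpoly C[3]}), (msize Q <= d)%N /\
    F = \sum_(j < (d.*2).+1) a j *: ebase d j + quad * Q.

Lemma divisible_formD d F G :
  divisible_form d F -> divisible_form d G -> divisible_form d (F + G).
Proof.
move=> [a [Q [sQ ->]]] [b [Q' [sQ' ->]]].
exists (fun j => a j + b j), (Q + Q'); split.
  by apply: leq_trans (mmeasureD_le _ _ _) _; rewrite geq_max sQ sQ'.
rewrite mulrDr addrACA -big_split /=; congr (_ + _).
by apply: eq_bigr => j _; rewrite scalerDl.
Qed.

Lemma divisible_formZ d c F : divisible_form d F -> divisible_form d (c *: F).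
Proof.
move=> [a [Q [sQ ->]]]; exists (fun j => c * a j), (c *: Q); split.
  by apply: leq_trans (msizeZ_le _ _) _.
rewrite scalerDr scaler_sumr scalerAr; congr (_ + _).
by apply: eq_bigr => j _; rewrite scalerA.
Qed.

Lemma divisible_form0 d : divisible_form d 0.
Proof.
exists (fun=> 0), 0; rewrite mmeasure0; split => //.
by rewrite mulr0 addr0 big1 // => j _; rewrite scale0r.
Qed.

Lemma divisible_form_ebase d j : (j <= d.*2)%N -> divisible_form d (ebase d j).
Proof.
move=> jd; exists (fun i => (i == j)%:R), 0; rewrite mmeasure0; split => //.
have jd' : (j < (d.*2).+1)%N by [].
rewrite mulr0 addr0 (bigD1 (Ordinal jd')) //= eqxx scale1r big1 ?addr0 // => i.
by rewrite -val_eqE /= => /negPf ->; rewrite scale0r.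
Qed.

Lemma divisible_form_quad d Q : (msize Q <= d)%N -> divisible_form d (quad * Q).
Proof.
move=> sQ; exists (fun=> 0), Q; split => //.
by rewrite big1 ?add0r // => j _; rewrite scale0r.
Qed.

(** Reduces the stability of normal forms under multiplication by a linear form
    to its effect on the basis monomials. *)
Lemma divisible_form_mul d (X : {mpoly C[3]}) F : (msize X <= 2)%N ->
  (forall j, (j <= d.*2)%N -> divisible_form d.+1 (X * ebase d j)) ->
  divisible_form d F -> divisible_form d.+1 (X * F).
Proof.
move=> sX hX [a [Q [sQ ->]]]; rewrite mulrDr mulr_sumr; apply: divisible_formD.
  apply: (big_ind (divisible_form d.+1)).
  - exact: divisible_form0.
  - exact: divisible_formD.
  - by move=> j _; rewrite -scalerAr; apply: divisible_formZ; apply: hX; rewrite -ltnS.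
rewrite mulrCA; apply: divisible_form_quad.
exact: (msizeM_bound sX sQ).
Qed.

Lemma msize_lin (X : {mpoly C[3]}) : X \is 1.-homog -> (msize X <= 2)%N.
Proof.
move=> /dhomogP h; rewrite msizeE; apply/bigmax_leqP_seq => m /h /= hm _.
by rewrite ltnS -[X in (X <= _)%N]/(mdeg m) hm.
Qed.

Lemma X_homog i : ('X_i : {mpoly C[3]}) \is 1.-homog.
Proof. by rewrite dhomogX /= mdeg1. Qed.

Lemma xi_homog : xi \is 1.-homog.
Proof. by apply: rpredD; [|apply: rpredZ]; exact: X_homog. Qed.

Lemma eta_homog : eta \is 1.-homog.
Proof. by apply: rpredB; [|apply: rpredZ]; exact: X_homog. Qed.

Lemma msizeX_le (X : {mpoly C[3]}) n : (msize X <= 2)%N -> (msize (X ^+ n) <= n.+1)%N.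
Proof.
move=> sX; elim: n => [|n IH]; first by rewrite expr0 msize1.
by rewrite exprS; exact: (msizeM_bound sX IH).
Qed.

Lemma msize_mono (X Y : {mpoly C[3]}) a b d : X \is 1.-homog -> Y \is 1.-homog ->
  (a + b < d)%N -> (msize (X ^+ a * Y ^+ b) <= d)%N.
Proof.
move=> /msize_lin sX /msize_lin sY abd.
apply: leq_trans (msizeM_bound (msizeX_le a sX) (msizeX_le b sY)) _; lia.
Qed.

Lemma zeta_ebase d j : (j <= d.*2)%N -> divisible_form d.+1 (zeta * ebase d j).
Proof.
move=> jd; have -> : zeta * ebase d j = ebase d.+1 j.+1.
  rewrite /ebase ltnS doubleS !subSS; case: ifP => jd'; rewrite mulrCA -exprS //.
  by congr (_ * _ ^+ _); lia.
by apply: divisible_form_ebase; lia.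
Qed.

Lemma xi_ebase d j : (j <= d.*2)%N -> divisible_form d.+1 (xi * ebase d j).
Proof.
move=> jd; have [jd'|jd'] := ltnP j d; last first.
  have -> : xi * ebase d j = ebase d.+1 j.+2.
    rewrite /ebase !ltnS ltnNge jd' doubleS /=; case: ifP => jd''; last first.
      by rewrite mulrA -exprS; congr (_ ^+ _ * _ ^+ _); lia.
    have -> : j = d by lia.
    by rewrite subnn subSS subSn // subnn expr0 mul1r expr1; congr (_ * _ ^+ _); lia.
  by apply: divisible_form_ebase; lia.
have -> : xi * ebase d j =
    quad * (eta ^+ (d - j.+1) * zeta ^+ j) + (-1) *: ebase d.+1 j.+2.
  rewrite /ebase ltnW // ltnS jd' scaleN1r /quad (_ : (d - j = (d - j.+1).+1)%N); last by lia.
  rewrite (_ : (d.+1 - j.+2 = d - j.+1)%N); last by lia.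
  by rewrite !exprS; ring.
apply: divisible_formD; last first.
  by apply: divisible_formZ; apply: divisible_form_ebase; lia.
apply: divisible_form_quad; apply: msize_mono; [exact: eta_homog|exact: X_homog|lia].
Qed.

Lemma eta_ebase d j : (j <= d.*2)%N -> divisible_form d.+1 (eta * ebase d j).
Proof.
move=> jd; have [jd'|jd'] := leqP j d.
  have -> : eta * ebase d j = ebase d.+1 j.
    by rewrite /ebase jd' leqW // mulrA -exprS subSn.
  by apply: divisible_form_ebase; lia.
have -> : eta * ebase d j =
    quad * (xi ^+ (j - d.+1) * zeta ^+ (d.*2 - j)) + (-1) *: ebase d.+1 j.
  rewrite /ebase leqNgt jd' doubleS /= scaleN1r /quad (_ : (j - d = (j - d.+1).+1)%N); last by lia.
  case: ifP => jd''; last first.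
    rewrite (_ : (d.*2.+2 - j = (d.*2 - j).+2)%N); last by lia.
    by rewrite !exprS; ring.
  have -> : j = d.+1 by lia.
  have -> : zeta ^+ d.+1 = zeta ^+ (d.*2 - d.+1).+2 by congr (_ ^+ _); lia.
  by rewrite subnn !exprS expr0; ring.
apply: divisible_formD; last first.
  by apply: divisible_formZ; apply: divisible_form_ebase; lia.
apply: divisible_form_quad; apply: msize_mono; [exact: xi_homog|exact: X_homog|lia].
Qed.
End Pullback.

(** * Polynomials vanishing on the conic *)

Section ConicIdeal.
Variable R : realType.
Local Notation C := R[i].
Local Notation toC := (real_complex R).
Local Notation xi := (xi R).
Local Notation eta := (eta R).
Local Notation zeta := (zeta R).
Local Notation quad := (quad R).
Local Notation divisible_form := (@divisible_form R).

Lemma X0E : 'X_0 = (2^-1 : C) *: (xi + eta).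
Proof.
have -> : xi + eta = 2%:R *: 'X_0.
  by rewrite /xi /eta scaler_nat; move: ('i%C *: 'X_1) => Y; ring.
by rewrite scalerA mulVf ?scale1r // pnatr_eq0.
Qed.

Lemma X1E : 'X_1 = (- ('i%C / 2)) *: (xi - eta) :> {mpoly C[3]}.
Proof.
have -> : xi - eta = 2%:R *: ('i%C *: 'X_1).
  by rewrite /xi /eta scaler_nat; move: ('i%C *: 'X_1) => Y; ring.
rewrite !scalerA (_ : _ * _ = 1) ?scale1r //.
have n2 : (2 : C) != 0 by rewrite pnatr_eq0.
by transitivity (- 'i%C ^+ 2 : C); [field|rewrite sqr_i opprK].
Qed.

Lemma divisible_formX d F (i : 'I_3) :
  divisible_form d F -> divisible_form d.+1 ('X_i * F).
Proof.
have hxi : divisible_form d F -> divisible_form d.+1 (xi * F).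
  by apply: divisible_form_mul; [exact/msize_lin/xi_homog|exact: xi_ebase].
have heta : divisible_form d F -> divisible_form d.+1 (eta * F).
  by apply: divisible_form_mul; [exact/msize_lin/eta_homog|exact: eta_ebase].
move=> hF; case: (ord3P i) => ->.
- rewrite X0E -scalerAl mulrDl; apply: divisible_formZ.
  by apply: divisible_formD; [exact: hxi|exact: heta].
- rewrite X1E -scalerAl mulrBl; apply: divisible_formZ; rewrite -scaleN1r.
  by apply: divisible_formD; [exact: hxi|apply: divisible_formZ; exact: heta].
- by apply: divisible_form_mul hF; [exact/msize_lin/X_homog|exact: zeta_ebase].
Qed.

Lemma divisible_form1 : divisible_form 0 (1 : {mpoly C[3]}).
Proof.
exists (fun=> 1), 0; rewrite mmeasure0; split => //.
by rewrite big_ord1 mulr0 addr0 scale1r /ebase /= mulr1.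
Qed.

Lemma divisible_formXn d F (i : 'I_3) n :
  divisible_form d F -> divisible_form (n + d) ('X_i ^+ n * F).
Proof.
move=> hF; elim: n => [|n IH]; first by rewrite mul1r.
by rewrite exprS -mulrA; exact: divisible_formX.
Qed.

Lemma divisible_form_homog d (P : {mpoly C[3]}) : P \is d.-homog -> divisible_form d P.
Proof.
move=> /dhomogP hP; rewrite (mpolyE P) big_seq.
apply: (big_ind (divisible_form d)).
- exact: divisible_form0.
- exact: divisible_formD.
move=> m /hP /= md; apply: divisible_formZ.
have mdE : (m 0%R + (m 1%R + (m 2%R + 0)))%N = d.
  by rewrite -md mdegE sum3 addn0 addnA.
rewrite mpolyXE_id -mdE prod3 -mulrA; do 2 apply: divisible_formXn.
by rewrite -[X in divisible_form _ X]mulr1; apply: divisible_formXn; exact: divisible_form1.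
Qed.

Lemma conic_xi t : xi.@[conic t] = - 2 * t ^+ 2.
Proof.
by rewrite /xi mevalD mevalZ !mevalXU conic0 conic1 mulrA -expr2 sqr_i; ring.
Qed.

Lemma conic_eta t : eta.@[conic t] = 2.
Proof.
by rewrite /eta mevalB mevalZ !mevalXU conic0 conic1 mulrA -expr2 sqr_i; ring.
Qed.

Lemma conic_zeta t : zeta.@[conic t] = 2 * t.
Proof. by rewrite mevalXU conic2. Qed.

Lemma conic_quad t : quad.@[conic t] = 0.
Proof.
by rewrite /quad mevalD mevalM rmorphXn /= conic_xi conic_eta conic_zeta; ring.
Qed.

Lemma conic_ebase d j : (j <= d.*2)%N -> exists2 k : C, k != 0 &
  forall t, (ebase R d j).@[conic t] = k * t ^+ j.
Proof.
move=> jd; have n2 : (2 : C) != 0 by rewrite pnatr_eq0.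
rewrite /ebase; case: ifP => jd'.
  exists (2 ^+ (d - j) * 2 ^+ j); first by rewrite mulf_neq0 ?expf_neq0.
  by move=> s; rewrite mevalM !rmorphXn /= conic_eta conic_zeta exprMn mulrA.
exists ((- 2) ^+ (j - d) * 2 ^+ (d.*2 - j)).
  by rewrite mulf_neq0 ?expf_neq0 // oppr_eq0.
move=> s; rewrite mevalM !rmorphXn /= conic_xi conic_zeta (exprMn _ (- 2)) (exprMn _ 2) mulrACA -exprM -exprD.
by congr (_ * _ ^+ _); lia.
Qed.

(** The remainder of the division has one coefficient for each power of t, up to
    nonzero factors, so it is zero as soon as its restriction to the conic is:
    the ideal of the conic is generated by the quadratic form. *)
Lemma pull_eq0_divisible d (P : {mpoly R[3]}) : P \is d.-homog -> pull P = 0 ->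
  exists Q : {mpoly C[3]}, (msize Q <= d)%N /\ cmpoly P = quad * Q.
Proof.
move=> hP P0.
have hcP : cmpoly P \is d.-homog.
  apply/dhomogP => m; rewrite mcoeff_msupp mcoeff_map_mpoly => hm.
  move: hP => /dhomogP; apply; rewrite mcoeff_msupp; apply: contraNneq hm => ->.
  exact/eqP/(rmorph0 toC).
have [a [Q [sQ PE]]] := divisible_form_homog hcP.
exists Q; split => //; rewrite PE big1 ?add0r // => -[j hj] _ /=.
pose kk (i : 'I_(d.*2).+1) := cid2 (@conic_ebase d i (ltnSE (ltn_ord i))).
pose K (i : 'I_(d.*2).+1) := s2val (kk i).
have p0 : \sum_(i < (d.*2).+1) (a i * K i) *: 'X^i = 0 :> {poly C}.
  apply: poly_eq_punctured => t _; rewrite horner_sum horner0.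
  have := pull_horner P t; rewrite P0 horner0 PE mevalD mevalM conic_quad mul0r addr0.
  rewrite raddf_sum /= => h; rewrite [RHS]h; apply: eq_bigr => i _.
  by rewrite hornerZ hornerXn mevalZ -mulrA (s2valP' (kk i) t).
have /(congr1 (fun p : {poly C} => p`_j)) := p0.
rewrite coef0 coef_sum (bigD1 (Ordinal hj)) //= coefZ coefXn eqxx mulr1.
rewrite big1 => [|i ij]; last first.
  by rewrite coefZ coefXn -val_eqE /= eq_sym in ij *; rewrite (negPf ij) mulr0.
rewrite addr0 => /eqP; rewrite mulf_eq0 => /orP[/eqP ->|]; first by rewrite scale0r.
by rewrite (negPf (s2valP (kk (Ordinal hj)))).
Qed.
End ConicIdeal.

(** * Products of linear forms on the sphere: existence *)

Section SphereProducts.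
Variable R : realType.
Local Notation C := R[i].
Local Notation toC := (real_complex R).

(** On the real sphere the quotient of a real polynomial by the quadratic form,
    although computed over the complex numbers, can be replaced by its real
    part. *)
Definition re_mpoly (Q : {mpoly C[3]}) : {mpoly R[3]} :=
  \sum_(m <- msupp Q) complex.Re Q@_m *: 'X_[m].

Lemma msize_re_mpoly d Q : (msize Q <= d)%N -> (msize (re_mpoly Q) <= d)%N.
Proof.
move=> sQ; rewrite /re_mpoly big_seq.
apply: (big_ind (fun P : {mpoly R[3]} => (msize P <= d)%N)).
- by rewrite mmeasure0.
- by move=> x y sx sy; apply: leq_trans (mmeasureD_le _ _ _) _; rewrite geq_max sx sy.
move=> m /msize_mdeg_lt hm; apply: leq_trans (msizeZ_le _ _) _.
by rewrite msizeX; exact: leq_trans hm sQ.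
Qed.

Lemma ReD (x y : C) : complex.Re (x + y) = complex.Re x + complex.Re y.
Proof. by case: x; case: y. Qed.

Lemma re_mpolyE Q (v : 'I_3 -> R) :
  (re_mpoly Q).@[v] = complex.Re Q.@[fun i => toC (v i)].
Proof.
rewrite [in RHS]mevalE (big_morph _ ReD (erefl : complex.Re 0 = 0)) /re_mpoly raddf_sum /=.
apply: eq_bigr => m _; rewrite mevalZ mevalX.
have -> : \prod_(i < 3) toC (v i) ^+ m i = toC (\prod_(i < 3) v i ^+ m i).
  by rewrite (rmorph_prod toC); apply: eq_bigr => i _ /=; rewrite -[RHS]/(toC _) (rmorphXn toC).
by case: (Q@_m) => a b /=; rewrite mulr0 subr0.
Qed.

Definition coords (v : 'rV[R]_3) (i : 'I_3) : R := v 0 i.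

Lemma quad_real (v : 'rV[R]_3) :
  (quad R).@[fun i => toC (coords v i)] = toC (sqnorm v).
Proof.
rewrite /sqnorm sum3 /quad mevalD mevalM rmorphXn /xi /eta /zeta.
rewrite mevalD mevalB mevalZ /= !mevalXU /coords !expr2.
by apply: eq_cplx => /=; ring.
Qed.

(** On the sphere the quadratic form equals 1, so a form that is divisible by it
    agrees there with the quotient, which has lower degree. *)
Lemma sphere_reduce d (P : {mpoly R[3]}) : P \is d.-homog -> pull P = 0 ->
  exists Q : {mpoly R[3]}, (msize Q <= d)%N /\
    forall v, unit_sphere v -> P.@[coords v] = Q.@[coords v].
Proof.
move=> hP /(pull_eq0_divisible hP)[Q [sQ QE]].
exists (re_mpoly Q); split; first exact: msize_re_mpoly.
move=> v; rewrite /unit_sphere /= => v1; rewrite re_mpolyE.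
have := cmpoly_real P (coords v); rewrite QE mevalM quad_real v1.
by rewrite mul1r => ->.
Qed.

Lemma linformE w (v : 'rV[R]_3) : linform w v = (mlin w).@[coords v].
Proof. by rewrite mlinE. Qed.

Lemma prod_linformE k (w : 'I_k -> 'rV[R]_3) v :
  \prod_(j < k) linform (w j) v = (\prod_(j < k) mlin (w j)).@[coords v].
Proof. by rewrite rmorph_prod; apply: eq_bigr => j _; rewrite linformE. Qed.

(** The pullback of P splits by Sylvester's argument into quadratics of real
    linear forms; P minus the product of these forms vanishes on the conic, hence
    drops in degree on the sphere. *)
Lemma homog_sphere_product d (P : {mpoly R[3]}) : P \is d.+1.-homog ->
  exists (w : 'I_d.+1 -> 'rV[R]_3) (Q : {mpoly R[3]}), (msize Q <= d.+1)%N /\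
    forall v, unit_sphere v ->
      P.@[coords v] = \prod_(j < d.+1) linform (w j) v + Q.@[coords v].
Proof.
move=> hP; have [sP starP] := stable_pull hP.
have [c [w pE]] := star_factor sP starP.
(* The scalar of the factorization is absorbed into the first linear form. *)
pose w' j := if j == 0 then c *: w j else w j.
have hM : \prod_(j < d.+1) mlin (w' j) \is d.+1.-homog.
  by apply: prod_homog => j; exact: mlin_homog.
have [||Q [sQ QE]] := @sphere_reduce d.+1 (P - \prod_(j < d.+1) mlin (w' j)).
- exact: rpredB.
- rewrite rmorphB rmorph_prod /= pE; apply/eqP; rewrite subr_eq0; apply/eqP.
  rewrite !big_ord_recl /= mulrA -lquadZ pull_mlin /w' eqxx; congr (_ * _).
  by apply: eq_bigr => j _; rewrite pull_mlin.
exists w', Q; split => // v v1.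
by rewrite prod_linformE -QE // mevalB addrC subrK.
Qed.

Lemma msizeD_bound d (P Q : {mpoly R[3]}) :
  (msize P <= d)%N -> (msize Q <= d)%N -> (msize (P + Q) <= d)%N.
Proof.
by move=> sP sQ; apply: leq_trans (mmeasureD_le _ _ _) _; rewrite geq_max sP sQ.
Qed.

Lemma msize_homog_lt d (P : {mpoly R[3]}) : P \is d.-homog -> (msize P <= d.+1)%N.
Proof.
move=> /dhomogP h; rewrite msizeE; apply/bigmax_leqP_seq => m /h /= hm _.
by rewrite ltnS -[X in (X <= _)%N]/(mdeg m) hm.
Qed.

(** Peeling off the part of top degree, which homog_sphere_product turns into one
    product plus terms of lower degree. *)
Lemma sphere_products D (P : {mpoly R[3]}) : (msize P <= D.+1)%N ->
  exists (lam : R) (L : forall k, 'I_k -> 'rV[R]_3), forall v, unit_sphere v ->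
    P.@[coords v] = lam + \sum_(1 <= k < D.+1) \prod_(j < k) linform (L k j) v.
Proof.
elim: D P => [|D IH] P sP.
  exists P@_0%MM, (fun _ _ => 0) => v _; rewrite big_geq // addr0.
  by rewrite {1}(msize1_polyC sP) mevalC.
have PE := pihomog_partitionE sP; rewrite big_ord_recr /= in PE.
have [w [Q [sQ QE]]] := homog_sphere_product (pihomogP mdeg D.+1 P).
have [|lam [L LE]] := IH (\sum_(i < D.+1) pihomog mdeg i P + Q).
  apply: msizeD_bound => //.
  apply: (big_ind (fun P : {mpoly R[3]} => (msize P <= D.+1)%N)).
  - by rewrite mmeasure0.
  - exact: msizeD_bound.
  - by move=> i _; apply: leq_trans (msize_homog_lt (pihomogP mdeg i P)) _.
pose L' k : 'I_k -> 'rV[R]_3 :=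
  if eqVneq k D.+1 is EqNotNeq e then fun j => w (cast_ord e j) else L k.
exists lam, L' => v v1.
rewrite PE mevalD QE // addrCA -mevalD LE //.
rewrite [LHS]addrCA [in RHS]big_nat_recr //=; congr (_ + _); rewrite addrC; congr (_ + _).
- rewrite [LHS]big_nat [RHS]big_nat; apply: eq_bigr => k /andP[_ kD].
  rewrite /L'; case: eqVneq => // e; first by rewrite e ltnn in kD.
- rewrite /L'; case: eqVneq => [e|]; last by rewrite eqxx.
  by apply: eq_bigr => j _; rewrite cast_ord_id.
Qed.
End SphereProducts.

(** * Products of linear forms on the sphere: uniqueness *)

Section SphereUnique.
Variable R : realType.
Local Notation C := R[i].
Local Notation toC := (real_complex R).

Lemma cmpolyZ c (P : {mpoly R[3]}) : cmpoly (c *: P) = toC c *: cmpoly P.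
Proof. exact: map_mpolyZ. Qed.

Lemma cmpolyM (P Q : {mpoly R[3]}) : cmpoly (P * Q) = cmpoly P * cmpoly Q.
Proof. exact: (rmorphM (map_mpoly toC)). Qed.

Lemma cmpolyXn (P : {mpoly R[3]}) n : cmpoly (P ^+ n) = cmpoly P ^+ n.
Proof. exact: (rmorphXn (map_mpoly toC)). Qed.

Lemma cmpoly_sum n (F : 'I_n -> {mpoly R[3]}) : cmpoly (\sum_i F i) = \sum_i cmpoly (F i).
Proof. exact: (rmorph_sum (map_mpoly toC)). Qed.

(** Kronecker substitution: on the curve (s, s^N, s^(N^2)) with N larger than
    all exponents distinct monomials become distinct powers of s, so the
    restriction is a one-variable polynomial with the same coefficients. *)
Lemma mpoly_vanish (P : {mpoly R[3]}) : (forall v : 'I_3 -> R, P.@[v] = 0) -> P = 0.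
Proof.
move=> P0; apply/mpolyP => m0; rewrite mcoeff0.
have [m0P|m0P] := boolP (m0 \in msupp P); last exact: memN_msupp_eq0.
pose N := msize P.
pose ex (m : 'X_{1..3}) := (m 0%R + N * (m 1%R + N * m 2%R))%N.
have lt_N (m : 'X_{1..3}) i : m \in msupp P -> (m i < N)%N.
  move=> /msize_mdeg_lt; apply: leq_trans; rewrite ltnS mdegE (bigD1 i) //=; exact: leq_addr.
have ex_inj m : m \in msupp P -> ex m = ex m0 -> m = m0.
  move=> mP; rewrite /ex => e.
  have e0 : m 0%R = m0 0%R.
    have := congr1 (modn^~ N) e; rewrite ![(_ + N * _)%N]addnC ![(N * _)%N]mulnC !modnMDl.
    by rewrite !modn_small // lt_N.
  have N0 : (0 < N)%N by apply: leq_trans (lt_N _ 0 m0P).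
  move/eqP: e; rewrite e0 eqn_add2l eqn_pmul2l // => /eqP e.
  have e1 : m 1%R = m0 1%R.
    have := congr1 (modn^~ N) e; rewrite ![(_ + N * _)%N]addnC ![(N * _)%N]mulnC !modnMDl.
    by rewrite !modn_small // lt_N.
  move/eqP: e; rewrite e1 eqn_add2l eqn_pmul2l // => /eqP e2.
  by apply/mnmP => i; case: (ord3P i) => ->.
pose p : {poly R} := \sum_(m <- msupp P) P@_m *: 'X^(ex m).
have p0 : p = 0.
  apply: nat_roots_poly0 => n; set s := n%:R.
  have := P0 (fun i => s ^+ (if i == 0 then 1 else if i == 1 then N else N * N)).
  rewrite mevalE /p horner_sum => h; rewrite -[RHS]h.
  apply: eq_bigr => m _; rewrite hornerZ hornerXn prod3 /= expr1 -!exprM.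
  by rewrite -!exprD; congr (_ * _ ^+ _); rewrite /ex; lia.
have /(congr1 (fun q : {poly R} => q`_(ex m0))) := p0.
rewrite coef0 coef_sum (bigD1_seq m0) ?msupp_uniq //= coefZ coefXn eqxx mulr1.
rewrite big_seq_cond big1 ?addr0 // => m /andP[mP mm0].
rewrite coefZ coefXn; case: eqP => [/esym/ex_inj|_]; last by rewrite mulr0.
by move=> /(_ mP) mm; rewrite mm eqxx in mm0.
Qed.

Lemma homog_scale d (P : {mpoly R[3]}) r (v : 'I_3 -> R) : P \is d.-homog ->
  P.@[fun i => r * v i] = r ^+ d * P.@[v].
Proof.
move=> /dhomogP h; rewrite !mevalE mulr_sumr !big_seq; apply: eq_bigr => m /h /= md.
rewrite mulrCA; congr (_ * _); rewrite -md mdegE.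
by under eq_bigr do rewrite exprMn; rewrite big_split /= prodrXr.
Qed.

Definition rquad : {mpoly R[3]} := \sum_(i < 3) 'X_i ^+ 2.

Lemma rquadE (v : 'rV[R]_3) : rquad.@[coords v] = sqnorm v.
Proof. by rewrite raddf_sum; apply: eq_bigr => i _ /=; rewrite rmorphXn /= mevalXU. Qed.

Lemma cquad_rquad : cmpoly rquad = quad R.
Proof.
rewrite /cmpoly rmorph_sum sum3 /= !rmorphXn /= !map_mpolyX /quad /xi /eta /zeta.
by rewrite (mulrC ('X_0 + _)) -subr_sqr exprZn sqr_i scaleN1r opprK.
Qed.

Lemma sqnormZ r (v : 'rV[R]_3) : sqnorm (r *: v) = r ^+ 2 * sqnorm v.
Proof. by rewrite /sqnorm mulr_sumr; apply: eq_bigr => i _; rewrite mxE exprMn. Qed.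

Lemma sqnorm_ge0 (v : 'rV[R]_3) : 0 <= sqnorm v.
Proof. by apply: sumr_ge0 => i _; exact: sqr_ge0. Qed.

Lemma sqnorm_eq0 (v : 'rV[R]_3) : sqnorm v = 0 -> v = 0.
Proof.
move=> h; apply/rowP => i; rewrite mxE; apply/eqP; rewrite -sqrf_eq0.
have := @psumr_eq0P _ _ predT (fun i => v 0 i ^+ 2) (fun i _ => sqr_ge0 _) h.
by move=> /(_ i isT) ->.
Qed.

Lemma unit_e1 : unit_sphere (row3 1 0 0 : 'rV[R]_3).
Proof. by rewrite /unit_sphere /= sqnorm_row3 !expr0n /= expr1n !addr0. Qed.

Lemma normalize (v : 'rV[R]_3) : v != 0 ->
  exists r u, [/\ 0 < r, r ^+ 2 = sqnorm v, unit_sphere u & v = r *: u].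
Proof.
move=> v0; have n0 : 0 < sqnorm v.
  by rewrite lt_def sqnorm_ge0 andbT; apply: contraNneq v0 => /sqnorm_eq0 ->.
have r0 : 0 < Num.sqrt (sqnorm v) by rewrite sqrtr_gt0.
have rr : Num.sqrt (sqnorm v) ^+ 2 = sqnorm v by rewrite sqr_sqrtr // ltW.
have rn : Num.sqrt (sqnorm v) != 0 by rewrite gt_eqF.
exists (Num.sqrt (sqnorm v)), ((Num.sqrt (sqnorm v))^-1 *: v); split=> //.
  by rewrite /unit_sphere /= sqnormZ -{2}rr exprVn mulVf // expf_neq0.
by rewrite scalerA divff // scale1r.
Qed.

(** Replacing a relation on the sphere by its even or odd part, according to the
    parity of D, and multiplying the term of degree k by the power of the
    quadratic form that raises it to degree D gives a homogeneous polynomial E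
    that vanishes on the whole space.  Restricted to the conic, where the
    quadratic form is zero, E reduces to its term of degree D. *)
Lemma top_vanish D (c : nat -> {mpoly R[3]}) : (forall k, c k \is k.-homog) ->
  (forall v, unit_sphere v -> \sum_(k < D.+1) (c k).@[coords v] = 0) ->
  pull (c D) = 0.
Proof.
move=> hc hz.
(* Equal to 2 when k has the parity of D, and to 0 otherwise. *)
pose eps k : R := 1 + (-1) ^+ (D + k).
pose E : {mpoly R[3]} := \sum_(k < D.+1) eps k *: (rquad ^+ (D - k)./2 * c k).
have EE (v : 'rV[R]_3) : E.@[coords v] =
    \sum_(k < D.+1) eps k * (sqnorm v ^+ (D - k)./2 * (c k).@[coords v]).
  rewrite raddf_sum; apply: eq_bigr => k _ /=.
  by rewrite mevalZ mevalM rmorphXn /= rquadE.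
have cscale k r v : (c k).@[coords (r *: v)] = r ^+ k * (c k).@[coords v].
  by rewrite -(homog_scale _ _ (hc k)); apply: meval_eq => i; rewrite /coords mxE.
have E0 (v : 'rV[R]_3) : E.@[coords v] = 0.
  have [->|v0] := eqVneq v 0.
    rewrite EE big_ord_recr /= subnn expr0 mul1r big1 => [|k _]; last first.
      have [kD|] := boolP (odd (D - k)).
        rewrite /eps -signr_odd oddD -oddB ?kD; last exact: ltnW.
        by rewrite expr1 subrr mul0r.
      move=> /even_halfK eD; have : (0 < (D - k)./2)%N by have := ltn_ord k; lia.
      have -> : sqnorm (0 : 'rV[R]_3) = 0.
        by rewrite -(scale0r (0 : 'rV[R]_3)) sqnormZ expr0n mul0r.
      by case: (_./2) => // n _; rewrite expr0n mul0r mulr0.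
    rewrite add0r; pose u := row3 1 0 0 : 'rV[R]_3.
    rewrite -(scale0r u) cscale; case: (D) hz => [|n] hz; last by rewrite expr0n mul0r mulr0.
    by have := hz u; rewrite big_ord1 expr0 mul1r => ->; [rewrite mulr0|exact: unit_e1].
  have [r [u [_ rr u1 vE]]] := normalize v0.
  have u2 : unit_sphere (- u).
    by rewrite /unit_sphere /= -scaleN1r sqnormZ sqrrN expr1n mul1r.
  have := hz u u1; have := hz _ u2; rewrite -scaleN1r => h2 h1.
  transitivity (r ^+ D * (\sum_(k < D.+1) (c k).@[coords u]
      + (-1) ^+ D * \sum_(k < D.+1) (c k).@[coords (-1 *: u)])); last first.
    by rewrite h1 h2 mulr0 addr0 mulr0.
  rewrite EE [X in _ + X]mulr_sumr -big_split mulr_sumr /=; apply: eq_bigr => k _.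
  rewrite (cscale _ (-1)) -rr -exprM.
  have -> : (c k).@[coords v] = r ^+ k * (c k).@[coords u] by rewrite vE cscale.
  have [kD|kD] := boolP (odd (D - k)).
    have -> : eps k = 0.
      rewrite /eps -signr_odd oddD -oddB ?kD; last by rewrite -ltnS.
      by rewrite expr1 subrr.
    rewrite mul0r [X in _ + X]mulrA -exprD -signr_odd oddD -oddB ?kD; last by rewrite -ltnS.
    by rewrite expr1 mulN1r subrr mulr0.
  have -> : (2 * (D - k)./2 = D - k)%N by rewrite mul2n even_halfK.
  have -> : r ^+ D = r ^+ (D - k) * r ^+ k by rewrite -exprD subnK // -ltnS.
  by rewrite /eps exprD; ring.
have cE0 : E = 0.
  apply: mpoly_vanish => v.
  have -> : E.@[v] = E.@[coords (\row_i v i)] by apply: meval_eq => i; rewrite /coords mxE.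
  exact: E0.
apply: poly_eq_punctured => t _; rewrite horner0 pull_horner.
have : (cmpoly E).@[conic t] = 0 by rewrite cE0 /cmpoly (raddf0 (map_mpoly toC)) meval0.
rewrite /E cmpoly_sum (raddf_sum (meval (conic t))) big_ord_recr /=.
rewrite subnn expr0 mul1r big1 ?add0r => [|k _]; last first.
  rewrite cmpolyZ mevalZ.
  have [kD|] := boolP (odd (D - k)).
    rewrite /eps -signr_odd oddD -oddB ?kD; last exact: ltnW.
    by rewrite expr1 subrr (rmorph0 toC) mul0r.
  move=> /even_halfK eD; have : (0 < (D - k)./2)%N by have := ltn_ord k; lia.
  case: (_./2) => // n _; rewrite cmpolyM mevalM cmpolyXn rmorphXn /=.
  by rewrite cquad_rquad conic_quad expr0n mul0r mulr0.
have two_neq0 : toC (1 + 1) != 0.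
  by apply/eqP => -[/eqP]; rewrite -mulr2n pnatr_eq0.
rewrite cmpolyZ mevalZ /eps addnn -signr_odd odd_double expr0 => /eqP.
by rewrite mulf_eq0 (negPf two_neq0) => /eqP.
Qed.

Lemma linformZ (c : R) w v : linform (c *: w) v = c * linform w v.
Proof. by rewrite /linform mulr_sumr; apply: eq_bigr => i _; rewrite mxE mulrA. Qed.

(** When the product is nonzero the matching of the factors comes from common
    roots, and the constants multiply to 1 because the products agree; a zero
    product forces a zero factor on both sides. *)
Lemma prod_lquad_same k (u w : 'I_k -> 'rV[R]_3) :
  \prod_(j < k) lquad (u j) = \prod_(j < k) lquad (w j) ->
  same_factors u w /\
  (forall v, \prod_(j < k) linform (u j) v = \prod_(j < k) linform (w j) v).
Proof.
move=> uw; have [u0|u0] := eqVneq (\prod_(j < k) lquad (u j)) 0.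
  have /eqP/prodf_eq0[j _] := u0; rewrite lquad_eq0 => /eqP uj.
  have /eqP/prodf_eq0[i _] := esym (etrans (esym u0) uw); rewrite lquad_eq0 => /eqP wi.
  split; first by right; split; [exists j|exists i].
  move=> v; rewrite (bigD1 j) //= [RHS](bigD1 i) //= uj wi.
  by rewrite -(scale0r 0) linformZ !mul0r.
pose us := [tuple u i | i < k]; pose ws := [tuple w i | i < k].
have prodE (f : 'I_k -> 'rV[R]_3) : \prod_(x <- [tuple f i | i < k]) lquad x = \prod_(j < k) lquad (f j).
  by rewrite big_tuple; apply: eq_bigr => j _; rewrite tnth_mktuple.
have nthE (f : 'I_k -> 'rV[R]_3) (j : 'I_k) : nth 0 [tuple f i | i < k] j = f j.
  by rewrite -tnth_nth tnth_mktuple.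
have [|||vs pvs hvs] := @prod_lquad_unique R 1 us ws.
- by rewrite !size_tuple.
- have one : (toC 1)%:P = 1 :> {poly C} by exact: polyC1.
  by rewrite one (prodE u) uw -(prodE w) mul1r.
- by rewrite (prodE u).
move: pvs; rewrite perm_sym => /tuple_permP[s vsE].
have hc j : exists c : R, w j = c *: u (s j).
  have := hvs j; rewrite size_tuple ltn_ord => /(_ isT)[c]; exists c.
  by move: p; rewrite vsE /ws !nthE tnth_mktuple.
pose c j := projT1 (cid (hc j)).
have wE j : w j = c j *: u (s j) by rewrite /c; case: cid.
have c1 : \prod_j c j = 1.
  have := uw; under [X in _ = X]eq_bigr do rewrite wE lquadZ.
  rewrite big_split /= (reindex_inj (@perm_inj _ s)) /=.
  rewrite (reindex_inj (@perm_inj _ s)) /= in u0.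
  rewrite -{1}[X in X = _]mul1r => /(mulIf u0).
  rewrite -(rmorph_prod (@polyC _)) -(rmorph_prod toC) /= => /polyC_inj.
  by move=> /(congr1 (@complex.Re R)) /= <-.
split; first by left; exists s, c.
move=> v; under [RHS]eq_bigr do rewrite wE linformZ.
by rewrite big_split /= c1 mul1r [LHS](reindex_inj (@perm_inj _ s)).
Qed.

(** The difference of two representations is a relation between forms of
    degrees 0 to D on the sphere; its top term vanishes on the conic, so the two
    top products are equal and can be cancelled. *)
Lemma sphere_products_unique D (lam lam' : R) (L L' : forall k, 'I_k -> 'rV[R]_3) :
  (forall v, unit_sphere v ->
    lam + \sum_(1 <= k < D.+1) \prod_(j < k) linform (L k j) v =
    lam' + \sum_(1 <= k < D.+1) \prod_(j < k) linform (L' k j) v) ->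
  lam = lam' /\ forall k, (1 <= k <= D)%N -> same_factors (L k) (L' k).
Proof.
elim: D => [|D IH] h.
  split; last by case.
  have := h (row3 1 0 0); rewrite !big_geq // !addr0; apply; exact: unit_e1.
pose c k : {mpoly R[3]} := if k is 0 then (lam - lam')%:MP else
  \prod_(j < k) mlin (L k j) - \prod_(j < k) mlin (L' k j).
have hc k : c k \is k.-homog.
  case: k => [|k]; last by apply: rpredB; apply: prod_homog => j; exact: mlin_homog.
  by rewrite /c -[_%:MP]mulr1 mul_mpolyC; apply: rpredZ; exact: dhomog1.
have /(top_vanish hc) : forall v, unit_sphere v -> \sum_(k < D.+2) (c k).@[coords v] = 0.
  move=> v v1; rewrite big_ord_recl /= mevalC; apply/eqP.
  have /eqP := h v v1; rewrite -subr_eq0 opprD addrACA -sumrB.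
  rewrite big_add1 /= big_mkord; congr (_ + _ == _).
  by apply: eq_bigr => k _; rewrite mevalB !prod_linformE.
rewrite /c rmorphB !rmorph_prod /= => /eqP; rewrite subr_eq0 => /eqP.
have pullE (f : 'I_D.+1 -> 'rV[R]_3) :
    \prod_(j < D.+1) pull (mlin (f j)) = \prod_(j < D.+1) lquad (f j).
  by apply: eq_bigr => j _; rewrite pull_mlin.
rewrite !pullE.
move=> /prod_lquad_same[sf pe].
have [v v1|-> sfk] := IH.
  by have := h v v1; rewrite [in LHS]big_nat_recr //= [in RHS]big_nat_recr //= !addrA pe => /addIr.
split=> // k /andP[k0]; rewrite leq_eqVlt => /predU1P[->//|kD].
by apply: sfk; rewrite k0.
Qed.
End SphereUnique.

(** * Topology of the sphere *)

Section SphereTopology.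
Variable R : realType.
Local Notation S2 := (S2 R).

Lemma S2val_sphere (p : S2) : unit_sphere (S2val p).
Proof. exact: (set_mem (valP p)). Qed.

Lemma S2val_inj : injective (@S2val R).
Proof. exact: val_inj. Qed.

Lemma S2valK v (hv : unit_sphere v) : S2val (mkS2 hv) = v :> 'rV[R]_3.
Proof. by []. Qed.

Lemma continuous_S2val : continuous (@S2val R).
Proof. exact: initial_continuous. Qed.

Lemma continuous_coord i : continuous (fun p : S2 => S2val p 0 i).
Proof.
move=> p; apply: (@continuous_comp _ _ _ (@S2val R) (fun v : 'rV[R]_3 => v 0 i)).
  exact: continuous_S2val.
exact: coord_continuous.
Qed.

Lemma continuous_sqnorm : continuous (@sqnorm R).
Proof.
have csq i : continuous (fun v : 'rV[R]_3 => v 0 i ^+ 2).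
  move=> v; apply: (@continuous_comp _ _ _ (fun v : 'rV[R]_3 => v 0 i) (fun x => x ^+ 2)).
    exact: coord_continuous.
  exact: exprn_continuous.
have -> : @sqnorm R = (fun v => v 0 0 ^+ 2 + v 0 1 ^+ 2 + v 0 2 ^+ 2).
  by apply/funext => v; rewrite /sqnorm sum3.
by move=> v; exact: (cvgD (cvgD (csq 0 v) (csq 1 v)) (csq 2 v)).
Qed.

Lemma coord_le_sqnorm (v : 'rV[R]_3) i : v 0 i ^+ 2 <= sqnorm v.
Proof.
rewrite /sqnorm (bigD1 i) //= lerDl; apply: sumr_ge0 => j _; exact: sqr_ge0.
Qed.

Lemma coord_sphere_le1 (v : 'rV[R]_3) i : unit_sphere v -> `|v 0 i| <= 1.
Proof.
rewrite /unit_sphere /= => v1; rewrite -(ler_pXn2r (_ : 0 < 2)%N) ?nnegrE //.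
by rewrite expr1n real_normK ?num_real // -v1 coord_le_sqnorm.
Qed.

Lemma unit_sphere_compact : compact (@unit_sphere R).
Proof.
apply: bounded_closed_compact.
  exists 1; split => //.
  move=> M M1 v v1 /=; rewrite /Num.norm /= mx_normrE.
  apply/bigmax_leP; split; first by rewrite (le_trans _ (ltW M1)).
  move=> [i j] _ /=; rewrite (ord1 i); apply: le_trans (ltW M1).
  exact: coord_sphere_le1.
have -> : @unit_sphere R = @sqnorm R @^-1` [set 1] by [].
apply: preimage_closed; first by move=> v _; exact: continuous_sqnorm.
exact: closed_eq.
Qed.

Lemma S2_compact : compact [set: S2].
Proof.
move=> F PF _.
have [v [v1 cv]] : @unit_sphere R `&` cluster (@S2val R @ F) !=set0.
  by apply: unit_sphere_compact; apply: (@filterE _ F)  => p; exact: S2val_sphere.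
exists (mkS2 v1); split => // A B FA /nbhs_ballP[e /= e0 Be].
have FA' : (@S2val R @ F) (@S2val R @` A).
  suff : F (@S2val R @^-1` (@S2val R @` A)) by [].
  by apply: (filterS _ FA) => p Ap; exists p.
have [w [[p Ap <-] pe]] := cv _ _ FA' (nbhsx_ballx v e e0).
by exists p; split => //; exact: Be.
Qed.

Lemma S2_bounded (g : S2 -> R) : continuous g -> exists B : R, 0 < B /\ forall p, `|g p| <= B.
Proof.
move=> cg.
have : compact (g @` [set: S2]).
  by apply: continuous_compact S2_compact; exact: continuous_subspaceT.
move=> /compact_bounded[M [_ hM]].
exists (Num.max M 0 + 1); split; first by rewrite ltr_pwDr // le_max lexx orbT.
by move=> p; apply: hM; [rewrite ltr_pwDr // le_max lexx|exists p].
Qed.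

(** A modulus of continuity in quadratic form: nearby points are controlled by
    e, and for points at distance at least d / 2 a large multiple of the squared
    distance dominates the oscillation of g. *)
Lemma S2_modulus (g : S2 -> R) (e : R) : continuous g -> 0 < e ->
  exists K : R, 0 <= K /\ forall p q, `|g p - g q| <= e + K * sqnorm (S2val p - S2val q).
Proof.
move=> cg e0; have [B [B0 hB]] := S2_bounded cg.
have /compact_near_coveringP := S2_compact.
move=> /(_ nat \oo (fun n p => forall q, `|g p - g q| <= e + n%:R * sqnorm (S2val p - S2val q)) _).
case.
  move=> p _.
  have /cvgrPdist_lt /(_ (e / 2)) := cg p.
  rewrite divr_gt0 // => /(_ isT) /nbhs_ballP[d /= d0 hd].
  have d20 : 0 < d / 2 by rewrite divr_gt0.
  pose N := (Num.truncn (2 * B / (d / 2) ^+ 2)).+1.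
  exists (ball p (d / 2), [set n | (N <= n)%N]); first split => /=.
  - exact: nbhsx_ballx.
  - by exists N.
  move=> [q n] /= [pq Nn] r.
  have [pr|pr] := pselect (ball p d r).
    have hq : `|g p - g q| < e / 2 by apply: hd; apply: le_ball pq; rewrite ler_pdivrMr // ler_peMr ?ltW // ltr1n.
    have hr := hd _ pr; rewrite /= in hr.
    apply: (@le_trans _ _ e); last by rewrite lerDl mulr_ge0 // sqnorm_ge0.
    rewrite -(subrKA (g p)) (splitr e) (le_trans (ler_normD _ _)) // lerD // ltW //.
    by rewrite distrC.
  have hqr : (d / 2) ^+ 2 <= sqnorm (S2val q - S2val r).
    rewrite leNgt; apply/negP => h; apply: pr.
    rewrite (splitr d); apply: (ball_triangle pq).
    split => // i j; rewrite (ord1 i).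
    have := coord_le_sqnorm (S2val q - S2val r) j.
    rewrite !mxE => /le_lt_trans /(_ h).
    rewrite -[ltLHS]real_normK ?num_real // ltr_pXn2r ?nnegrE ?(ltW d20) //.
  apply: (@le_trans _ _ (2 * B)).
    by rewrite (le_trans (ler_normB _ _)) // mulr_natl mulr2n lerD.
  apply: (@le_trans _ _ (n%:R * (d / 2) ^+ 2)); last first.
    by apply: ler_wpDl; [exact: ltW|exact: ler_wpM2l].
  rewrite -ler_pdivrMr ?exprn_gt0 //.
  apply: le_trans (ltW (truncnS_gt _)) _.
  by rewrite ler_nat.
move=> N _ hN; exists N%:R; split => // p q.
by apply: (hN N) => //=.
Qed.
End SphereTopology.

(** * Uniform approximation by polynomials *)

Section Bernstein.
Variable R : realType.

(** The expectation of phi under the binomial distribution of parameters n and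
    x. *)
Definition bern (n : nat) (x : R) (phi : nat -> R) : R :=
  \sum_(i < n.+1) ('C(n, i)%:R * x ^+ i * (1 - x) ^+ (n - i)) * phi i.

(** Conditioning on the last trial; all moments follow by induction from it. *)
Lemma bernS n x phi :
  bern n.+1 x phi = x * bern n x (phi \o S) + (1 - x) * bern n x phi.
Proof.
rewrite /bern !mulr_sumr.
have -> : \sum_(i < n.+1) (1 - x) * ('C(n, i)%:R * x ^+ i * (1 - x) ^+ (n - i) * phi i) =
   \sum_(i < n.+2) (1 - x) * ('C(n, i)%:R * x ^+ i * (1 - x) ^+ (n - i) * phi i).
  by rewrite [RHS]big_ord_recr /= bin_small // !mul0r mulr0 addr0.
rewrite [LHS]big_ord_recl [X in _ = _ + X]big_ord_recl /= [RHS]addrCA -big_split /=; congr (_ + _).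
  by rewrite !bin0 !subn0 exprS; ring.
apply: eq_bigr => i _; rewrite /bump /= add1n binS natrD subSS.
have [->|ni] := eqVneq (i : nat) n.
  by rewrite bin_small // subnn (_ : n - n.+1 = 0)%N ?subnSK //; [rewrite exprS; ring|lia].
have -> : (n - i = (n - i.+1).+1)%N by have := ltn_ord i; lia.
by rewrite !exprS; ring.
Qed.

Lemma bern_lin n x (a b : R) phi psi :
  bern n x (fun i => a * phi i + b * psi i) = a * bern n x phi + b * bern n x psi.
Proof.
rewrite /bern !mulr_sumr -big_split; apply: eq_bigr => i _ /=; ring.
Qed.

Lemma eq_bern n x phi psi : phi =1 psi -> bern n x phi = bern n x psi.
Proof. by move=> e; apply: eq_bigr => i _; rewrite e. Qed.

Lemma bern1 n x : bern n x (fun=> 1) = 1.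
Proof.
elim: n => [|n IH]; first by rewrite /bern big_ord1 bin0 !expr0 !mulr1.
by rewrite bernS (@eq_bern _ _ (_ \o S) (fun=> 1)) // IH; ring.
Qed.

Lemma bern_mean n x : bern n x (fun i => i%:R - n%:R * x) = 0.
Proof.
elim: n => [|n IH]; first by rewrite /bern big_ord1 /=; ring.
rewrite bernS (@eq_bern _ _ (_ \o S) (fun i => 1 * (i%:R - n%:R * x) + (1 - x) * 1)); last first.
  by move=> i /=; rewrite -(natr1 i) -(natr1 n); ring.
rewrite (@eq_bern _ _ (fun i => i%:R - n.+1%:R * x) (fun i => 1 * (i%:R - n%:R * x) + (- x) * 1)); last first.
  by move=> i /=; rewrite -(natr1 n); ring.
by rewrite !bern_lin IH bern1; ring.
Qed.

Lemma bern_variance n x : bern n x (fun i => (i%:R - n%:R * x) ^+ 2) = n%:R * (x * (1 - x)).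
Proof.
elim: n => [|n IH]; first by rewrite /bern big_ord1 /=; ring.
rewrite bernS (@eq_bern _ _ (_ \o S)
  (fun i => 1 * (i%:R - n%:R * x) ^+ 2 + 1 * (2 * (1 - x) * (i%:R - n%:R * x) + (1 - x) ^+ 2 * 1))); last first.
  by move=> i /=; rewrite -(natr1 i) -(natr1 n); ring.
rewrite (@eq_bern _ _ (fun i => (i%:R - n.+1%:R * x) ^+ 2)
  (fun i => 1 * (i%:R - n%:R * x) ^+ 2 + 1 * (- 2 * x * (i%:R - n%:R * x) + x ^+ 2 * 1))); last first.
  by move=> i /=; rewrite -(natr1 n); ring.
by rewrite !bern_lin IH bern_mean bern1 -(natr1 n); ring.
Qed.

Definition bpoly (n i : nat) (s : 'I_3) : {mpoly R[3]} :=
  'C(n, i)%:R *: (2^-1 *: (1 + 'X_s)) ^+ i * (2^-1 *: (1 - 'X_s)) ^+ (n - i).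

(** Bernstein weights on [-1, 1], which contains the coordinates of the points
    of the sphere; the corresponding nodes are 2 i / n - 1. *)
Definition bw (n i : nat) (t : R) : R :=
  'C(n, i)%:R * ((1 + t) / 2) ^+ i * ((1 - t) / 2) ^+ (n - i).

Definition bnode (n i : nat) : R := 2 * i%:R / n%:R - 1.

Lemma bpolyE n i s v : (bpoly n i s).@[v] = bw n i (v s).
Proof.
rewrite /bpoly /bw mevalM mevalZ !rmorphXn /= !mevalZ mevalD mevalB !meval1 !mevalXU.
by rewrite ![2^-1 * _]mulrC.
Qed.

Lemma bw_ge0 n i t : `|t| <= 1 -> 0 <= bw n i t.
Proof.
rewrite ler_norml => /andP[t1 t2]; rewrite /bw; apply: mulr_ge0; last by apply: exprn_ge0; lra.
by apply: mulr_ge0 => //; apply: exprn_ge0; lra.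
Qed.

Lemma bw_sum n t (phi : nat -> R) :
  \sum_(i < n.+1) bw n i t * phi i = bern n ((1 + t) / 2) phi.
Proof.
rewrite /bern; apply: eq_bigr => i _; rewrite /bw.
by congr (_ * _ * _ ^+ _ * _); field.
Qed.

Lemma bw_sum1 n t : \sum_(i < n.+1) bw n i t = 1.
Proof. by rewrite -(bern1 n ((1 + t) / 2)) -bw_sum; apply: eq_bigr => i _; rewrite mulr1. Qed.

Lemma bw_variance n t : (0 < n)%N -> `|t| <= 1 ->
  \sum_(i < n.+1) bw n i t * (bnode n i - t) ^+ 2 <= n%:R^-1.
Proof.
move=> n0 t1; have nn : (n%:R : R) != 0 by rewrite pnatr_eq0 -lt0n.
rewrite (@bw_sum n t (fun i => (bnode n i - t) ^+ 2)).
set x := (1 + t) / 2.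
rewrite (@eq_bern n x _ (fun i => (4 / n%:R ^+ 2) * (i%:R - n%:R * x) ^+ 2 + 0 * 1)); last first.
  by move=> i; rewrite /bnode /x; field.
rewrite bern_lin bern_variance mul0r addr0.
have -> : 4 / n%:R ^+ 2 * (n%:R * (x * (1 - x))) = (1 - t ^+ 2) / n%:R.
  by rewrite /x; field.
by rewrite -[leRHS]mul1r ler_wpM2r ?invr_ge0 // lerBlDr lerDl sqr_ge0.
Qed.

Definition node3 n (f : {ffun 'I_3 -> 'I_n.+1}) : 'rV[R]_3 := \row_s bnode n (f s).

Definition bern3 n (F : 'rV[R]_3 -> R) : {mpoly R[3]} :=
  \sum_(f : {ffun 'I_3 -> 'I_n.+1}) F (node3 f) *: \prod_s bpoly n (f s) s.

Definition bw3 n (v : 'rV[R]_3) (f : {ffun 'I_3 -> 'I_n.+1}) : R :=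
  \prod_s bw n (f s) (v 0 s).

Lemma bern3E n F v : (bern3 n F).@[coords v] = \sum_f bw3 v f * F (@node3 n f).
Proof.
rewrite raddf_sum; apply: eq_bigr => f _ /=; rewrite mevalZ rmorph_prod mulrC.
by congr (_ * _); apply: eq_bigr => s _ /=; rewrite bpolyE.
Qed.

Lemma bw3_sum1 n v : \sum_f @bw3 n v f = 1.
Proof.
rewrite /bw3 -(bigA_distr_bigA (fun s (i : 'I_n.+1) => bw n i (v 0 s))).
by rewrite big1 // => s _; rewrite bw_sum1.
Qed.

Lemma bw3_ge0 n v f : unit_sphere v -> 0 <= @bw3 n v f.
Proof. by move=> v1; apply: prodr_ge0 => s _; apply/bw_ge0/coord_sphere_le1. Qed.

(** The three coordinates are independent, so the mean squared distance to v is
    the sum of three one-dimensional variances. *)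
Lemma bw3_variance n v : (0 < n)%N -> unit_sphere v ->
  \sum_f @bw3 n v f * sqnorm (node3 f - v) <= 3 / n%:R.
Proof.
move=> n0 v1.
have -> : \sum_f @bw3 n v f * sqnorm (node3 f - v) =
   \sum_s \sum_f @bw3 n v f * (bnode n (f s) - v 0 s) ^+ 2.
  rewrite exchange_big; apply: eq_bigr => f _ /=; rewrite /sqnorm mulr_sumr.
  by apply: eq_bigr => s _; rewrite !mxE.
have -> : 3 / n%:R = \sum_(s < 3) n%:R^-1 :> R.
  by rewrite sumr_const card_ord -[RHS]mulr_natl.
apply: ler_sum => s _.
pose h t (i : 'I_n.+1) := bw n i (v 0 t) * (if t == s then (bnode n i - v 0 s) ^+ 2 else 1).
have -> : \sum_f @bw3 n v f * (bnode n (f s) - v 0 s) ^+ 2 =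
    \sum_(f : {ffun 'I_3 -> 'I_n.+1}) \prod_t h t (f t).
  apply: eq_bigr => f _; rewrite /h big_split /= -/(bw3 v f); congr (_ * _).
  by rewrite -big_mkcond big_pred1_eq.
rewrite -bigA_distr_bigA (bigD1 s) //= [X in _ * X]big1 ?mulr1.
  by rewrite /h eqxx; apply: bw_variance => //; exact: coord_sphere_le1.
by move=> t /negPf ts; rewrite /h ts; under eq_bigr do rewrite mulr1; rewrite bw_sum1.
Qed.

(** Korovkin's principle: averaging F over the Bernstein nodes costs e plus K
    times the variance, and the latter is at most 3 / n. *)
Lemma poly_approx_quadratic (F g : 'rV[R]_3 -> R) (e K : R) : 0 < e -> 0 <= K ->
  (forall a v, unit_sphere v -> `|F a - g v| <= e + K * sqnorm (a - v)) ->
  exists P : {mpoly R[3]}, forall v, unit_sphere v -> `|P.@[coords v] - g v| <= 2 * e.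
Proof.
move=> e0 K0 FG.
pose n := (Num.truncn (3 * K / e)).+1.
exists (bern3 n F) => v v1; rewrite bern3E.
rewrite -[g v]mul1r -(bw3_sum1 n v) mulr_suml -sumrB.
under eq_bigr do rewrite -mulrBr.
apply: le_trans (ler_norm_sum _ _ _) _.
apply: (@le_trans _ _ (\sum_f @bw3 n v f * (e + K * sqnorm (node3 f - v)))).
  apply: ler_sum => f _; rewrite normrM ger0_norm ?bw3_ge0 //.
  by apply: ler_wpM2l; [exact: bw3_ge0|exact: FG].
under eq_bigr do rewrite mulrDr mulrCA.
rewrite big_split /= -mulr_suml -mulr_sumr bw3_sum1 mul1r mulrDl mul1r lerD2l.
apply: (@le_trans _ _ (K * (3 / n%:R))); first by rewrite ler_wpM2l // bw3_variance.
rewrite mulrA ler_pdivrMr ?ltr0n // [K * _]mulrC [e * _]mulrC -ler_pdivrMr //.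
exact: ltW (truncnS_gt _).
Qed.

(** Radial projection onto the sphere at most doubles the distance to points of
    the sphere. *)
Lemma sqnorm_normalize (r : R) (u v : 'rV[R]_3) : 0 < r ->
  unit_sphere u -> unit_sphere v -> sqnorm (u - v) <= 4 * sqnorm (r *: u - v).
Proof.
move=> r0; rewrite /unit_sphere /= /sqnorm !sum3 !mxE.
move: (u 0 0) (u 0 1) (u 0 2) (v 0 0) (v 0 1) (v 0 2) => x y z x' y' z' h1 h2.
pose c := x * x' + y * y' + z * z'.
have eN : (x - x') ^+ 2 + (y - y') ^+ 2 + (z - z') ^+ 2 = 2 - 2 * c.
  transitivity ((x ^+ 2 + y ^+ 2 + z ^+ 2) + (x' ^+ 2 + y' ^+ 2 + z' ^+ 2) - 2 * c).
    by rewrite /c; ring.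
  by rewrite h1 h2.
have eD : (x + x') ^+ 2 + (y + y') ^+ 2 + (z + z') ^+ 2 = 2 + 2 * c.
  transitivity ((x ^+ 2 + y ^+ 2 + z ^+ 2) + (x' ^+ 2 + y' ^+ 2 + z' ^+ 2) + 2 * c).
    by rewrite /c; ring.
  by rewrite h1 h2.
have -> : (r * x - x') ^+ 2 + (r * y - y') ^+ 2 + (r * z - z') ^+ 2 = r ^+ 2 - 2 * r * c + 1.
  transitivity (r ^+ 2 * (x ^+ 2 + y ^+ 2 + z ^+ 2) - 2 * r * c + (x' ^+ 2 + y' ^+ 2 + z' ^+ 2)).
    by rewrite /c; ring.
  by rewrite h1 h2 mulr1.
have c1 : 0 <= 2 - 2 * c by rewrite -eN !addr_ge0 ?sqr_ge0.
have c2 : 0 <= 2 + 2 * c by rewrite -eD !addr_ge0 ?sqr_ge0.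
rewrite eN; move: c c1 c2 {eN eD} => c c1 c2.
have [hc|hc] := lerP (- (1 / 2)) c.
  have := sqr_ge0 (r - c); nra.
nra.
Qed.

(** g is extended to the space by g (a / |a|); this extension is not continuous
    at 0, but Korovkin's principle asks only for the quadratic estimate relative
    to points of the sphere. *)
Lemma sphere_weierstrass (g : S2 R -> R) (e : R) : continuous g -> 0 < e ->
  exists P : {mpoly R[3]}, forall p, `|P.@[coords (S2val p)] - g p| < e.
Proof.
move=> cg e0; have e3 : 0 < e / 3 by rewrite divr_gt0.
have [B [B0 hB]] := S2_bounded cg.
have [K [K0 hK]] := S2_modulus cg e3.
pose nrm (a : 'rV[R]_3) := Num.sqrt (sqnorm a).
pose gx (v : 'rV[R]_3) : R := if pselect (unit_sphere v) is left h then g (mkS2 h) else 0.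
have gxE p : gx (S2val p) = g p.
  rewrite /gx; case: pselect => [h|]; last by case; exact: S2val_sphere.
  by congr g; apply: S2val_inj.
have [||P hP] := @poly_approx_quadratic (fun a => gx ((nrm a)^-1 *: a)) gx (e / 3) (B + 4 * K) e3.
- by apply: addr_ge0; [exact: ltW|exact: mulr_ge0].
- move=> a v v1.
  pose q := mkS2 v1; have -> : gx v = g q by rewrite -gxE.
  have [a0|a0] := eqVneq (sqnorm a) 0.
    rewrite (sqnorm_eq0 a0) scaler0 sub0r.
    have -> : gx 0 = 0.
      have s0 : ~ @unit_sphere R 0.
        rewrite /unit_sphere /= -(scale0r (0 : 'rV[R]_3)) sqnormZ expr0n mul0r.
        by move=> /eqP; rewrite eq_sym oner_eq0.
      by rewrite /gx; case: pselect.
    rewrite sub0r normrN -scaleN1r sqnormZ sqrrN expr1n mul1r v1 mulr1.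
    apply: le_trans (hB q) _; lra.
  have n0 : 0 < sqnorm a by rewrite lt_def a0 sqnorm_ge0.
  have r0 : 0 < nrm a by rewrite sqrtr_gt0.
  have rr : nrm a ^+ 2 = sqnorm a by rewrite sqr_sqrtr // ltW.
  have u1 : unit_sphere ((nrm a)^-1 *: a).
    by rewrite /unit_sphere /= sqnormZ -rr exprVn mulVf // expf_neq0 // gt_eqF.
  have -> : gx ((nrm a)^-1 *: a) = g (mkS2 u1) by rewrite -gxE.
  apply: le_trans (hK _ _) _; rewrite lerD2l /= !S2valK.
  set u := _ *: a in u1 *.
  have aE : a = nrm a *: u by rewrite scalerA divff ?scale1r // gt_eqF.
  suff : sqnorm (u - v) <= 4 * sqnorm (a - v).
    move=> h; have := sqnorm_ge0 (a - v); nra.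
  by rewrite [in leRHS]aE; exact: sqnorm_normalize.
exists P => p; rewrite -gxE; apply: le_lt_trans (hP _ (S2val_sphere p)) _; lra.
Qed.
End Bernstein.

(** * Surface integrals in spherical coordinates *)

(** Change of variables for a measure that is the image under phi of a measure
    with density w; the surface measure is of this kind. *)
Section DensityImage.
Local Open Scope ereal_scope.
Context d1 d2 (X : measurableType d1) (Y : measurableType d2) (R : realType).
Variables (mu : {measure set X -> \bar R}) (nu : {measure set Y -> \bar R}).
Variables (phi : X -> Y) (mphi : measurable_fun setT phi).
Variables (D : set X) (mD : measurable D).
Variables (w : X -> R) (mw : measurable_fun setT w) (w0 : forall x, D x -> (0 <= w x)%R).
Hypothesis nuE : forall A, measurable A -> nu A = \int[mu]_(x in D `&` phi @^-1` A) (w x)%:E.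

Import HBNNSimple.

Let mwD : measurable_fun D (EFin \o w).
Proof. by apply: measurable_funTS; exact/measurable_EFinP. Qed.

Lemma ge0_integral_density (f : Y -> \bar R) : measurable_fun setT f ->
  (forall y, 0 <= f y) ->
  \int[nu]_y f y = \int[mu]_(x in D) (f (phi x) * (w x)%:E).
Proof.
move=> mf f0; pose f_ := nnsfun_approx measurableT mf.
transitivity (limn (fun n => \int[nu]_x (f_ n x)%:E)).
  rewrite -monotone_convergence//.
  - apply: eq_integral => y _; apply/esym/cvg_lim => //.
    by apply: cvg_nnsfun_approx => // *; exact: f0.
  - by move=> n; exact/measurable_EFinP/measurable_funP.
  - by move=> n y _; rewrite lee_fin.
  - by move=> y _ m n mn; rewrite lee_fin; exact/lefP/nd_nnsfun_approx.
have mfn n : measurable_fun D (fun x => (f_ n (phi x))%:E * (w x)%:E).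
  apply: emeasurable_funM => //; apply/measurable_EFinP.
  by apply: measurable_funTS; apply: measurableT_comp => //; exact: measurable_funP.
have fn0 n x : D x -> 0 <= (f_ n (phi x))%:E * (w x)%:E.
  by move=> Dx; apply: mule_ge0; rewrite lee_fin //; exact: w0.
transitivity (limn (fun n => \int[mu]_(x in D) ((f_ n (phi x))%:E * (w x)%:E))); last first.
  rewrite -monotone_convergence//.
    apply: eq_integral => x /[!inE] Dx; apply/cvg_lim => //.
    apply: cvgeZr => //.
    by apply: cvg_nnsfun_approx => // y _; exact: f0.
  move=> x Dx m n mn; apply: lee_wpmul2r; first by rewrite lee_fin; exact: w0.
  by rewrite lee_fin; exact/lefP/nd_nnsfun_approx.
congr (limn _); apply/funext => n.
have mset k : measurable (f_ n @^-1` [set k]).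
  by rewrite -[X in measurable X]setTI; exact: measurable_funP.
transitivity (\sum_(k \in range (f_ n)) k%:E * nu (f_ n @^-1` [set k])).
  under eq_integral do rewrite fimfunE -fsumEFin//.
  rewrite ge0_integral_fsum//; last 2 first.
  - by move=> y; exact/measurable_EFinP/measurable_funM.
  - by move=> y x _; rewrite nnfun_muleindic_ge0.
  apply: eq_fsbigr => r _; rewrite integralZl_indic_nnsfun// integral_indic//=.
  by rewrite setIT.
transitivity (\int[mu]_(x in D) \sum_(k \in range (f_ n)) (k * \1_(f_ n @^-1` [set k]) (phi x) * w x)%:E); last first.
  apply: eq_integral => x _; rewrite fsumEFin// -EFinM; congr (_%:E).
  by rewrite -mulr_fsuml -fimfunE.
rewrite ge0_integral_fsum//; last 2 first.
- move=> k; apply/measurable_EFinP; apply: measurable_funM; last exact: measurable_funTS.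
  by apply: measurable_funM => //; apply: measurable_funTS; exact: measurableT_comp.
- move=> k x Dx; rewrite lee_fin; apply: mulr_ge0; last exact: w0.
  by have := nnfun_muleindic_ge0 (f_ n) k (phi x); rewrite lee_fin.
apply: eq_fsbigr => k /[!inE] -[y _ yk].
have k0 : (0 <= k)%R by rewrite -yk.
under [RHS]eq_integral do rewrite -mulrA EFinM.
rewrite ge0_integralZl//; last 2 first.
- by apply/measurable_EFinP/measurable_funM; [apply: measurable_funTS; exact: measurableT_comp|exact: measurable_funTS].
- by move=> x Dx; rewrite lee_fin mulr_ge0// w0.
congr (_ * _); rewrite nuE// integral_mkcondr.
apply: eq_integral => x _; rewrite /patch /= indicE.
have -> : (x \in phi @^-1` (f_ n @^-1` [set k])) = (phi x \in f_ n @^-1` [set k]) by apply/idP/idP; rewrite !inE.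
by case: ifPn; rewrite ?mul1r ?mul0r.
Qed.

Lemma integral_density (f : Y -> R) : measurable_fun setT f ->
  \int[nu]_y (f y)%:E = \int[mu]_(x in D) (f (phi x) * w x)%:E.
Proof.
move=> mf; rewrite integralE [RHS]integralE.
have mfE : measurable_fun setT (EFin \o f) by exact/measurable_EFinP.
congr (_ - _).
- rewrite ge0_integral_density//; last exact: measurable_funepos.
  apply: eq_integral => x /[!inE] /w0 wx.
  by rewrite !funeposE /= -!EFin_max -EFinM maxr_pMl// mul0r.
- rewrite ge0_integral_density//; last exact: measurable_funeneg.
  apply: eq_integral => x /[!inE] /w0 wx.
  by rewrite !funenegE /= -!EFin_max -EFinM maxr_pMl// mul0r mulNr.
Qed.
End DensityImage.

Section SurfaceIntegral.
Variable R : realType.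
Local Notation S2 := (S2 R).
Local Notation leb := (@lebesgue_measure R).
Local Notation leb2 := (leb \x leb)%E.
Local Notation dom := (@spherical_domain R).

Lemma measurable_dom : measurable dom.
Proof. by apply: measurableX; exact: measurable_itv. Qed.

Lemma dom_sin_ge0 u : dom u -> 0 <= sin u.2.
Proof. by move=> [_ /=]; rewrite in_itv /= => /andP[h0 hpi]; rewrite sin_ge0_pi // h0. Qed.

Lemma measurable_sin2 : measurable_fun [set: R * R] (fun u => sin u.2).
Proof.
apply: measurableT_comp => //.
by apply: continuous_measurable_fun => x; exact: continuous_sin.
Qed.

Lemma surface_integral (f : S2 -> R) : measurable_fun [set: S2] f ->
  (\int[surface_measure]_p (f p)%:E = \int[leb2]_(u in dom) (f (spherical u) * sin u.2)%:E)%E.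
Proof.
move=> mf; apply: integral_density => //.
- exact: measurable_spherical.
- exact: measurable_dom.
- exact: measurable_sin2.
- exact: dom_sin_ge0.
Qed.

Lemma measurable_continuous_S2 (g : S2 -> R) : continuous g -> measurable_fun [set: S2] g.
Proof.
move=> /continuousP cg; apply: (measurability _ (RGenOpens.measurableE R)).
move=> _ [_ [a [b ->] <-]]; rewrite setTI.
by apply: sub_sigma_algebra; exact/cg/interval_open.
Qed.

Lemma leb2_dom : (leb2 dom < +oo)%E.
Proof.
rewrite /spherical_domain product_measure1E; [|exact: measurable_itv..].
rewrite /= !lebesgue_measure_itv /= !lte_fin.
have p0 := pi_gt0 R; rewrite p0 mulr_gt0 // -!EFinB -EFinM ltry //.
Qed.

Lemma dom_integrable (f : R * R -> R) M : measurable_fun [set: R * R] f ->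
  (forall u, dom u -> `|f u| <= M) -> leb2.-integrable dom (EFin \o f).
Proof.
move=> mf fM; apply: measurable_bounded_integrable.
- exact: measurable_dom.
- exact: leb2_dom.
- exact: measurable_funTS.
exists M; split; first exact: num_real.
by move=> N MN u Du /=; rewrite (le_trans (fM _ Du)) // ltW.
Qed.

Lemma surface_finite : (surface_measure [set: S2] < +oo)%E.
Proof.
have -> : surface_measure [set: S2] = (\int[surface_measure]_p ((cst 1 : S2 -> R) p)%:E)%E.
  by rewrite -[RHS]/(\int[surface_measure]_p (cst 1%:E p))%E integral_cst // mul1e.
rewrite surface_integral //.
apply: integrable_lty; first exact: measurable_dom.
apply: (@dom_integrable (fun u => 1 * sin u.2) 1).
- by apply: measurable_funM => //; exact: measurable_sin2.
- by move=> u _; rewrite mul1r ler_norml sin_geN1 sin_le1.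
Qed.

Lemma continuous_itv_integrable (u : R -> R) (a b : R) : continuous u ->
  leb.-integrable `[a, b]%classic (EFin \o u).
Proof.
move=> cu; apply: continuous_compact_integrable; first exact: segment_compact.
exact: continuous_subspaceT.
Qed.

(** Monomials become products of a function of the longitude and a function of
    the colatitude, so their integrals factor. *)
Lemma dom_integral_prod (u w : R -> R) : continuous u -> continuous w ->
  (\int[leb2]_(x in dom) (u x.1 * w x.2)%:E =
   (\int[leb]_(t in `[0, 2 * pi]%classic) u t * \int[leb]_(t in `[0, pi]%classic) w t)%R%:E)%E.
Proof.
move=> cu cw.
have iu := continuous_itv_integrable 0 (2 * pi) cu.
have iw := continuous_itv_integrable 0 pi cw.
have mu : measurable_fun [set: R] u by exact: continuous_measurable_fun.
have mw : measurable_fun [set: R] w by exact: continuous_measurable_fun.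
have bnd (v : R -> R) (a b : R) : continuous v -> exists M, forall t, `[a, b]%classic t -> `|v t| <= M.
  move=> cv; have : compact (v @` `[a, b]%classic).
    by apply: continuous_compact; [exact: continuous_subspaceT|exact: segment_compact].
  move=> /compact_bounded[M [_ hM]]; exists (M + 1) => t tab; apply: hM; first by rewrite ltrDl.
  by exists t.
have [Mu hMu] := bnd u 0 (2 * pi) cu; have [Mw hMw] := bnd w 0 pi cw.
have iuw : leb2.-integrable dom (EFin \o (fun x => u x.1 * w x.2)).
  apply: (@dom_integrable _ (Mu * Mw)).
    by apply: measurable_funM; apply: measurableT_comp.
  by move=> x [x1 x2]; rewrite normrM ler_pM // ?hMu ?hMw.
rewrite integral_mkcond -integral12_prod_meas1; last first.
  by rewrite -integrable_mkcond //; exact: measurable_dom.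
rewrite /= /fubini_F.
transitivity (\int[leb]_(x in `[0%R, (2 * pi)%R]%classic) ((u x)%:E * (\int[leb]_(t in `[0, pi]%classic) w t)%R%:E))%E.
  rewrite [RHS]integral_mkcond; apply: eq_integral => x _.
  rewrite /patch; case: ifPn => [/set_mem x1|x1].
    rewrite /Rintegral fineK; last by apply: integrable_fin_num => //; exact: measurable_itv.
    rewrite -integralZl //; rewrite [RHS]integral_mkcond; apply: eq_integral => y _.
    rewrite /patch; have [y2|y2] := boolP (y \in `[0%R, pi]%classic).
      by rewrite ifT //; apply/mem_set; split => //; exact: set_mem.
    by rewrite ifF //; apply/negbTE; apply: contra y2 => /set_mem[_ ?]; exact/mem_set.
  rewrite integral0_eq // => y _; rewrite ifF //; apply/negbTE.
  by apply: contra x1 => /set_mem[? _]; exact/mem_set.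
rewrite integralZr // EFinM; congr (_ * _)%E.
by rewrite /Rintegral fineK //; apply: integrable_fin_num => //; exact: measurable_itv.
Qed.

(** Moments of sine and cosine.  Instead of closed formulas, recurrences between
    them are used, which come from integrating exact derivatives. *)
Definition tmom (a b : R) (p q : nat) : R :=
  \int[leb]_(t in `[a, b]%classic) (sin t ^+ p * cos t ^+ q).

Lemma continuous_trig p q : continuous (fun t : R => sin t ^+ p * cos t ^+ q).
Proof.
move=> t; apply: cvgM.
  exact: (@continuous_comp _ _ _ sin (fun x => x ^+ p) t (@continuous_sin R t) (@exprn_continuous R p (sin t))).
exact: (@continuous_comp _ _ _ cos (fun x => x ^+ q) t (@continuous_cos R t) (@exprn_continuous R q (cos t))).
Qed.

Lemma tmom_integrable a b p q : 
  leb.-integrable `[a, b]%classic (EFin \o (fun t : R => sin t ^+ p * cos t ^+ q)).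
Proof. exact/continuous_itv_integrable/continuous_trig. Qed.

Lemma continuous_trigZ c p q : continuous (fun t : R => c * (sin t ^+ p * cos t ^+ q)).
Proof. by move=> t; apply: cvgM; [exact: cvg_cst|exact: continuous_trig]. Qed.

Lemma tmom_split a b p q : tmom a b p q = tmom a b p.+2 q + tmom a b p q.+2.
Proof.
rewrite /tmom -RintegralD //; [|exact: tmom_integrable..].
apply: eq_Rintegral => t _.
transitivity (sin t ^+ p * cos t ^+ q * (cos t ^+ 2 + sin t ^+ 2)).
  by rewrite cos2Dsin2 mulr1.
by rewrite !exprS; ring.
Qed.

Lemma ftc_tmom (a b : R) (f F : R -> R) : a < b -> continuous f ->
  (forall t : R, is_derive t (1 : R) F (f t)) -> F a = F b ->
  \int[leb]_(t in `[a, b]%classic) f t = 0.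
Proof.
move=> ab cf dF Fab; rewrite /Rintegral (@continuous_FTC2 R f F a b) //.
- by rewrite Fab -EFinB subrr.
- exact: continuous_subspaceT.
- have cF : continuous F.
    by move=> t; apply/differentiable_continuous/derivable1_diffP; exact: ex_derive.
  split; [by move=> t _; exact: ex_derive| |].
  + exact/cvg_at_right_filter/cF.
  + exact/cvg_at_left_filter/cF.
- by move=> t _; rewrite derive1E; exact: derive_val.
Qed.

Section Moments.
Variables (a b : R).
Hypothesis ab : a < b.
(* The boundary terms of the integrations by parts cancel: this covers both a half
   period from 0 to pi and a full period. *)
Hypothesis per : forall p q, sin a ^+ p.+1 * cos a ^+ q = sin b ^+ p.+1 * cos b ^+ q.

Lemma tmom_parts p q : p.+1%:R * tmom a b p q.+2 = q.+1%:R * tmom a b p.+2 q.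
Proof.
apply/eqP; rewrite -subr_eq0; apply/eqP.
rewrite /tmom -!RintegralZl //; [|exact: tmom_integrable..].
rewrite -RintegralB //; last 2 first.
- exact/continuous_itv_integrable/continuous_trigZ.
- exact/continuous_itv_integrable/continuous_trigZ.
apply: (@ftc_tmom _ _ _ (fun t => sin t ^+ p.+1 * cos t ^+ q.+1)) => //.
- by move=> t; apply: cvgB; exact: continuous_trigZ.
- move=> t.
  have -> : (fun t : R => sin t ^+ p.+1 * cos t ^+ q.+1) = (@sin R) ^+ p.+1 * (@cos R) ^+ q.+1.
    by apply/funext => x; rewrite /GRing.mul /= !exprfctE.
  apply: is_derive_eq.
  rewrite !exprfctE -[LHS]/(sin t ^+ p.+1 * ((q.+1%:R * cos t ^+ q) * - sin t) +
    cos t ^+ q.+1 * ((p.+1%:R * sin t ^+ p) * cos t)).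
  move: (p.+1%:R : R) (q.+1%:R : R) => x y; rewrite !exprS; ring.
Qed.

Lemma tmom_sin1 p : tmom a b p 1 = 0.
Proof.
have p0 : (p.+1%:R : R) != 0 by rewrite pnatr_eq0.
apply: (mulfI p0); rewrite mulr0 /tmom -RintegralZl //; last exact: tmom_integrable.
apply: (@ftc_tmom _ _ _ (fun t => sin t ^+ p.+1)) => //.
- exact: continuous_trigZ.
- move=> t.
  have -> : (fun t : R => sin t ^+ p.+1) = (@sin R) ^+ p.+1.
    by apply/funext => x; rewrite exprfctE.
  apply: is_derive_eq.
  by rewrite -[LHS]/((p.+1%:R * sin t ^+ p) * cos t) expr1 mulrA.
- by have := per p 0; rewrite !expr0 !mulr1.
Qed.

Lemma tmom_raise_cos p q : q.+1%:R * tmom a b p q = (p + q).+2%:R * tmom a b p q.+2.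
Proof.
rewrite tmom_split mulrDr -tmom_parts -mulrDl -natrD; congr (_%:R * _); lia.
Qed.

Lemma tmom_raise_sin p q : p.+1%:R * tmom a b p q = (p + q).+2%:R * tmom a b p.+2 q.
Proof.
rewrite tmom_split mulrDr tmom_parts -mulrDl -natrD; congr (_%:R * _); lia.
Qed.

Lemma tmom_lower_cos p q : q%:R * tmom a b p q.-1 = (p + q).+1%:R * tmom a b p q.+1.
Proof.
case: q => [|q]; first by rewrite mul0r tmom_sin1 mulr0.
by rewrite tmom_raise_cos addnS.
Qed.
End Moments.
End SurfaceIntegral.

(** * Integrals of polynomials and the Green formula *)

Section PolyIntegral.
Variable R : realType.
Local Notation S2 := (S2 R).
Local Notation leb := (@lebesgue_measure R).
Local Notation surf := (@surface_measure R).

Definition pfun (P : {mpoly R[3]}) (p : S2) : R := P.@[coords (S2val p)].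

Lemma pfunD P Q p : pfun (P + Q) p = pfun P p + pfun Q p.
Proof. exact: mevalD. Qed.

Lemma pfunZ c P p : pfun (c *: P) p = c * pfun P p.
Proof. exact: mevalZ. Qed.

Lemma pfunM P Q p : pfun (P * Q) p = pfun P p * pfun Q p.
Proof. exact: mevalM. Qed.

Lemma pfun0 p : pfun 0 p = 0.
Proof. exact: meval0. Qed.

Lemma pfunX m p : pfun 'X_[m] p =
  S2val p 0 0 ^+ m 0 * S2val p 0 1 ^+ m 1 * S2val p 0 2 ^+ m 2.
Proof. by rewrite /pfun mevalX prod3. Qed.

Lemma continuous_sum (T : topologicalType) J (s : seq J) (F : J -> T -> R) :
  (forall j, continuous (F j)) -> continuous (fun p => \sum_(j <- s) F j p).
Proof.
move=> cF; elim: s => [|j s IH] p.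
  by under eq_fun do rewrite big_nil; exact: cvg_cst.
by under eq_fun do rewrite big_cons; exact: (cvgD (cF j p) (IH p)).
Qed.

Lemma continuous_prod (T : topologicalType) J (s : seq J) (F : J -> T -> R) :
  (forall j, continuous (F j)) -> continuous (fun p => \prod_(j <- s) F j p).
Proof.
move=> cF; elim: s => [|j s IH] p.
  by under eq_fun do rewrite big_nil; exact: cvg_cst.
by under eq_fun do rewrite big_cons; exact: (cvgM (cF j p) (IH p)).
Qed.

Lemma continuous_meval (T : topologicalType) (P : {mpoly R[3]}) (x : T -> 'I_3 -> R) :
  (forall i, continuous (fun t => x t i)) -> continuous (fun t => P.@[x t]).
Proof.
move=> cx; under eq_fun do rewrite mevalE.
apply: continuous_sum => m; have cX : continuous (fun t => \prod_i x t i ^+ m i).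
  apply: continuous_prod => i t.
  exact: (@continuous_comp _ _ _ (x^~ i) (fun y => y ^+ m i) t (cx i t) (@exprn_continuous R (m i) _)).
by move=> t; exact: (cvgM (cvg_cst _) (cX t)).
Qed.

Lemma continuous_pfun P : continuous (pfun P).
Proof. by apply: continuous_meval => i; exact: continuous_coord. Qed.

Lemma continuous_S2_integrable (g : S2 -> R) : continuous g -> surf.-integrable setT (EFin \o g).
Proof.
move=> cg; have [B [B0 hB]] := S2_bounded cg.
apply: measurable_bounded_integrable => //.
- exact: surface_finite.
- exact: measurable_continuous_S2.
exists B; split; first exact: num_real.
by move=> M BM p _ /=; rewrite (le_trans (hB p)) // ltW.
Qed.

Lemma pfun_integrable P : surf.-integrable setT (EFin \o pfun P).
Proof. exact/continuous_S2_integrable/continuous_pfun. Qed.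

Definition sphint (P : {mpoly R[3]}) : R := \int[surf]_p pfun P p.

Lemma sphintE P : (\int[surf]_p (pfun P p)%:E = (sphint P)%:E)%E.
Proof. by rewrite /sphint /Rintegral fineK //; apply: integrable_fin_num => //; exact: pfun_integrable. Qed.

Lemma sphintD P Q : sphint (P + Q) = sphint P + sphint Q.
Proof.
rewrite /sphint -RintegralD //; [|exact: pfun_integrable..].
by apply: eq_Rintegral => p _; rewrite pfunD.
Qed.

Lemma sphintZ c P : sphint (c *: P) = c * sphint P.
Proof.
rewrite /sphint -RintegralZl //; last exact: pfun_integrable.
by apply: eq_Rintegral => p _; rewrite pfunZ.
Qed.

Lemma sphint0 : sphint 0 = 0.
Proof. by rewrite -(scale0r 0) sphintZ mul0r. Qed.

Lemma sphintB P Q : sphint (P - Q) = sphint P - sphint Q.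
Proof. by rewrite -scaleN1r sphintD sphintZ mulN1r. Qed.

Lemma sphint_sum I (r : seq I) (F : I -> {mpoly R[3]}) :
  sphint (\sum_(i <- r) F i) = \sum_(i <- r) sphint (F i).
Proof. exact: (big_morph _ sphintD sphint0). Qed.

Lemma eq_sphint P Q : (forall p, pfun P p = pfun Q p) -> sphint P = sphint Q.
Proof. by move=> h; apply: eq_Rintegral => p _; exact: h. Qed.

Lemma sphint_sq_ge0 P : 0 <= sphint (P * P).
Proof. by apply: Rintegral_ge0 => p _; rewrite pfunM -expr2; exact: sqr_ge0. Qed.

Lemma sphint_mono m : sphint 'X_[m] =
  tmom 0 (2 * pi) (m 1) (m 0) * tmom 0 pi (m 0 + m 1).+1 (m 2).
Proof.
apply: EFin_inj; rewrite -sphintE.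
rewrite (surface_integral (measurable_continuous_S2 (@continuous_pfun 'X_[m]))).
rewrite /tmom -dom_integral_prod; [|exact: continuous_trig..].
apply: eq_integral => u _; congr (_%:E).
rewrite pfunX /spherical /S2val /= !mxE /=.
rewrite !exprMn exprS exprD; ring.
Qed.

Lemma sin0_per (a b : R) p q : sin a = 0 -> sin b = 0 ->
  sin a ^+ p.+1 * cos a ^+ q = sin b ^+ p.+1 * cos b ^+ q.
Proof. by move=> -> ->; rewrite expr0n !mul0r. Qed.

Lemma pi_pos : 0 < pi :> R. Proof. exact: pi_gt0. Qed.

Lemma twopi_pos : 0 < 2 * pi :> R.
Proof. by rewrite mulr_gt0 // pi_pos. Qed.

Lemma per_pi p q : sin 0 ^+ p.+1 * cos 0 ^+ q = sin pi ^+ p.+1 * cos pi ^+ q :> R.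
Proof. by apply: sin0_per; rewrite ?sin0 ?sinpi. Qed.

Lemma per_2pi p q :
  sin 0 ^+ p.+1 * cos 0 ^+ q = sin (2 * pi) ^+ p.+1 * cos (2 * pi) ^+ q :> R.
Proof. by apply: sin0_per; rewrite ?sin0 // mulr_natl sin2pi. Qed.

Lemma tmom_cos1 q : tmom 0 (2 * pi) 1 q = 0 :> R.
Proof.
have q0 : (- q.+1%:R : R) != 0 by rewrite oppr_eq0 pnatr_eq0.
apply: (mulfI q0); rewrite mulr0 /tmom -RintegralZl //; last exact: tmom_integrable.
apply: (@ftc_tmom _ _ _ _ (fun t => cos t ^+ q.+1)) => //.
- exact: twopi_pos.
- exact: continuous_trigZ.
- move=> t.
  have -> : (fun t : R => cos t ^+ q.+1) = (@cos R) ^+ q.+1.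
    by apply/funext => x; rewrite exprfctE.
  apply: is_derive_eq.
  by rewrite -[LHS]/((q.+1%:R * cos t ^+ q) * - sin t) expr1; ring.
- by rewrite cos0 mulr_natl cos2pi.
Qed.

Lemma tmom_lower_sin p q :
  p%:R * tmom 0 (2 * pi) p.-1 q = (p + q).+1%:R * tmom 0 (2 * pi) p.+1 q :> R.
Proof.
case: p => [|p]; first by rewrite mul0r tmom_cos1 mulr0.
by rewrite (tmom_raise_sin twopi_pos per_2pi).
Qed.

Lemma moment_combine (A N M T0 T2 S0 S2 : R) :
  N * S0 = M * S2 -> A * T0 = N * T2 -> A * (T0 * S0) = M * (T2 * S2).
Proof. by move=> h1 h2; rewrite mulrA h2 mulrAC h1 mulrAC -mulrA. Qed.

(** The divergence theorem for a field v directed along the i-th axis: for a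
    form v of degree d on the ball it reads (d + 2) * int (x_i v) = int (d_i v),
    where both sides are integrals over the sphere.  For monomials it is one
    recurrence for the moments of each coordinate angle. *)
Lemma sphint_deriv_mono i m :
  sphint ('X_[m])^`M(i) = (mdeg m).+2%:R * sphint ('X_i * 'X_[m]).
Proof.
rewrite mderivX sphintZ -mpolyXD !sphint_mono !mnmDE !mnmBE !mnm1E.
have -> : mdeg m = (m 0%R + m 1%R + m 2%R)%N by rewrite mdegE sum3.
case: (ord3P i) => ->.
- rewrite /= !subn0 !add0n subn1 add1n.
  have := tmom_lower_cos twopi_pos per_2pi (m 1%R) (m 0%R).
  have := tmom_raise_sin pi_pos per_pi (m 0%R + m 1%R) (m 2%R).
  case: (m 0%R) => [|a] h1 h2.
    rewrite mul0r; move: h2; rewrite mul0r => /esym/eqP.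
    by rewrite mulf_eq0 pnatr_eq0 /= => /eqP ->; rewrite mul0r mulr0.
  by apply: moment_combine h1 _; rewrite addnC.
- rewrite /= !subn0 !add0n subn1 add1n.
  have := tmom_lower_sin (m 1%R) (m 0%R).
  have := tmom_raise_sin pi_pos per_pi (m 0%R + m 1%R) (m 2%R).
  case: (m 1%R) => [|a] h1 h2.
    rewrite mul0r; move: h2; rewrite mul0r => /esym/eqP.
    by rewrite mulf_eq0 pnatr_eq0 /= => /eqP ->; rewrite mul0r mulr0.
  by rewrite !addnS /=; rewrite !addnS in h1; apply: moment_combine h1 _; rewrite h2 addSn addnC.
- rewrite /= !subn0 !add0n subn1 add1n.
  have := tmom_lower_cos pi_pos per_pi (m 0%R + m 1%R).+1 (m 2%R).
  by move=> h; rewrite mulrCA [RHS]mulrCA h addSn.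
Qed.

Lemma sphint_deriv d (P : {mpoly R[3]}) i : P \is d.-homog ->
  sphint P^`M(i) = d.+2%:R * sphint ('X_i * P).
Proof.
move=> /dhomogP hP; rewrite (mpolyE P) raddf_sum mulr_sumr !sphint_sum mulr_sumr !big_seq.
apply: eq_bigr => m /hP /= <-.
by rewrite mderivZ -scalerAr !sphintZ sphint_deriv_mono mulrCA.
Qed.

Definition lap (P : {mpoly R[3]}) : {mpoly R[3]} := \sum_(i < 3) (P^`M(i))^`M(i).

Lemma deriv_homog d (P : {mpoly R[3]}) i : P \is d.+1.-homog -> P^`M(i) \is d.-homog.
Proof.
move=> /dhomogP hP; apply/dhomogP => m; rewrite mcoeff_msupp mcoeff_mderiv => hm.
have /hP /= : (m + U_(i))%MM \in msupp P.
  by rewrite mcoeff_msupp; apply: contraNneq hm => ->; rewrite mul0rn.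
by rewrite mdegD mdeg1 addn1 => -[].
Qed.

Lemma deriv_homog0 (P : {mpoly R[3]}) i : P \is 0.-homog -> P^`M(i) = 0.
Proof.
move=> /dhomogP hP; apply/mpolyP => m; rewrite mcoeff_mderiv mcoeff0.
apply/eqP; rewrite mulrn_eq0 /= mcoeff_eq0; apply/negP => /hP /=.
by rewrite mdegD mdeg1 addn1.
Qed.

Lemma euler d (P : {mpoly R[3]}) : P \is d.-homog ->
  \sum_(i < 3) 'X_i * P^`M(i) = d%:R *: P.
Proof.
move=> /dhomogP hP; rewrite {2}(mpolyE P) scaler_sumr.
transitivity (\sum_(i < 3) \sum_(m <- msupp P) P@_m *: ('X_i * ('X_[m])^`M(i))).
  apply: eq_bigr => i _; rewrite {1}(mpolyE P) raddf_sum mulr_sumr.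
  by apply: eq_bigr => m _ /=; rewrite mderivZ scalerAr.
rewrite exchange_big /= !big_seq; apply: eq_bigr => m /hP /= <-.
rewrite -scaler_sumr scalerA mulrC -scalerA; congr (_ *: _).
transitivity (\sum_(i < 3) (m i)%:R *: ('X_[m] : {mpoly R[3]})).
  apply: eq_bigr => i _; rewrite mderivX -scalerAr -mpolyXD.
  have [->|mi] := eqVneq (m i) 0%N; first by rewrite !scale0r.
  by rewrite addmC submK // lep1mP.
by rewrite -scaler_suml -natr_sum mdegE.
Qed.

(** Apply the divergence formula to P grad Q - Q grad P; its radial component is
    given by the Euler identity. *)
Lemma sphint_green d e (P Q : {mpoly R[3]}) : P \is d.-homog -> Q \is e.-homog ->
  sphint (P * lap Q) - sphint (Q * lap P) =
  (d + e).+1%:R * (e%:R - d%:R) * sphint (P * Q).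
Proof.
move=> hP hQ.
pose V i := P * Q^`M(i) - Q * P^`M(i).
have divV : P * lap Q - Q * lap P = \sum_(i < 3) (V i)^`M(i).
  rewrite /lap !mulr_sumr -sumrB; apply: eq_bigr => i _.
  rewrite /V mderivB !mderivM; ring.
have eulV : \sum_(i < 3) 'X_i * V i = (e%:R - d%:R) *: (P * Q).
  rewrite scalerBl scalerAr -(euler hQ) -[in X in _ - X]mulrC scalerAr -(euler hP).
  rewrite !mulr_sumr -sumrB; apply: eq_bigr => i _; rewrite /V; ring.
rewrite -sphintB divV sphint_sum.
have [de0|[n de]] : (d + e = 0 \/ exists n, d + e = n.+1)%N.
  by case: (d + e)%N => [|n]; [left|right; exists n].
  have [d0 e0] : d = 0%N /\ e = 0%N by lia.
  rewrite d0 e0 subrr mulr0 mul0r big1 // => i _.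
  rewrite d0 in hP; rewrite e0 in hQ.
  by rewrite /V (deriv_homog0 i hP) (deriv_homog0 i hQ) !mulr0 subrr mderiv0 sphint0.
have hV i : V i \is n.-homog.
  apply: rpredB.
    case: e hQ de {eulV divV} => [|e] hQ de; first by rewrite deriv_homog0 // mulr0; exact: rpred0.
    have -> : n = (d + e)%N by lia.
    by apply: dhomogM => //; exact: deriv_homog.
  case: d hP de {eulV divV} => [|d] hP de; first by rewrite deriv_homog0 // mulr0; exact: rpred0.
  have -> : n = (e + d)%N by lia.
  by apply: dhomogM => //; exact: deriv_homog.
transitivity (n.+2%:R * sphint (\sum_(i < 3) 'X_i * V i)).
  by rewrite sphint_sum mulr_sumr; apply: eq_bigr => i _; exact: sphint_deriv.
by rewrite eulV sphintZ de mulrA.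
Qed.

Lemma harmonic_orth d e (P Q : {mpoly R[3]}) : P \is d.-homog -> Q \is e.-homog ->
  lap P = 0 -> lap Q = 0 -> d != e -> sphint (P * Q) = 0.
Proof.
move=> hP hQ lP lQ de; have := sphint_green hP hQ.
rewrite lP lQ !mulr0 sphint0 subrr => /esym/eqP.
rewrite mulf_eq0 mulf_eq0 pnatr_eq0 /= subr_eq0 eqr_nat eq_sym (negPf de) /=.
by move/eqP.
Qed.
End PolyIntegral.

(** * Definiteness of the inner product on polynomials *)

Lemma integral_eq0_negligible d (X : measurableType d) (R : realType)
    (mu : {measure set X -> \bar R}) (D : set X) (g : X -> R) :
  (\int[mu]_(x in D) (g x)%:E = 0)%E -> measurable D -> measurable_fun setT g ->
  (forall x, D x -> 0 <= g x) ->
  exists N, [/\ measurable N, mu N = 0%E & forall x, D x -> g x != 0 -> N x].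
Proof.
move=> Ig mD mg g0.
have mgE : measurable_fun D (EFin \o g).
  by apply: measurable_funTS; exact/measurable_EFinP.
have Iabs : (\int[mu]_(x in D) `|(EFin \o g) x| = 0)%E.
  by rewrite -Ig; apply: eq_integral => x /set_mem /g0 gx; rewrite gee0_abs ?lee_fin.
have [N [mN N0 subN]] := proj1 (ae_eq_integral_abs mu mD mgE) Iabs.
exists N; split => // x Dx gx; apply: subN => /= /(_ Dx) [gx0].
by move: gx; rewrite gx0 eqxx.
Qed.

Section Positivity.
Variable R : realType.
Local Notation S2 := (S2 R).
Local Notation leb := (@lebesgue_measure R).
Local Notation leb2 := (leb \x leb)%E.

Lemma polar_angle (x y : R) : x ^+ 2 + y ^+ 2 = 1 ->
  exists2 t, 0 <= t <= 2 * pi & cos t = x /\ sin t = y.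
Proof.
move=> xy; have x1 : -1 <= x <= 1.
  have := sqr_ge0 y; have := sqr_ge0 x; move: xy; nra.
have a0 := acos_ge0 x1; have api := acos_lepi x1.
have [y0|y0] := leP 0 y.
  exists (acos x); first by rewrite a0 /=; have := pi_ge0 R; lra.
  split; first by rewrite acosK.
  by rewrite sin_acos // -xy addrAC subrr add0r sqrtr_sqr ger0_norm.
exists (2 * pi - acos x); first by have := pi_ge0 R; lra.
have e2 : 2 * pi - acos x = - acos x + pi *+ 2 :> R by rewrite mulr_natl addrC.
split; rewrite e2 ?cosD2pi ?sinD2pi ?cosN ?sinN; first by rewrite acosK.
by rewrite sin_acos // -xy addrAC subrr add0r sqrtr_sqr ltr0_norm // opprK.
Qed.

(** The zero set of a polynomial is studied in coordinates, so every point of the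
    sphere must have some. *)
Lemma spherical_surj (p : S2) : exists2 u, spherical_domain u & spherical u = p.
Proof.
have := S2val_sphere p; rewrite /unit_sphere /= /sqnorm sum3.
set x := S2val p 0 0; set y := S2val p 0 1; set z := S2val p 0 2 => h.
have z1 : -1 <= z <= 1.
  have := sqr_ge0 x; have := sqr_ge0 y; move: h; nra.
pose s := Num.sqrt (1 - z ^+ 2).
have s0 : 0 <= s by exact: sqrtr_ge0.
have ss : s ^+ 2 = x ^+ 2 + y ^+ 2.
  rewrite sqr_sqrtr; first by rewrite -h; ring.
  by have := sqr_ge0 x; have := sqr_ge0 y; move: h; lra.
have [t ht [ct st]] : exists2 t, 0 <= t <= 2 * pi & s * cos t = x /\ s * sin t = y.
  have [s00|sn0] := eqVneq s 0.
    exists 0; first by rewrite lexx /= mulr_ge0 // pi_ge0.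
    have x0 : x ^+ 2 = 0 by have := sqr_ge0 x; have := sqr_ge0 y; move: ss; rewrite s00; nra.
    have y0 : y ^+ 2 = 0 by have := sqr_ge0 x; have := sqr_ge0 y; move: ss; rewrite s00; nra.
    by rewrite s00 !mul0r; move/eqP: x0; move/eqP: y0; rewrite !sqrf_eq0 => /eqP -> /eqP ->.
  have [|t ht [ct st]] := @polar_angle (x / s) (y / s).
    by rewrite !exprMn -mulrDl -ss exprVn divff // expf_neq0.
  by exists t => //; rewrite ct st ![s * _]mulrC !divfK.
exists (t, acos z).
  by split; rewrite /= in_itv /= // acos_ge0 // acos_lepi.
apply: S2val_inj; rewrite /spherical /S2val /= sin_acos // acosK //.
by apply: row3P; rewrite !mxE /= -/s.
Qed.

Lemma continuous_spherical_pfun (P : {mpoly R[3]}) :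
  continuous (fun u : R * R => pfun P (spherical u)).
Proof.
have c1 (f : R -> R) : continuous f -> continuous (fun u : R * R => f u.1).
  by move=> cf u; apply: (@continuous_comp _ _ _ fst f); [exact: cvg_fst|exact: cf].
have c2 (f : R -> R) : continuous f -> continuous (fun u : R * R => f u.2).
  by move=> cf u; apply: (@continuous_comp _ _ _ snd f); [exact: cvg_snd|exact: cf].
have cM (g h : R * R -> R) : continuous g -> continuous h -> continuous (fun u => g u * h u).
  by move=> cg ch u; exact: (cvgM (cg u) (ch u)).
have ct1 := c1 _ (@continuous_cos R); have ct2 := c2 _ (@continuous_cos R).
have st1 := c1 _ (@continuous_sin R); have st2 := c2 _ (@continuous_sin R).
apply: continuous_meval => i.
case: (ord3P i) => ->; rewrite /coords /spherical /S2val /=.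
- by under eq_fun do rewrite mxE /=; exact: cM st2 ct1.
- by under eq_fun do rewrite mxE /=; exact: cM st2 st1.
- by under eq_fun do rewrite mxE /=; exact: ct2.
Qed.

(** If P does not vanish at a point, then in spherical coordinates it is nonzero
    on a rectangle of positive area near that point; the open rectangle stays in
    the interior of the domain, where the density sin is positive. *)
Lemma sphint_sq_eq0 (P : {mpoly R[3]}) : sphint (P * P) = 0 -> forall p, pfun P p = 0.
Proof.
move=> I0 p.
pose g (u : R * R) := pfun P (spherical u) ^+ 2 * sin u.2.
have cf := @continuous_spherical_pfun P.
have mg : measurable_fun [set: R * R] g.
  apply: measurable_funM; last exact: measurable_sin2.
  apply: measurable_funX.
  exact: (measurableT_comp (measurable_continuous_S2 (@continuous_pfun _ P)) (@measurable_spherical R)).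
have g0 u : spherical_domain u -> 0 <= g u.
  by move=> /dom_sin_ge0 su; rewrite mulr_ge0 // sqr_ge0.
have Ig : (\int[leb2]_(u in @spherical_domain R) (g u)%:E = 0)%E.
  have := sphintE (P * P); rewrite I0.
  rewrite (surface_integral (measurable_continuous_S2 (@continuous_pfun _ (P * P)))) => h.
  rewrite -[RHS]/(0%:E)%E -h.
  by apply: eq_integral => u _; rewrite pfunM -expr2.
have [N [mN N0 subN]] := integral_eq0_negligible Ig (@measurable_dom R) mg g0.
have [u0 du0 <-] := spherical_surj p.
apply/eqP/negPn/negP => Pn0.
have : nbhs u0 [set u | pfun P (spherical u) != 0].
  have := cf u0 => /(_ [set x | x != 0]); apply.
  by apply: open_nbhs_nbhs; split => //; exact: open_neq.
move=> /nbhs_ballP[e /= e0 he].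
case: u0 du0 Pn0 he => t0 f0 [/=]; rewrite !in_itv /= => /andP[t00 t01] /andP[f00 f01] Pn0 he.
have p0 := pi_gt0 R.
pose a1 := Num.max 0 (t0 - e); pose b1 := Num.min (2 * pi) (t0 + e).
pose a2 := Num.max 0 (f0 - e); pose b2 := Num.min pi (f0 + e).
have ab1 : a1 < b1.
  by rewrite /a1 /b1 lt_min !gt_max; lra.
have ab2 : a2 < b2.
  by rewrite /a2 /b2 lt_min !gt_max; lra.
have BN : `]a1, b1[%classic `*` `]a2, b2[%classic `<=` N.
  move=> [t f] [/=]; rewrite !in_itv /= /a1 /b1 /a2 /b2 !lt_min !gt_max.
  move=> /andP[/andP[h1 h2] /andP[h3 h4]] /andP[/andP[k1 k2] /andP[k3 k4]].
  apply: subN; first by split; rewrite /= in_itv /=; lra.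
  rewrite /g mulf_neq0 //; last by rewrite gt_eqF //= sin_gt0_pi // k1 k3.
  by rewrite expf_neq0 //; apply: he; split; rewrite /ball /= ltr_distlC; lra.
have : (leb2 (`]a1, b1[%classic `*` `]a2, b2[%classic) <= leb2 N)%E.
  apply: le_measure => //; rewrite inE //.
  by apply: measurableX; exact: measurable_itv.
rewrite N0 product_measure1E; [|exact: measurable_itv..].
rewrite /= !lebesgue_measure_itv /= !lte_fin ab1 ab2 -!EFinB -EFinM lee_fin.
by rewrite leNgt mulr_gt0 // subr_gt0.
Qed.
End Positivity.

(** * Orthogonal projection and harmonic components *)

Section MpolyVanish.
Variable R : realType.

(** A form is determined by its values on the sphere, in contrast with general
    polynomials, which matter only modulo x^2 + y^2 + z^2 - 1. *)
Lemma homog_vanish_sphere d (P : {mpoly R[3]}) : P \is d.-homog ->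
  (forall v, unit_sphere v -> P.@[coords v] = 0) -> P = 0.
Proof.
move=> hP h; apply: mpoly_vanish => v.
pose w : 'rV[R]_3 := \row_i v i.
have vw : P.@[v] = P.@[coords w] by apply: meval_eq => i; rewrite /coords mxE.
have scale r u : P.@[coords (r *: u)] = r ^+ d * P.@[coords u].
  by rewrite -(homog_scale _ _ hP); apply: meval_eq => i; rewrite /coords mxE.
rewrite vw; have [->|/normalize[r [u [_ _ u1 ->]]]] := eqVneq w 0.
  by rewrite -(scale0r (row3 1 0 0)) scale h ?mulr0 //; exact: unit_e1.
by rewrite scale h ?mulr0.
Qed.
End MpolyVanish.

Section Projection.
Variable R : realType.
Local Notation V := {mpoly R[3]}.
Local Notation I := (@sphint R).

(** Linear functionals of the restriction of a polynomial to the sphere; the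
    instance of interest is the pairing with a square integrable function. *)
Definition lin_functional (phi : V -> R) :=
  [/\ forall P Q, phi (P + Q) = phi P + phi Q, forall c P, phi (c *: P) = c * phi P
    & forall P, (forall p, pfun P p = 0) -> phi P = 0].

(** The linear span, encoded by its universal property so that it needs no
    explicit coefficients. *)
Definition span_of (hs : seq V) (g : V) := forall S : V -> Prop,
  S 0 -> (forall P Q, S P -> S Q -> S (P + Q)) -> (forall c P, S P -> S (c *: P)) ->
  (forall h, h \in hs -> S h) -> S g.

Lemma lin_functional_sphint h : lin_functional (fun P => I (h * P)).
Proof.
split => [P Q|c P|P P0].
- by rewrite mulrDr sphintD.
- by rewrite -scalerAr sphintZ.
- by rewrite -(sphint0 R); apply: eq_sphint => p; rewrite pfunM P0 mulr0 pfun0.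
Qed.

Lemma lin_functional_ext phi hs g h : lin_functional phi ->
  span_of hs g -> (forall k, k \in hs -> phi k = I (h * k)) -> phi g = I (h * g).
Proof.
move=> [phiD phiZ phi0] sg hk; apply: (sg (fun g => phi g = I (h * g))) => //.
- by rewrite mulr0 sphint0 phi0 // => p; rewrite pfun0.
- by move=> P Q hP hQ; rewrite phiD mulrDr sphintD hP hQ.
- by move=> c P hP; rewrite phiZ -scalerAr sphintZ hP.
Qed.

(** Gram-Schmidt: the new vector h is replaced by its component h' orthogonal to
    the previous ones.  When h' has norm zero it vanishes on the sphere, and then
    phi vanishes on it as well. *)
Lemma gram_projection hs phi : lin_functional phi ->
  exists g, span_of hs g /\ forall h, h \in hs -> phi h = I (g * h).
Proof.
elim: hs phi => [|h t IH] phi lphi; first by exists 0; split => // S S0.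
have [g0 [sg0 hg0]] := IH _ lphi.
have [g1 [sg1 hg1]] := IH _ (lin_functional_sphint h).
pose h' := h - g1.
have subspan g : span_of t g -> span_of (h :: t) g.
  by move=> sg S S0 SD SZ Sh; apply: sg => // k kt; apply: Sh; rewrite inE kt orbT.
have sh : span_of (h :: t) h' by move=> S S0 SD SZ Sh; rewrite /h' -scaleN1r;
  exact: (SD _ _ (Sh _ (mem_head _ _)) (SZ _ _ (subspan _ sg1 S S0 SD SZ Sh))).
have h't k : k \in t -> I (h' * k) = 0.
  by move=> kt; rewrite /h' mulrBl sphintB hg1 // subrr.
have h'span g : span_of t g -> I (h' * g) = 0.
  move=> sg; apply: (sg (fun g => I (h' * g) = 0)) => //.
  - by rewrite mulr0 sphint0.
  - by move=> P Q hP hQ; rewrite mulrDr sphintD hP hQ addr0.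
  - by move=> c P hP; rewrite -scalerAr sphintZ hP mulr0.
have h'h : I (h' * h) = I (h' * h').
  by rewrite -[RHS]/(I (h' * (h - g1))) mulrBr sphintB (h'span _ sg1) subr0.
have [z|nz] := eqVneq (I (h' * h')) 0.
  have h'0 := sphint_sq_eq0 z.
  exists g0; split; first exact: subspan.
  move=> k; rewrite inE => /predU1P[->|]; last exact: hg0.
  have -> : h = h' + g1 by rewrite subrK.
  case: (lphi) => phiD _ phi0; rewrite phiD phi0 // add0r mulrDr sphintD.
  rewrite (lin_functional_ext lphi sg1 hg0).
  have e : I (g0 * h') = 0 by case: (lin_functional_sphint g0) => _ _; exact.
  by rewrite e add0r.
pose c := (phi h - I (g0 * h)) / I (h' * h').
exists (g0 + c *: h'); split.
  move=> S S0 SD SZ Sh.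
  exact: (SD _ _ (subspan _ sg0 S S0 SD SZ Sh) (SZ _ _ (sh S S0 SD SZ Sh))).
move=> k; rewrite mulrDl -scalerAl sphintD sphintZ inE => /predU1P[->|kt].
  by rewrite h'h /c divfK // addrC subrK.
by rewrite h't // mulr0 addr0; exact: hg0.
Qed.

Lemma homog_projection d phi : lin_functional phi ->
  exists g : V, g \is d.-homog /\ forall h, h \is d.-homog -> phi h = I (g * h).
Proof.
move=> lphi.
pose hs : seq V := map (fun m : 'X_{1..3 < d.+1} => 'X_[m])
  [seq m : 'X_{1..3 < d.+1} <- enum {: 'X_{1..3 < d.+1}} | mdeg m == d].
have [g [sg hg]] := gram_projection hs lphi.
exists g; split.
  apply: (sg (fun g => g \is d.-homog)).
  - exact: rpred0.
  - by move=> P Q; exact: rpredD.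
  - by move=> c P; exact: rpredZ.
  - by move=> h /mapP[m]; rewrite mem_filter => /andP[/eqP md _] ->; rewrite dhomogX /= md.
move=> h /dhomogP hh; apply: (lin_functional_ext lphi) hg.
move=> S S0 SD SZ Sh; rewrite (mpolyE h) big_seq.
apply: (big_ind S) => // m /hh /= md; apply: SZ; apply: Sh.
have mlt : (mdeg m < d.+1)%N by rewrite ltnS -[X in (X <= _)%N]/(mdeg m) md.
apply/mapP; exists (BMultinom mlt) => //.
by rewrite mem_filter mem_enum /= md eqxx.
Qed.

Lemma rquad_homog : rquad R \is 2.-homog.
Proof.
apply: rpred_sum => i _; rewrite expr2.
have hX : ('X_i : V) \is 1.-homog by rewrite dhomogX /= mdeg1.
exact: (dhomogM hX hX).
Qed.

Lemma tmom_odd_cos (a b : R) p q : a < b ->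
  (forall p q, sin a ^+ p.+1 * cos a ^+ q = sin b ^+ p.+1 * cos b ^+ q) ->
  odd q -> tmom a b p q = 0.
Proof.
move=> ab per qo; rewrite -(odd_double_half q) qo add1n.
elim: (q./2) => [|k IH]; first exact: tmom_sin1.
have := tmom_raise_cos ab per p (k.*2).+1; rewrite IH mulr0 => /esym/eqP.
by rewrite mulf_eq0 pnatr_eq0 /= => /eqP.
Qed.

Lemma tmom_odd_sin p q : odd p -> tmom 0 (2 * pi) p q = 0 :> R.
Proof.
move=> po; rewrite -(odd_double_half p) po add1n.
elim: (p./2) => [|k IH]; first exact: tmom_cos1.
have := tmom_raise_sin (twopi_pos R) (@per_2pi R) (k.*2).+1 q; rewrite IH mulr0 => /esym/eqP.
by rewrite mulf_eq0 pnatr_eq0 /= => /eqP.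
Qed.

Lemma sphint_odd d (P : V) : P \is d.-homog -> odd d -> I P = 0.
Proof.
move=> /dhomogP hP od; rewrite (mpolyE P) sphint_sum big_seq big1 // => m /hP /= md.
rewrite sphintZ sphint_mono.
have : odd (m 0%R + m 1%R + m 2%R)%N by rewrite (_ : (_ + _)%N = d) // -[RHS]md mdegE sum3.
rewrite !oddD; case m0: (odd (m 0%R)).
  by rewrite (tmom_odd_cos _ (twopi_pos R) (@per_2pi R) m0) mul0r mulr0.
case m1: (odd (m 1%R)); first by rewrite (tmom_odd_sin _ m1) mul0r mulr0.
move=> m2; rewrite (tmom_odd_cos _ (pi_pos R) (@per_pi R) m2) //.
by rewrite !mulr0.
Qed.

(** Changes the degree of a form by 2 n without changing it on the sphere. *)
Definition raise n (P : V) : V := rquad R ^+ n * P.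

Lemma pfun_rquad p : pfun (rquad R) p = 1.
Proof. by rewrite /pfun rquadE; exact: S2val_sphere. Qed.

Lemma pfun_raise n P p : pfun (raise n P) p = pfun P p.
Proof. by rewrite /raise pfunM {1}/pfun rmorphXn /= -/(pfun _ p) pfun_rquad expr1n mul1r. Qed.

Lemma raise_homog n d (P : V) : P \is d.-homog -> raise n P \is (n.*2 + d).-homog.
Proof.
move=> hP; elim: n => [|n IH]; first by rewrite /raise mul1r.
by rewrite /raise exprS -mulrA doubleS 2!addSn; exact: (dhomogM rquad_homog IH).
Qed.

(** Multiplication by x^2 + y^2 + z^2 does not change values on the sphere and
    raises the degree by 2, so all terms of one parity can be brought to the same
    degree. *)
Lemma sphere_two_homog n (P : V) : (msize P <= n.+1)%N ->
  exists A B : V, [/\ A \is n.-homog, B \is n.+1.-homog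
    & forall p, pfun P p = pfun A p + pfun B p].
Proof.
move=> sP; rewrite (pihomog_partitionE sP).
have : forall k, (k <= n.+1)%N -> exists A B : V, [/\ A \is n.-homog, B \is n.+1.-homog
    & forall p, pfun (\sum_(d < k) pihomog mdeg d P) p = pfun A p + pfun B p].
  elim=> [_|k IH kn].
    exists 0, 0; split; [exact: rpred0|exact: rpred0|] => p.
    by rewrite big_ord0 !pfun0 addr0.
  have [A [B [hA hB AB]]] := IH (ltnW kn).
  have hk : pihomog mdeg k P \is k.-homog by exact: pihomogP.
  have [od|ev] := boolP (odd (n - k)).
    exists A, (B + raise (n.+1 - k)./2 (pihomog mdeg k P)); split => //.
      apply: rpredD => //.
      have := raise_homog (n.+1 - k)./2 hk.
      have ev : ~~ odd (n.+1 - k) by rewrite subSn //= od.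
      by rewrite (_ : ((n.+1 - k)./2.*2 + k = n.+1)%N) // even_halfK // subnK // ltnW.
    by move=> p; rewrite big_ord_recr /= !pfunD AB pfun_raise addrA.
  exists (A + raise (n - k)./2 (pihomog mdeg k P)), B; split => //.
    apply: rpredD => //; have := raise_homog (n - k)./2 hk.
    by rewrite (_ : ((n - k)./2.*2 + k = n)%N) // even_halfK // subnK.
  by move=> p; rewrite big_ord_recr /= !pfunD AB pfun_raise addrAC.
exact.
Qed.

Section Expansion.
Variables (phi : V -> R) (F2 : R).
Hypothesis lphi : lin_functional phi.

(** The squared distance |f - P|^2, expanded, when phi is the pairing with f and
    F2 is |f|^2. *)
Definition sqdist (P : V) : R := F2 - 2 * phi P + I (P * P).

Lemma phi_eq P Q : (forall p, pfun P p = pfun Q p) -> phi P = phi Q.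
Proof.
case: lphi => phiD phiZ phi0 PQ.
have : phi (P + (-1) *: Q) = 0 by apply: phi0 => p; rewrite pfunD pfunZ PQ mulN1r subrr.
by rewrite phiD phiZ mulN1r => /eqP; rewrite subr_eq0 => /eqP.
Qed.

Lemma I_eql P Q S : (forall p, pfun P p = pfun Q p) -> I (P * S) = I (Q * S).
Proof. by move=> PQ; apply: eq_sphint => p; rewrite !pfunM PQ. Qed.

Lemma I_eqr P Q S : (forall p, pfun P p = pfun Q p) -> I (S * P) = I (S * Q).
Proof. by move=> PQ; apply: eq_sphint => p; rewrite !pfunM PQ. Qed.

Definition hproj d : V := projT1 (cid (homog_projection d lphi)).

Lemma hproj_homog d : hproj d \is d.-homog.
Proof. by rewrite /hproj; case: cid => g /= []. Qed.

Lemma hprojP d h : h \is d.-homog -> phi h = I (hproj d * h).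
Proof. by rewrite /hproj; case: cid => g /= [_]; apply. Qed.

(** The projection to forms of degree d minus the one to forms of degree d - 2;
    on the sphere this is the projection to the part of degree d orthogonal to
    lower degrees of the same parity. *)
Definition hcomp d : V :=
  if d is d'.+2 then hproj d'.+2 - raise 1 (hproj d') else hproj d.

Lemma hcomp_homog d : hcomp d \is d.-homog.
Proof.
case: d => [|[|d]]; [exact: hproj_homog..|].
apply: rpredB; first exact: hproj_homog.
exact: (raise_homog 1 (hproj_homog d)).
Qed.

Lemma hcomp_orth d h : h \is d.-homog -> I (hcomp d.+2 * h) = 0.
Proof.
move=> hh; rewrite /hcomp mulrBl sphintB.
have -> : I (hproj d.+2 * h) = phi h.
  rewrite (@I_eqr h (raise 1 h)); last by move=> p; rewrite pfun_raise.
  rewrite -hprojP; last exact: (raise_homog 1 hh).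
  by apply: phi_eq => p; rewrite pfun_raise.
have -> : I (raise 1 (hproj d) * h) = phi h.
  by rewrite (hprojP hh); apply: I_eql => p; exact: pfun_raise.
by rewrite subrr.
Qed.

Lemma lap_homog d (P : V) : P \is d.+2.-homog -> lap P \is d.-homog.
Proof. by move=> hP; apply: rpred_sum => i _; do 2 apply: deriv_homog. Qed.

Lemma lap_homog0 d (P : V) : P \is d.-homog -> (d < 2)%N -> lap P = 0.
Proof.
case: d => [|[|//]] hP _; rewrite /lap big1 // => i _.
  by rewrite (deriv_homog0 i hP) mderiv0.
by apply: deriv_homog0; exact: deriv_homog.
Qed.

(** For P = hcomp d and Q = lap P the Green formula expresses int Q^2 through
    int (P * Q) and int (P * lap Q).  On the sphere both Q and lap Q agree with
    forms of degree d - 2, to which P is orthogonal; so Q = 0. *)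
Lemma hcomp_harmonic d : lap (hcomp d) = 0.
Proof.
case: d => [|[|d]]; [exact: (lap_homog0 (hcomp_homog 0))|exact: (lap_homog0 (hcomp_homog 1))|].
have hQ := lap_homog (hcomp_homog d.+2).
set Q := lap _ in hQ *.
have := sphint_green (hcomp_homog d.+2) hQ.
rewrite (hcomp_orth hQ) mulr0.
have -> : I (hcomp d.+2 * lap Q) = 0.
  have [d2|d2] := ltnP d 2; first by rewrite (lap_homog0 hQ d2) mulr0 sphint0.
  case: d d2 Q hQ => [|[|d]] // _ Q hQ.
  have hl := lap_homog hQ.
  rewrite (@I_eqr _ (raise 1 (lap Q))); last by move=> p; rewrite pfun_raise.
  apply: hcomp_orth; exact: (raise_homog 1 hl).
rewrite sub0r -/Q => /eqP; rewrite oppr_eq0 => /eqP /sphint_sq_eq0 Q0.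
apply: (homog_vanish_sphere hQ) => v v1.
by have := Q0 (mkS2 v1).
Qed.

Definition hsum N : V := \sum_(0 <= d < N) hcomp d.

(** Telescoping within each parity class. *)
Lemma hsum_pfun N p : pfun (hsum N.+2) p = pfun (hproj N.+1) p + pfun (hproj N) p.
Proof.
elim: N => [|N IH].
  by rewrite /hsum !big_nat_recr //= big_geq // add0r pfunD addrC.
rewrite /hsum big_nat_recr //= pfunD -/(hsum _) IH -scaleN1r pfunD pfunZ pfun_raise.
ring.
Qed.

(** The partial sum telescopes to the projections in the two top degrees, which
    are orthogonal to each other by parity.  Every polynomial of degree at most N
    is on the sphere a sum of forms of these two degrees, so the partial sum is
    the orthogonal projection to a space that contains it. *)
Lemma hsum_best N P : (msize P <= N.+1)%N -> sqdist (hsum N.+2) <= sqdist P.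
Proof.
move=> sP; have [A [B [hA hB AB]]] := sphere_two_homog sP.
pose S := hproj N.+1 + hproj N; pose Q := B + A.
have phi_def : forall X Y, X \is N.+1.-homog -> Y \is N.-homog ->
    phi (X + Y) = I (S * (X + Y)).
  move=> X Y hX hY; case: lphi => phiD _ _.
  rewrite phiD mulrDl !mulrDr !sphintD -(hprojP hX) -(hprojP hY).
  have oddN : odd (N.+1 + N) by rewrite addSn /= addnn odd_double.
  have -> : I (hproj N.+1 * Y) = 0 by apply: sphint_odd oddN; apply: dhomogM => //; exact: hproj_homog.
  have -> : I (hproj N * X) = 0.
    rewrite addnC in oddN; apply: sphint_odd oddN; apply: dhomogM => //; exact: hproj_homog.
  by rewrite addr0 add0r.
have sqE X Y : (forall p, pfun X p = pfun Y p) -> sqdist X = sqdist Y.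
  by move=> XY; rewrite /sqdist (phi_eq XY) (I_eql _ XY) (I_eqr _ XY).
rewrite (sqE (hsum N.+2) S); last by move=> p; rewrite hsum_pfun pfunD.
rewrite (sqE P Q); last by move=> p; rewrite AB pfunD addrC.
have := phi_def _ _ hB hA; rewrite -/Q => phiQ.
have := phi_def _ _ (hproj_homog N.+1) (hproj_homog N); rewrite -/S => phiS.
rewrite /sqdist phiQ phiS.
have := sphint_sq_ge0 (S - Q).
have -> : I ((S - Q) * (S - Q)) = I (S * S) - 2 * I (S * Q) + I (Q * Q).
  rewrite mulrBl !mulrBr !sphintB (mulrC Q S); ring.
lra.
Qed.

Lemma hsum_cvg : (forall P, 0 <= sqdist P) ->
  (forall e, 0 < e -> exists P, sqdist P < e) ->
  (fun N => sqdist (hsum N)) @ \oo --> 0.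
Proof.
move=> E0 dense; apply/cvgrPdist_lt => e e0.
have [P Pe] := dense e e0.
exists (msize P).+2 => // N /= hN.
rewrite sub0r normrN ger0_norm //; apply: le_lt_trans Pe.
case: N hN => [|[|N]] //; rewrite !ltnS => hN.
by apply: hsum_best; exact: leqW.
Qed.
End Expansion.
End Projection.

(** * Density of polynomials in the square integrable functions *)

Section L2Density.
Variable R : realType.
Local Notation S2 := (S2 R).
Local Notation surf := (@surface_measure R).

Definition sqint (g : S2 -> R) : \bar R := (\int[surf]_p (g p ^+ 2)%:E)%E.

Lemma measurable_sq (g : S2 -> R) : measurable_fun [set: S2] g ->
  measurable_fun [set: S2] (fun p => (g p ^+ 2)%:E).
Proof. by move=> mg; apply/measurable_EFinP; exact: measurable_funX. Qed.

Lemma sqint_ge0 g : (0 <= sqint g)%E.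
Proof. by apply: integral_ge0 => p _; rewrite lee_fin sqr_ge0. Qed.

Lemma measurable_pfun (P : {mpoly R[3]}) : measurable_fun [set: S2] (pfun P).
Proof. exact: (measurable_continuous_S2 (@continuous_pfun _ P)). Qed.

Lemma sqint_le2 (g u v : S2 -> R) : measurable_fun [set: S2] g ->
  measurable_fun [set: S2] u -> measurable_fun [set: S2] v ->
  (forall p, g p = u p + v p) -> (sqint g <= 2%:E * sqint u + 2%:E * sqint v)%E.
Proof.
move=> mg mu mv guv.
rewrite /sqint -!ge0_integralZl //; last 4 first.
- exact: measurable_sq.
- by move=> p _; rewrite lee_fin sqr_ge0.
- exact: measurable_sq.
- by move=> p _; rewrite lee_fin sqr_ge0.
rewrite -ge0_integralD //; last 4 first.
- by move=> p _; apply: mule_ge0; rewrite lee_fin ?sqr_ge0.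
- by apply: emeasurable_funM => //; exact: measurable_sq.
- by move=> p _; apply: mule_ge0; rewrite lee_fin ?sqr_ge0.
- by apply: emeasurable_funM => //; exact: measurable_sq.
apply: ge0_le_integral => //.
- by move=> p _; rewrite lee_fin sqr_ge0.
- exact: measurable_sq.
- by apply: emeasurable_funD; apply: emeasurable_funM => //; exact: measurable_sq.
- move=> p _; rewrite -!EFinM -EFinD lee_fin guv; have := sqr_ge0 (u p - v p); nra.
Qed.

Definition sqdiff (g h : S2 -> R) : \bar R := sqint (fun p => g p - h p).

(** Membership in the closure of the polynomials; it contains continuous
    functions by uniform approximation and is enlarged from there to indicators,
    simple functions and all square integrable functions. *)
Definition L2approx (g : S2 -> R) := measurable_fun [set: S2] g /\
  forall e : R, 0 < e -> exists P, (sqdiff g (pfun P) < e%:E)%E.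

Lemma sqint_split (g u v : S2 -> R) (e : R) : 0 < e -> measurable_fun [set: S2] g ->
  measurable_fun [set: S2] u -> measurable_fun [set: S2] v ->
  (forall p, g p = u p + v p) -> (sqint u < (e / 4)%:E)%E -> (sqint v < (e / 4)%:E)%E ->
  (sqint g < e%:E)%E.
Proof.
move=> e0 mg mu mv guv hu hv; apply: le_lt_trans (sqint_le2 mg mu mv guv) _.
have -> : e%:E = (2%:E * (e / 4)%:E + 2%:E * (e / 4)%:E)%E.
  by rewrite -!EFinM -EFinD; congr (_%:E); field.
by apply: lteD; rewrite lte_pmul2l.
Qed.

Lemma L2approx_closure (g : S2 -> R) : measurable_fun [set: S2] g ->
  (forall e : R, 0 < e -> exists2 h, L2approx h & (sqdiff g h < e%:E)%E) ->
  L2approx g.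
Proof.
move=> mg hg; split => // e e0; have e4 : 0 < e / 4 by rewrite divr_gt0.
have [h [mh hh] gh] := hg _ e4; have [P hP] := hh _ e4.
exists P; apply: (@sqint_split _ _ _ e e0 _ _ _ _ gh hP).
- by apply: measurable_funB => //; exact: measurable_pfun.
- exact: measurable_funB.
- by apply: measurable_funB => //; exact: measurable_pfun.
- by move=> p; rewrite subrKA.
Qed.

Lemma L2approxD g h : L2approx g -> L2approx h -> L2approx (fun p => g p + h p).
Proof.
move=> [mg hg] [mh hh]; split; first exact: measurable_funD.
move=> e e0; have e4 : 0 < e / 4 by rewrite divr_gt0.
have [P hP] := hg _ e4; have [Q hQ] := hh _ e4.
exists (P + Q); apply: (@sqint_split _ _ _ e e0 _ _ _ _ hP hQ).
- by apply: measurable_funB; [exact: measurable_funD|exact: measurable_pfun].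
- by apply: measurable_funB => //; exact: measurable_pfun.
- by apply: measurable_funB => //; exact: measurable_pfun.
- by move=> p; rewrite pfunD; ring.
Qed.

Lemma L2approxZ c g : L2approx g -> L2approx (fun p => c * g p).
Proof.
move=> [mg hg]; have mcg : measurable_fun [set: S2] (fun p => c * g p) by exact: measurable_funM.
split => // e e0.
have c0 : 0 < c ^+ 2 + 1 by rewrite ltr_wpDl // sqr_ge0.
have [P hP] := hg _ (divr_gt0 e0 c0).
exists (c *: P).
have -> : sqdiff (fun p => c * g p) (pfun (c *: P)) = ((c ^+ 2)%:E * sqdiff g (pfun P))%E.
  rewrite /sqdiff /sqint -ge0_integralZl_EFin ?sqr_ge0 //.
  - by apply: eq_integral => p _; rewrite pfunZ -mulrBr exprMn.
  - by move=> p _; rewrite lee_fin sqr_ge0.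
  - by apply: measurable_sq; apply: measurable_funB => //; exact: measurable_pfun.
have fin : sqdiff g (pfun P) \is a fin_num.
  by rewrite ge0_fin_numE ?sqint_ge0 // (lt_trans hP) // ltry.
move: hP; rewrite -(fineK fin) -EFinM !lte_fin => hP.
move: hP; rewrite ltr_pdivlMr // => hP.
have := fine_ge0 (sqint_ge0 (fun p => g p - pfun P p)); rewrite -/(sqdiff _ _); nra.
Qed.

Lemma L2approx_continuous (g : S2 -> R) : continuous g -> L2approx g.
Proof.
move=> cg; have mg := measurable_continuous_S2 cg; split => // e e0.
have [M hM] : exists M : R, surf [set: S2] = M%:E.
  exists (fine (surf [set: S2])); rewrite fineK // ge0_fin_numE //; exact: surface_finite.
have M0 : 0 <= M by rewrite -lee_fin -hM.
pose d := Num.min 1 (e / (M + 1)).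
have M1 : 0 < M + 1 by rewrite ltr_wpDl.
have d0 : 0 < d by rewrite lt_min ltr01 divr_gt0.
have [P hP] := sphere_weierstrass cg d0.
exists P; apply: (@le_lt_trans _ _ (\int[surf]_p (cst d%:E p))%E).
  apply: ge0_le_integral => //.
  - by move=> p _; rewrite lee_fin sqr_ge0.
  - by apply: measurable_sq; apply: measurable_funB => //; exact: measurable_pfun.
  - move=> p _; rewrite lee_fin -real_normK ?num_real // distrC expr2.
    have := hP p; rewrite lt_min => /andP[h1 h2].
    apply: (@le_trans _ _ (1 * d)); last by rewrite mul1r.
    by apply: ler_pM => //; apply: ltW => //; rewrite /d lt_min h1.
rewrite integral_cst //= hM -EFinM lte_fin.
apply: (@le_lt_trans _ _ (e / (M + 1) * M)).
  by apply: ler_wpM2r => //; rewrite /d ge_min lexx orbT.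
by rewrite mulrAC ltr_pdivrMr // mulrDr mulr1 ltrDl.
Qed.

(** Dominated convergence for the squared differences. *)
Lemma L2approx_limit (g : S2 -> R) (h : nat -> S2 -> R) (k : S2 -> R) :
  (forall n, L2approx (h n)) ->
  (forall p, h ^~ p @ \oo --> g p) ->
  (forall n p, (g p - h n p) ^+ 2 <= k p) ->
  surf.-integrable setT (EFin \o k) -> L2approx g.
Proof.
move=> hh hg hk ik.
have mg : measurable_fun [set: S2] g.
  apply: (measurable_fun_cvg (h := h)) => [n|p _]; last exact: hg.
  by case: (hh n).
apply: L2approx_closure => // e e0.
have hcv : (\int[surf]_p ((g p - h n p) ^+ 2)%:E)%E @[n --> \oo] --> 0%:E.
  rewrite [X in _ --> X](_ : _ = \int[surf]_p (cst 0%E p))%E; last by rewrite integral0.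
  apply: (@dominated_cvg _ _ _ surf setT measurableT _ _ (EFin \o k)) => //.
  - by move=> n; apply: measurable_sq; apply: measurable_funB => //; case: (hh n).
  - move=> p _; apply: cvg_EFin; first exact: nearW.
    have : (g p - h n p) ^+ 2 @[n --> \oo] --> (g p - g p) ^+ 2.
      have c1 : (g p - h n p) @[n --> \oo] --> g p - g p by exact: (cvgB (cvg_cst _) (hg p)).
      exact: (cvgM c1 c1).
    by rewrite subrr expr0n.
  - by move=> n p _; rewrite gee0_abs lee_fin ?sqr_ge0.
move: hcv => /fine_cvgP[fin /cvgrPdist_lt/(_ _ e0) cve].
have [N _ hN] := filterI fin cve.
have /= [f1 f2] := hN N (leqnn N).
exists (h N); first exact: hh.
rewrite /sqdiff /sqint -(fineK f1) lte_fin; move: f2.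
rewrite sub0r normrN; apply: le_lt_trans; exact: ler_norm.
Qed.

(** The distance to the complement of an open set U separates U from the rest, so
    the continuous functions min (1, n * dist) increase to the indicator of U. *)
Definition dist_to (A : set S2) (p : S2) : R :=
  inf ((fun a : S2 => `|S2val p - S2val a|) @` A).

Lemma dist_to_has_inf A p : A !=set0 -> has_inf ((fun a : S2 => `|S2val p - S2val a|) @` A).
Proof.
move=> [a Aa]; split; first by exists `|S2val p - S2val a|, a.
by exists 0 => _ [b _ <-].
Qed.

Lemma dist_to_lip A p q : A !=set0 -> dist_to A p <= `|S2val p - S2val q| + dist_to A q.
Proof.
move=> A0; rewrite -lerBlDl; apply: lb_le_inf; first by have [] := dist_to_has_inf q A0.
move=> _ [a Aa <-]; rewrite lerBlDl.
apply: le_trans (_ : `|S2val p - S2val a| <= _).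
  by apply: ge_inf; [have [] := dist_to_has_inf p A0|exists a].
by rewrite -(subrKA (S2val q)) ler_normD.
Qed.

Lemma continuous_dist_to A : A !=set0 -> continuous (dist_to A).
Proof.
move=> A0 p; have h := @continuous_S2val R p.
suff : forall e, 0 < e -> \forall q \near p, `|dist_to A p - dist_to A q| < e.
  by move/(@cvgrPdist_lt _ _ _ _ (nbhs_filter p)); exact.
move=> e e0; move/cvgrPdist_lt/(_ _ e0): h; apply: filterS => q pq'.
rewrite ltr_norml; have := dist_to_lip p q A0; have := dist_to_lip q p A0.
rewrite (distrC (S2val q)); lra.
Qed.

Lemma dist_to_ge0 A p : A !=set0 -> 0 <= dist_to A p.
Proof. by move=> A0; apply: lb_le_inf => [|_ [a _ <-]//]; have [] := dist_to_has_inf p A0. Qed.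

Lemma dist_to_eq0 A p : A p -> dist_to A p = 0.
Proof.
move=> Ap; apply/eqP; rewrite eq_le dist_to_ge0 ?andbT; last by exists p.
rewrite -(normr0 'rV[R]_3) -(subrr (S2val p)); apply: ge_inf; last by exists p.
by have [] := @dist_to_has_inf A p; [exists p|].
Qed.

Lemma dist_to_gt0 U p : open U -> U p -> (~` U) !=set0 -> 0 < dist_to (~` U) p.
Proof.
move=> oU Up A0; have /nbhs_ballP[e /= e0 eU] : nbhs p U by exact: open_nbhs_nbhs.
apply: (lt_le_trans e0); apply: lb_le_inf; first by have [] := dist_to_has_inf p A0.
move=> _ [a Ua <-]; rewrite leNgt; apply/negP => h; apply: Ua; apply: eU.
suff : ball (S2val p) e (S2val a) by [].
by rewrite -ball_normE.
Qed.

Lemma L2approx_open (U : set S2) : open U -> L2approx (\1_U : S2 -> R).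
Proof.
move=> oU; have [U0|U0] := pselect ((~` U) !=set0); last first.
  have -> : (\1_U : S2 -> R) = cst 1.
    apply/funext => p; rewrite indicE mem_set //.
    by apply: contrapT => Up; apply: U0; exists p.
  by apply: L2approx_continuous; exact: cst_continuous.
pose h n (p : S2) : R := Num.min 1 (n%:R * dist_to (~` U) p).
have h01 n p : 0 <= h n p <= 1.
  by rewrite /h le_min ler01 ge_min lexx mulr_ge0 // dist_to_ge0.
apply: (@L2approx_limit _ h (cst 1)).
- move=> n; apply: L2approx_continuous => p.
  apply: (@continuous_min _ _ (cst 1) (fun p => n%:R * dist_to (~` U) p)).
    exact: cst_continuous.
  exact: (cvgM (cvg_cst _) (@continuous_dist_to _ U0 p)).
- move=> p; have [Up|Up] := pselect (U p).
    rewrite indicE mem_set //; have d0 := dist_to_gt0 oU Up U0.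
    apply: cvg_near_cst; exists (Num.truncn (dist_to (~` U) p)^-1).+1 => // n /= hn.
    rewrite /h; apply/eqP; rewrite eq_sym min_l // -ler_pdivrMr // div1r.
    by apply: le_trans (ltW (truncnS_gt _)) _; rewrite ler_nat.
  rewrite indicE memNset //; apply: cvg_near_cst; apply: nearW => n.
  by rewrite /h dist_to_eq0 // mulr0 min_r.
- move=> n p; rewrite /= -real_normK ?num_real // expr_le1 //.
  have := h01 n p; rewrite indicE; case: (_ \in _) => /=; rewrite ler_norml; lra.
- apply: (@continuous_S2_integrable R (cst 1)); exact: cst_continuous.
Qed.

(** Sets whose indicator can be approximated form a lambda-system, and open sets
    are closed under intersection; hence all Borel sets qualify. *)
Lemma L2approx_indic (A : set S2) : measurable A -> L2approx (\1_A : S2 -> R).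
Proof.
pose D := [set A : set S2 | measurable A /\ L2approx (\1_A : S2 -> R)].
move=> mA; suff : D A by case.
suff sub : <<s @open S2 >> `<=` D by exact: sub.
have lD : lambda_system setT D.
  split => //.
  - by split => //; apply: L2approx_open; exact: openT.
  - move=> X Y YX [mX aX] [mY aY]; split; first exact: measurableD.
    have -> : (\1_(X `\` Y) : S2 -> R) = (fun p => \1_X p + (-1) * \1_Y p).
      apply/funext => p; rewrite !indicE in_setD; case: (boolP (p \in Y)) => [/set_mem/YX/mem_set ->|_] /=.
        by rewrite mulr1 subrr.
      by rewrite andbT mulr0 addr0.
    by apply: L2approxD => //; exact: L2approxZ.
  - move=> F ndF DF; split.
      by apply: bigcupT_measurable => n; case: (DF n).
    apply: (@L2approx_limit _ (fun n => \1_(F n)) (cst 1)).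
    + by move=> n; case: (DF n).
    + move=> p; have [[n _ Fnp]|nF] := pselect ((\bigcup_n F n) p).
        rewrite indicE mem_set; last by exists n.
        apply: cvg_near_cst; exists n => // m /= nm.
        by rewrite indicE mem_set //; exact: (subsetPset _ _ (ndF _ _ nm)).
      rewrite indicE memNset //; apply: cvg_near_cst; apply: nearW => n.
      by rewrite indicE memNset // => Fnp; apply: nF; exists n.
    + move=> n p; rewrite !indicE -real_normK ?num_real // expr_le1 //.
      by case: (_ \in _); case: (_ \in _); rewrite /= ?subrr ?subr0 ?sub0r ?normrN ?normr0 ?normr1.
    + apply: (@continuous_S2_integrable R (cst 1)); exact: cst_continuous.
apply: (lambda_system_subset _ lD) => //.
- move=> X Y oX oY; exact: openI.
- by move=> X oX; split; [exact: sub_sigma_algebra|exact: L2approx_open].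
Qed.

Import HBNNSimple.

Lemma L2approx_nnsfun (f : {nnsfun S2 >-> R}) : L2approx f.
Proof.
have -> : (f : S2 -> R) = (fun p => \sum_(k <- finmap.enum_fset (fset_set (range f))) k * \1_(f @^-1` [set k]) p).
  by apply/funext => p; rewrite fimfunE fsbig_finite.
elim: (finmap.enum_fset _) => [|k s IH].
  under eq_fun do rewrite big_nil.
  by apply: L2approx_continuous; exact: cst_continuous.
under eq_fun do rewrite big_cons.
apply: L2approxD => //; apply: L2approxZ; apply: L2approx_indic.
by rewrite -[X in measurable X]setTI; exact: measurable_funP.
Qed.

Lemma L2approx_ge0 (f : S2 -> R) : measurable_fun [set: S2] f -> (forall p, 0 <= f p) ->
  surf.-integrable setT (fun p => (f p ^+ 2)%:E) -> L2approx f.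
Proof.
move=> mf f0 intf.
have mfE : measurable_fun [set: S2] (EFin \o f) by exact/measurable_EFinP.
pose h := nnsfun_approx measurableT mfE.
have hcv p : h n p @[n --> \oo] --> f p.
  have /(_ p Logic.I)/fine_cvgP[_] :=
    @cvg_nnsfun_approx _ _ _ _ measurableT _ mfE (fun x _ => f0 x).
  by [].
have hle n p : h n p <= f p.
  have nd : nondecreasing_seq (fun n => h n p).
    by move=> i j ij; have /lefP/(_ p) := nd_nnsfun_approx measurableT mfE ij.
  rewrite -(cvg_lim (@Rhausdorff R) (hcv p)).
  by apply: (nondecreasing_cvgn_le nd); apply/cvg_ex; exists (f p); exact: hcv.
apply: (@L2approx_limit _ h (fun p => f p ^+ 2)) => //.
- by move=> n; exact: L2approx_nnsfun.
- move=> n p; have := hle n p; have : 0 <= h n p by [].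
  have := f0 p; nra.
Qed.

Lemma L2approx_L2 (f : S2 -> R) : measurable_fun [set: S2] f ->
  surf.-integrable setT (fun p => (f p ^+ 2)%:E) -> L2approx f.
Proof.
move=> mf intf.
have part (g : S2 -> R) : measurable_fun [set: S2] g -> (forall p, 0 <= g p) ->
    (forall p, g p <= `|f p|) -> L2approx g.
  move=> mg g0 gf; apply: L2approx_ge0 => //.
  apply: (le_integrable measurableT _ _ intf); first exact: measurable_sq.
  move=> p _; rewrite /= !ger0_norm ?sqr_ge0 // lee_fin.
  by rewrite -(real_normK (num_real (f p))) ler_pXn2r ?nnegrE.
have -> : f = (fun p => Num.max (f p) 0 + (-1) * Num.max (- f p) 0).
  by apply/funext => p; case: (leP 0 (f p)) => fp; [rewrite max_r|rewrite max_l]; lra.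
apply: L2approxD; [|apply: L2approxZ]; apply: part.
- exact: measurable_maxr.
- by move=> p; rewrite le_max lexx orbT.
- by move=> p; rewrite ge_max ler_norm normr_ge0.
- by apply: measurable_maxr => //; exact: measurableT_comp.
- by move=> p; rewrite le_max lexx orbT.
- by move=> p; rewrite ge_max normr_ge0 andbT -normrN ler_norm.
Qed.
End L2Density.

(** * The expansion in mean square *)

Section L2Expansion.
Variable R : realType.
Local Notation S2 := (S2 R).
Local Notation surf := (@surface_measure R).
Local Notation V := {mpoly R[3]}.
Local Notation I := (@sphint R).

Lemma L2norm_lt (g : S2 -> R) (e : R) : 0 < e ->
  ('N[surf]_2%:E[EFin \o g] < e%:E)%E = (sqint g < (e ^+ 2)%:E)%E.
Proof.
move=> e0; have -> : sqint g = ('N[surf]_2%:E[EFin \o g] `^ 2)%E.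
  rewrite poweR_Lnorm //; apply: eq_integral => p _ /=.
  rewrite (powR_mulrn 2 (normr_ge0 _)) real_normK ?num_real //.
have := Lnorm_ge0 surf 2%:E (EFin \o g).
case: ('N[surf]_2%:E[EFin \o g])%E => [x||] //= x0.
  rewrite lee_fin in x0; rewrite !lte_fin powR_mulrn // ltr_pXn2r // ?nnegrE //; exact: ltW.
by rewrite pnatr_eq0.
Qed.

Lemma ecvg0P (a : nat -> \bar R) : (forall n, 0 <= a n)%E ->
  a @ \oo --> 0%E <-> (forall e : R, 0 < e -> \forall n \near \oo, (a n < e%:E)%E).
Proof.
move=> a0; split => [/fine_cvgP[fin /cvgrPdist_lt h] e e0|h].
  move: (h e e0); apply: filterS2 fin => n fn.
  rewrite sub0r normrN -(fineK fn) lte_fin; apply: le_lt_trans; exact: ler_norm.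
have lt1 := h 1 ltr01.
apply/fine_cvgP; split.
  move: lt1; apply: filterS => n an; rewrite ge0_fin_numE //.
  exact: (lt_trans an (ltry _)).
apply/cvgrPdist_lt => e e0; have := h e e0; apply: filterS => n an.
have fn : a n \is a fin_num by rewrite ge0_fin_numE //; exact: (lt_trans an (ltry _)).
by rewrite sub0r normrN ger0_norm ?fine_ge0 // -lte_fin fineK.
Qed.

(** Passing between the norm and its square keeps square roots out of everything
    that follows. *)
Lemma L2norm_cvg (u : nat -> S2 -> R) :
  ('N[surf]_2%:E[EFin \o u n])%E @[n --> \oo] --> 0%E <-> sqint (u n) @[n --> \oo] --> 0%E.
Proof.
rewrite (ecvg0P (fun n => Lnorm_ge0 surf 2%:E (EFin \o u n))) (ecvg0P (fun n => sqint_ge0 (u n))).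
split=> h e e0; last first.
  have := h (e ^+ 2) (exprn_gt0 _ e0).
  by apply: filterS => n; rewrite L2norm_lt.
have se0 : 0 < Num.sqrt e by rewrite sqrtr_gt0.
have := h _ se0; apply: filterS => n.
by rewrite L2norm_lt // sqr_sqrtr // ltW.
Qed.

Section Fixed.
Variable f : S2 -> R.
Hypothesis mf : measurable_fun [set: S2] f.
Hypothesis intf2 : surf.-integrable setT (fun p => (f p ^+ 2)%:E).

Lemma mul_pfun_integrable P : surf.-integrable setT (fun p => (f p * pfun P p)%:E).
Proof.
have i2 : surf.-integrable setT (fun p => (f p ^+ 2 + pfun (P * P) p)%:E).
  exact: (integrableD measurableT intf2 (pfun_integrable (P * P))).
apply: le_integrable i2 => //.
  by apply/measurable_EFinP; apply: measurable_funM => //; exact: measurable_pfun.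
move=> p _; rewrite /= lee_fin pfunM -expr2.
have h0 : 0 <= f p ^+ 2 + pfun P p ^+ 2 by rewrite addr_ge0 ?sqr_ge0.
rewrite (ger0_norm h0) ler_norml.
have := sqr_ge0 (f p + pfun P p); have := sqr_ge0 (f p - pfun P p); nra.
Qed.

Definition coef (P : V) : R := \int[surf]_p (f p * pfun P p).
Definition sqnorm2 : R := \int[surf]_p (f p ^+ 2).

Lemma coefE P : (\int[surf]_p (f p * pfun P p)%:E = (coef P)%:E)%E.
Proof. by rewrite fineK //; exact: integrable_fin_num (mul_pfun_integrable P). Qed.

Lemma sqnorm2E : (sqint f = sqnorm2%:E)%E.
Proof. by rewrite fineK //; exact: integrable_fin_num intf2. Qed.

Lemma lin_functional_coef : lin_functional coef.
Proof.
split.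
- move=> P Q; apply/EFin_inj; rewrite EFinD -!coefE -integralD //; try exact: mul_pfun_integrable.
  by apply: eq_integral => p _; rewrite pfunD mulrDr.
- move=> c P; apply/EFin_inj; rewrite EFinM -!coefE -integralZl //; last exact: mul_pfun_integrable.
  by apply: eq_integral => p _; rewrite pfunZ -EFinM mulrCA.
- move=> P P0; apply/EFin_inj; rewrite -coefE integral0_eq // => p _.
  by rewrite P0 mulr0.
Qed.

Lemma sqdiffE P : sqdiff f (pfun P) = (sqdist coef sqnorm2 P)%:E.
Proof.
rewrite /sqdiff /sqint /sqdist EFinD EFinD EFinN EFinM -sqnorm2E -coefE -sphintE.
rewrite -integralZl //; last exact: mul_pfun_integrable.
rewrite -integralB //; last first.
  by apply: integrableZl => //; exact: mul_pfun_integrable.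
rewrite -integralD //; last exact: pfun_integrable.
  apply: eq_integral => p _; rewrite -EFinM -EFinB -EFinD pfunM; congr (_%:E); ring.
by apply: integrableB => //; apply: integrableZl => //; exact: mul_pfun_integrable.
Qed.

Lemma sqdist_ge0 P : 0 <= sqdist coef sqnorm2 P.
Proof. by rewrite -lee_fin -sqdiffE; exact: sqint_ge0. Qed.

Lemma sqdist_dense e : 0 < e -> exists P, sqdist coef sqnorm2 P < e.
Proof.
move=> e0; have [_ /(_ e e0)[P hP]] := L2approx_L2 mf intf2.
by exists P; rewrite -lte_fin -sqdiffE.
Qed.

Lemma L2_cvgP (S : nat -> V) (u : nat -> S2 -> R) :
  (forall n p, u n p = f p - pfun (S n) p) ->
  ('N[surf]_2%:E[EFin \o u n])%E @[n --> \oo] --> 0%E <->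
  sqdist coef sqnorm2 (S n) @[n --> \oo] --> 0.
Proof.
move=> uE; rewrite L2norm_cvg.
have -> : (fun n => sqint (u n)) = (fun n => (sqdist coef sqnorm2 (S n))%:E).
  apply/funext => n; rewrite -sqdiffE /sqdiff; congr sqint.
  by apply/funext => p; exact: uE.
split; first by move/fine_cvgP => [].
by move=> h; apply: cvg_EFin => //; exact: nearW.
Qed.

(** Each harmonic component is a polynomial of degree d, hence a constant plus
    products of linear forms on the sphere. *)
Lemma L2_representation_exists :
  exists (lam : nat -> R) (L : nat -> forall k, 'I_k -> 'rV[R]_3), L2_representation f lam L.
Proof.
have lphi := lin_functional_coef.
have ex d : exists lL : R * (forall k, 'I_k -> 'rV[R]_3), forall v, unit_sphere v ->
    (hcomp lphi d).@[coords v] = lL.1 + \sum_(1 <= k < d.+1) \prod_(j < k) linform (lL.2 k j) v.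
  have [|lam [L h]] := @sphere_products R d (hcomp lphi d); last by exists (lam, L).
  exact: msize_homog_lt (hcomp_homog lphi d).
have [lL hlL] := choice ex.
exists (fun d => (lL d).1), (fun d => (lL d).2).
have bE d p : brace (fun d => (lL d).1) (fun d => (lL d).2) d (S2val p) = pfun (hcomp lphi d) p.
  by rewrite /brace /pfun hlL //; exact: S2val_sphere.
split.
  move=> d; exists (hcomp lphi d); split.
  - exact: hcomp_homog.
  - exact: hcomp_harmonic.
  - exact: bE.
apply/(@L2_cvgP (hsum lphi)).
  move=> n p; congr (_ - _); rewrite /hsum /pfun raddf_sum /=.
  by apply: eq_bigr => d _; rewrite bE.
exact: (hsum_cvg lphi sqdist_ge0 sqdist_dense).
Qed.

Lemma brace_polys lam L : L2_representation f lam L -> exists S : nat -> V,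
  [/\ forall d, S d \is d.-homog, forall d, lap (S d) = 0,
      forall d p, brace lam L d (S2val p) = pfun (S d) p
    & sqdist coef sqnorm2 (\sum_(0 <= d < n) S d) @[n --> \oo] --> 0].
Proof.
move=> [hs hc]; have [S hS] := choice hs.
exists S; split.
- by move=> d; case: (hS d).
- by move=> d; case: (hS d).
- by move=> d p; case: (hS d) => _ _; exact.
- apply/(L2_cvgP (u := fun n p => f p - \sum_(0 <= d < n) brace lam L d (S2val p))); last exact: hc.
  move=> n p; congr (_ - _); rewrite /pfun raddf_sum /=.
  by apply: eq_bigr => d _; case: (hS d) => _ _ ->.
Qed.

(** Harmonic forms of different degrees are orthogonal, so the square norm of the
    sum is the sum of the square norms. *)
Lemma sphint_pyth (D : nat -> V) d n : (forall d, D d \is d.-homog) -> (forall d, lap (D d) = 0) ->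
  (d < n)%N -> I (D d * D d) <= I ((\sum_(0 <= e < n) D e) * (\sum_(0 <= e < n) D e)).
Proof.
move=> hD lD dn; rewrite mulr_suml sphint_sum.
have -> : \sum_(0 <= e < n) I (D e * \sum_(0 <= e' < n) D e') = \sum_(0 <= e < n) I (D e * D e).
  rewrite !big_mkord; apply: eq_bigr => e _.
  rewrite mulr_sumr sphint_sum (bigD1 e) //= big1 ?addr0 // => e' e'e.
  by apply: harmonic_orth (hD _) (hD _) (lD _) (lD _) _; rewrite eq_sym.
rewrite big_mkord (bigD1 (Ordinal dn)) //= lerDl; apply: sumr_ge0 => e _.
exact: sphint_sq_ge0.
Qed.

(** The parallelogram identity around f, with the distance from f to the midpoint
    dropped. *)
Lemma sphint_diff_le (P Q : V) :
  I ((P - Q) * (P - Q)) <= 2 * sqdist coef sqnorm2 P + 2 * sqdist coef sqnorm2 Q.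
Proof.
have := sqdist_ge0 (2^-1 *: (P + Q)).
have [cD cZ _] := lin_functional_coef.
have -> : I ((P - Q) * (P - Q)) = I (P * P) - 2 * I (P * Q) + I (Q * Q).
  rewrite mulrBl !mulrBr !sphintB (mulrC Q P); ring.
have sD : I ((P + Q) * (P + Q)) = I (P * P) + 2 * I (P * Q) + I (Q * Q).
  rewrite mulrDl !mulrDr !sphintD (mulrC Q P); ring.
have sH : I ((2^-1 *: (P + Q)) * (2^-1 *: (P + Q))) = 4^-1 * I ((P + Q) * (P + Q)).
  rewrite -[X in I X]scalerAl sphintZ -[X in I X]scalerAr sphintZ mulrA; congr (_ * _); lra.
rewrite /sqdist sH cZ cD sD.
move: sqnorm2 (coef P) (coef Q) (I _) (I _) (I _) => a b c x y z; lra.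
Qed.

(** The differences of the two expansions are harmonic forms whose partial sums
    tend to 0 in mean square, and by orthogonality each single difference is
    bounded by the partial sums that contain it. *)
Lemma brace_unique lam L lam' L' : L2_representation f lam L -> L2_representation f lam' L' ->
  forall d p, brace lam L d (S2val p) = brace lam' L' d (S2val p).
Proof.
move=> /brace_polys[S [hS lS bS cS]] /brace_polys[T [hT lT bT cT]] d p.
pose D e := S e - T e.
have hD e : D e \is e.-homog by apply: rpredB.
have lD e : lap (D e) = 0.
  rewrite -(subr0 0) -{1}(lS e) -(lT e) /lap -sumrB; apply: eq_bigr => i _.
  by rewrite !raddfB.
have : I (D d * D d) = 0.
  apply/eqP; rewrite eq_le; apply/andP; split; last first.
    exact: sphint_sq_ge0.
  have c0 : (2 * sqdist coef sqnorm2 (\sum_(0 <= e < n) S e) +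
     2 * sqdist coef sqnorm2 (\sum_(0 <= e < n) T e)) @[n --> \oo] --> (0 : R).
    rewrite [X in _ --> X](_ : 0 = 2 * 0 + 2 * 0); last by rewrite mulr0 addr0.
    exact: (cvgD (cvgM (cvg_cst _) cS) (cvgM (cvg_cst _) cT)).
  rewrite -(cvg_lim (@Rhausdorff R) c0); apply: limr_ge.
    by apply/cvg_ex; exists 0; exact: c0.
  exists d.+1 => // n /= dn.
  apply: le_trans (sphint_pyth hD lD dn) _.
  by rewrite sumrB; exact: sphint_diff_le.
move/sphint_sq_eq0/(_ p); rewrite /D -scaleN1r pfunD pfunZ mulN1r bS bT => /eqP.
by rewrite subr_eq0 => /eqP.
Qed.

Lemma representation_unique lam L lam' L' :
  L2_representation f lam L -> L2_representation f lam' L' ->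
  (forall d, lam d = lam' d) /\
  (forall d k, (1 <= k <= d)%N -> same_factors (L d k) (L' d k)).
Proof.
move=> h h'; have bE := brace_unique h h'.
have key d : lam d = lam' d /\ forall k, (1 <= k <= d)%N -> same_factors (L d k) (L' d k).
  by apply: sphere_products_unique => v v1; exact: (bE d (mkS2 v1)).
by split=> [d|d k kd]; have [l s] := key d => //; exact: s.
Qed.

Lemma brace_orth lam L : L2_representation f lam L -> forall d e : nat, d <> e ->
  (\int[surf]_p (brace lam L d (S2val p) * brace lam L e (S2val p))%:E = 0)%E.
Proof.
move=> /brace_polys[S [hS lS bS _]] d e /eqP de.
rewrite (eq_integral (fun p => (pfun (S d * S e) p)%:E)); last first.
  by move=> p _; rewrite !bS pfunM.
by rewrite sphintE (harmonic_orth (hS d) (hS e)).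
Qed.
End Fixed.

Lemma Lfun2P (f : S2 -> R) : f \in Lfun surf 2%:E ->
  measurable_fun [set: S2] f /\ surf.-integrable setT (fun p => (f p ^+ 2)%:E).
Proof.
move=> lf; split; last exact: Lfun2_integrable_sqr.
by move: lf; rewrite inE => /andP[+ _]; rewrite inE.
Qed.
End L2Expansion.

(** * Uniformly convergent series of products *)

Section UniformSeries.
Variable R : realType.
Local Notation S2 := (S2 R).

Lemma uniformP (F : nat -> S2 -> R) (f : S2 -> R) :
  {uniform, F @ \oo --> f} <->
  forall e, 0 < e -> \forall N \near \oo, forall p, `|f p - F N p| < e.
Proof.
split=> [h e e0|h].
  have : nbhs (f : {uniform S2 -> R}) [set g : S2 -> R | forall p, `|f p - g p| < e].
    apply/uniform_nbhs; exists [set xy : R * R | ball xy.1 e xy.2].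
    by split; [exact: (entourage_ball _ (PosNum e0))|move=> g hg p; exact: hg].
  by move/h.
move=> P /uniform_nbhs[E [entE EP]].
move: entE; rewrite -entourage_ballE => -[e /= e0 eE].
have := h e e0; rewrite near_simpl /=; apply: filterS => N hN.
by apply: EP => p _; apply: eE; exact: hN.
Qed.

Lemma continuous_linform w : continuous (fun p : S2 => linform w (S2val p)).
Proof.
apply: continuous_sum => i p.
exact: (cvgM (cvg_cst _) (@continuous_coord _ i p)).
Qed.

Lemma continuous_partial_sum lam L N : continuous (fun p : S2 => partial_sum lam L N (S2val p)).
Proof.
have cQ d : continuous (fun q : S2 => \prod_(j < d) linform (L d j) (S2val q)).
  by apply: continuous_prod => j; exact: continuous_linform.
have cS := @continuous_sum R S2 nat (index_iota 1 N.+1) _ cQ.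
by move=> p; exact: (cvgD (cvg_cst lam) (cS p)).
Qed.

Lemma calF_continuous (f : S2 -> R) : calF f -> continuous f.
Proof.
move=> [lam [L h]].
apply: (@uniform_limit_continuous _ _ _ _ _ _ h).
have H : \forall N \near \oo, continuous (fun p : S2 => partial_sum lam L N (S2val p)).
  by apply: nearW => N; exact: continuous_partial_sum.
exact: H.
Qed.

(** A polynomial restricted to the sphere already lies in the class, as a finite
    sum of products; the series is continued by products of zero forms. *)
Lemma calF_dense (g : S2 -> R) : continuous g -> forall e : R, 0 < e ->
  exists f : S2 -> R, calF f /\ forall p, `|g p - f p| < e.
Proof.
move=> cg e e0; have [P hP] := sphere_weierstrass cg e0.
have [lam [L hL]] := @sphere_products R (msize P) P (leqnSn _).
exists (fun p => P.@[coords (S2val p)]); split; last by move=> p; rewrite distrC; exact: hP.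
exists lam, (fun d j => if (d <= msize P)%N then L d j else 0).
apply/uniformP => e' e'0; exists (msize P) => // N /= hN p.
suff -> : partial_sum lam (fun d j => if (d <= msize P)%N then L d j else 0) N (S2val p) =
    P.@[coords (S2val p)] by rewrite subrr normr0.
rewrite hL; last exact: S2val_sphere.
rewrite /partial_sum (big_cat_nat (n := (msize P).+1)) //=; congr (_ + _).
rewrite [X in _ + X]big_nat_cond [X in _ + X]big1 ?addr0.
  by apply: eq_big_nat => d /andP[_]; rewrite ltnS => ->.
move=> d /andP[/andP[hd _] _]; case: d hd => // d hd.
rewrite big_ord_recl leqNgt hd /= /linform big1 ?mul0r // => i _.
by rewrite mxE mul0r.
Qed.

Lemma linform_mul (w v : 'rV[R]_3) (A : 'M[R]_3) : linform w (v *m A) = linform (w *m A^T) v.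
Proof.
rewrite /linform; under eq_bigr do rewrite mxE mulr_sumr.
rewrite exchange_big; apply: eq_bigr => j _ /=.
rewrite mxE mulr_suml; apply: eq_bigr => i _; rewrite mxE; ring.
Qed.

(** A rotation or reflection sends linear forms to linear forms, so it acts on
    the series factor by factor. *)
Lemma calF_orthact (A : 'M[R]_3) (hA : A *m A^T = 1%:M) (f : S2 -> R) :
  calF f -> calF (fun p => f (orthact hA p)).
Proof.
move=> [lam [L /uniformP h]]; exists lam, (fun d j => L d j *m A^T).
apply/uniformP => e e0; have := h e e0; apply: filterS => N hN p.
suff -> : partial_sum lam (fun d j => L d j *m A^T) N (S2val p) =
   partial_sum lam L N (S2val (orthact hA p)) by exact: hN.
congr (_ + _); apply: eq_bigr => d _; apply: eq_bigr => j _.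
by rewrite -linform_mul.
Qed.

Lemma extension_sphere (f : S2 -> R) lam L : uniform_representation f lam L ->
  forall p : S2, canonical_extension lam L (S2val p) = f p.
Proof.
move=> /uniformP h p; apply: (@cvg_lim _ (@Rhausdorff R)).
apply/cvgrPdist_lt => e e0; have := h e e0; by apply: filterS => N hN; exact: hN.
Qed.
End UniformSeries.

(** * A criterion for real analyticity *)

Section AnalyticCriterion.
Variable R : realType.
Local Notation V := {mpoly R[3]}.

Lemma cvg_bigsum J (s : seq J) (P : pred J) (F : J -> nat -> R) (l : J -> R) :
  (forall j, F j @ \oo --> l j) ->
  (fun n => \sum_(j <- s | P j) F j n) @ \oo --> \sum_(j <- s | P j) l j.
Proof.
move=> cF; elim: s => [|j s IH].
  by under eq_fun do rewrite big_nil; rewrite big_nil; exact: cvg_cst.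
under eq_fun do rewrite big_cons; rewrite big_cons.
by case: (P j) => //; exact: (cvgD (cF j) IH).
Qed.

Lemma geometric_cvg (u : nat -> R) (K a : R) : 0 <= a -> a < 1 ->
  (forall d, `|u d| <= K * a ^+ d) -> cvgn (series u).
Proof.
move=> a0 a1 hu; apply: normed_cvg.
apply: (@series_le_cvg _ _ (geometric K a)) => //.
- by move=> n; exact: normr_ge0.
- by move=> n; exact: (le_trans (normr_ge0 _) (hu n)).
- by apply: is_cvg_geometric_series; rewrite ger0_norm.
Qed.

Lemma geometric_tail (K a : R) m n : 0 <= K -> 0 <= a -> a < 1 ->
  \sum_(m <= d < n) K * a ^+ d <= K * a ^+ m / (1 - a).
Proof.
move=> K0 a0 a1; have b0 : 0 < 1 - a by rewrite subr_gt0.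
rewrite ler_pdivlMr //.
have [mn|nm] := leqP m n; last by rewrite big_geq ?mul0r ?mulr_ge0 ?exprn_ge0 // ltnW.
suff -> : (\sum_(m <= d < n) K * a ^+ d) * (1 - a) = K * a ^+ m - K * a ^+ n.
  by rewrite lerBlDr lerDl mulr_ge0 // exprn_ge0.
elim: n mn => [|n IH]; first by rewrite leqn0 => /eqP ->; rewrite big_geq // mul0r subrr.
rewrite leq_eqVlt => /orP[/eqP ->|]; first by rewrite big_geq // mul0r subrr.
rewrite ltnS => mn; rewrite big_nat_recr //= mulrDl IH // exprS; ring.
Qed.

Section Norm.
Variable t : R.
Hypothesis t0 : 0 < t.

(** The weighted l1 norm of the coefficients.  It is submultiplicative, and it
    bounds the sum of the absolute values of the terms on the cube of half-side
    t. *)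
Definition mnorm (p : V) : R := \sum_(m <- msupp p) `|p@_m| * t ^+ mdeg m.

Lemma mnorm_ge0 p : 0 <= mnorm p.
Proof. by apply: sumr_ge0 => m _; rewrite mulr_ge0 // exprn_ge0 // ltW. Qed.

Lemma mnorm_wide k p : (msize p <= k)%N ->
  mnorm p = \sum_(m : 'X_{1..3 < k}) `|p@_m| * t ^+ mdeg m.
Proof.
move=> pk; pose I : subFinType _ := 'X_{1..3 < k}.
rewrite /mnorm (ssrcomplements.big_mksub I) //=; first last.
- by move=> x /msize_mdeg_lt /leq_trans; apply.
- exact: msupp_uniq.
by rewrite big_rmcond //= => m /memN_msupp_eq0 ->; rewrite normr0 mul0r.
Qed.

Lemma mnormD p q : mnorm (p + q) <= mnorm p + mnorm q.
Proof.
pose k := maxn (maxn (msize p) (msize q)) (msize (p + q)).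
rewrite !(@mnorm_wide k) ?leq_max ?leqnn ?orbT // -big_split /=.
apply: ler_sum => m _; rewrite -mulrDl mcoeffD ler_wpM2r ?ler_normD //.
by rewrite exprn_ge0 // ltW.
Qed.

Lemma mnorm0 : mnorm 0 = 0.
Proof. by rewrite /mnorm msupp0 big_nil. Qed.

Lemma mnorm_sum J (s : seq J) (F : J -> V) :
  mnorm (\sum_(j <- s) F j) <= \sum_(j <- s) mnorm (F j).
Proof.
elim: s => [|j s IH]; first by rewrite !big_nil mnorm0.
by rewrite !big_cons; apply: le_trans (mnormD _ _) _; rewrite lerD2l.
Qed.

Lemma mnormZ c p : mnorm (c *: p) = `|c| * mnorm p.
Proof.
pose k := maxn (msize p) (msize (c *: p)).
rewrite !(@mnorm_wide k) ?leq_max ?leqnn ?orbT // mulr_sumr.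
by apply: eq_bigr => m _; rewrite mcoeffZ normrM mulrA.
Qed.

Lemma mnormX m : mnorm 'X_[m] = t ^+ mdeg m.
Proof. by rewrite /mnorm msuppX big_seq1 mcoeffX eqxx normr1 mul1r. Qed.

Lemma mnormM p q : mnorm (p * q) <= mnorm p * mnorm q.
Proof.
rewrite mpolyME; apply: le_trans (mnorm_sum _ _) _.
rewrite big_allpairs [X in _ <= X * _]/mnorm [X in _ <= _ * X]/mnorm mulr_suml; apply: ler_sum => m _.
rewrite mulr_sumr; apply: ler_sum => m' _ /=.
by rewrite mnormZ mnormX normrM mdegD exprD mulrACA.
Qed.

Lemma mnorm1 : mnorm 1 = 1.
Proof. by rewrite -mpolyX0 mnormX mdeg0 expr0. Qed.

Lemma mnorm_prod J (s : seq J) (P : pred J) (F : J -> V) :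
  mnorm (\prod_(j <- s | P j) F j) <= \prod_(j <- s | P j) mnorm (F j).
Proof.
elim: s => [|j s IH]; first by rewrite !big_nil mnorm1.
rewrite !big_cons; case: (P j) => //; apply: le_trans (mnormM _ _) _.
by rewrite ler_wpM2l // mnorm_ge0.
Qed.

Lemma mcoeff_le_mnorm p m : `|p@_m| * t ^+ mdeg m <= mnorm p.
Proof.
have [mp|mp] := boolP (m \in msupp p).
  rewrite /mnorm (big_rem _ mp) /= lerDl.
  by apply: sumr_ge0 => m' _; rewrite mulr_ge0 // exprn_ge0 // ltW.
by rewrite memN_msupp_eq0 // normr0 mul0r mnorm_ge0.
Qed.

(** Regroups a sum over the support by total degree. *)
Lemma degree_sum (g : R -> 'X_{1..3} -> R) p N : (forall m, g 0 m = 0) ->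
  \sum_(0 <= n < N) \sum_(m : 'X_{1..3 < n.+1} | mdeg m == n) g p@_m m =
  \sum_(m <- msupp p | (mdeg m < N)%N) g p@_m m.
Proof.
move=> g0.
transitivity (\sum_(0 <= n < N) \sum_(m <- msupp p | mdeg m == n) g p@_m m).
  apply: eq_bigr => n _; pose I : subFinType _ := 'X_{1..3 < n.+1}.
  rewrite -[RHS]big_filter (ssrcomplements.big_mksub I) /=; first last.
  - by move=> m; rewrite mem_filter => /andP[/eqP -> _].
  - by rewrite filter_uniq // msupp_uniq.
  rewrite big_mkcond [RHS]big_mkcond; apply: eq_bigr => m _; rewrite mem_filter.
  case: eqP => //= _; case: ifPn => // /memN_msupp_eq0 ->; exact: g0.
rewrite (eq_bigr (fun n => \sum_(m <- msupp p) if mdeg m == n then g p@_m m else 0)); last first.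
  by move=> n _; rewrite big_mkcond.
rewrite exchange_big /= [RHS]big_mkcond; apply: eq_bigr => m _.
rewrite big_mkord -big_mkcond /= (eq_bigl (fun n : 'I_N => n == mdeg m :> nat)); last first.
  by move=> n; rewrite eq_sym.
by rewrite (big_ord1_eq _ (fun=> g p@_m m)).
Qed.

(** The part of p of degree less than N, evaluated at h in the form in which power
    series are summed. *)
Definition trunc N (h : 'rV[R]_3) (p : V) : R :=
  \sum_(0 <= n < N) \sum_(m : 'X_{1..3 < n.+1} | mdeg m == n)
     monomial_term (fun m => p@_m) h m.

Lemma truncE N h p :
  trunc N h p = \sum_(m <- msupp p | (mdeg m < N)%N) monomial_term (fun m => p@_m) h m.
Proof.
have H := @degree_sum (fun c m => c * \prod_(i < 3) h 0 i ^+ m i) p N.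
by apply: H => m; rewrite mul0r.
Qed.

Lemma trunc_sum N h J (s : seq J) (F : J -> V) :
  trunc N h (\sum_(j <- s) F j) = \sum_(j <- s) trunc N h (F j).
Proof.
rewrite /trunc [RHS]exchange_big /=; apply: eq_bigr => n _.
rewrite [RHS]exchange_big /=; apply: eq_bigr => m _.
by rewrite /monomial_term raddf_sum mulr_suml.
Qed.

Lemma monomial_le (c : 'X_{1..3} -> R) (h : 'rV[R]_3) m : (forall i, `|h 0 i| <= t) ->
  `|monomial_term c h m| <= `|c m| * t ^+ mdeg m.
Proof.
move=> ht; rewrite normrM ler_wpM2l // normr_prod mdegE -prodrXr.
by apply: ler_prod => i _; rewrite normr_ge0 normrX lerXn2r // nnegrE // ltW.
Qed.

Lemma trunc_err N (h : 'rV[R]_3) (p : V) : (forall i, `|h 0 i| <= t) -> `|trunc N h p - p.@[coords h]| <= mnorm p.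
Proof.
move=> ht; rewrite truncE mevalE distrC.
rewrite (bigID (fun m : 'X_{1..3} => (mdeg m < N)%N)) /= addrAC subrr add0r.
apply: le_trans (ler_norm_sum _ _ _) _.
rewrite [leRHS](bigID (fun m : 'X_{1..3} => (mdeg m < N)%N)) /=.
apply: le_trans (_ : \sum_(m <- msupp p | ~~ (mdeg m < N)%N) `|p@_m| * t ^+ mdeg m <= _).
  by apply: ler_sum => m _; exact: (@monomial_le (fun m => p@_m)).
rewrite lerDr; by apply: sumr_ge0 => m _; rewrite mulr_ge0 // exprn_ge0 // ltW.
Qed.

Lemma trunc_exact N (h : 'rV[R]_3) (p : V) : (msize p <= N)%N -> trunc N h p = p.@[coords h].
Proof.
move=> pN; rewrite truncE mevalE big_seq_cond [RHS]big_seq.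
apply: eq_bigl => m; case: (boolP (m \in msupp p)) => //= /msize_mdeg_lt mp.
exact: leq_trans mp pN.
Qed.

Lemma abs_trunc_le N (h : 'rV[R]_3) (p : V) : (forall i, `|h 0 i| <= t) ->
  \sum_(0 <= n < N) \sum_(m : 'X_{1..3 < n.+1} | mdeg m == n)
    `|monomial_term (fun m => p@_m) h m| <= mnorm p.
Proof.
move=> ht; have H := @degree_sum (fun c m => `|c * \prod_(i < 3) h 0 i ^+ m i|) p N.
rewrite [leLHS]H; last by move=> m; rewrite mul0r normr0.
rewrite /mnorm [leRHS](bigID (fun m : 'X_{1..3} => (mdeg m < N)%N)) /=.
apply: ler_wpDr; first by apply: sumr_ge0 => m _; rewrite mulr_ge0 // exprn_ge0 // ltW.
by apply: ler_sum => m _; exact: (@monomial_le (fun m => p@_m)).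
Qed.
End Norm.

(** Geometric decay of the norms allows the order of summation to be exchanged.
    The coefficient of a monomial is the sum of its coefficients in all G d; for
    the sum by degree, the terms with d < D0 are finite sums and are exact from
    some degree on, while the terms with d >= D0 contribute at most the tail of
    the geometric series, whatever the truncation. *)
Lemma analytic_criterion (F : 'rV[R]_3 -> R) (v : 'rV[R]_3) (t K a : R) (G : nat -> V) :
  0 < t -> 0 <= a -> a < 1 -> (forall d, mnorm t (G d) <= K * a ^+ d) ->
  (forall w, `|w - v| < t ->
     (fun D => \sum_(0 <= d < D) (G d).@[coords (w - v)]) @ \oo --> F w) ->
  real_analytic_at F v.
Proof.
move=> t0 a0 a1 hG hF.
have K0 : 0 <= K by have := hG 0%N; rewrite expr0 mulr1; apply: le_trans; exact: mnorm_ge0.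
pose P D := \sum_(0 <= d < D) G d.
pose c m := limn (fun D => (P D)@_m).
have cP m : (P D)@_m @[D --> \oo] --> c m.
  have h : cvgn (series (fun d => (G d)@_m)).
    apply: (@geometric_cvg _ (K / t ^+ mdeg m) a) => // d.
    rewrite mulrAC ler_pdivlMr ?exprn_gt0 //.
    exact: le_trans (mcoeff_le_mnorm t0 _ _) (hG d).
  suff e : (fun D => (P D)@_m) = series (fun d => (G d)@_m) by rewrite /c e.
  by apply/funext => D; rewrite /P raddf_sum.
have tail m n : \sum_(m <= d < n) mnorm t (G d) <= K * a ^+ m / (1 - a).
  apply: le_trans (geometric_tail m n K0 a0 a1).
  by apply: ler_sum => d _; exact: hG.
have nP D : mnorm t (P D) <= K / (1 - a).
  rewrite -(mulr1 K) -(expr0 a); apply: le_trans (tail 0%N D).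
  exact: mnorm_sum.
exists t, c; split => // w wv.
have ht i : `|(w - v) 0 i| <= t.
  apply: le_trans (ltW wv); rewrite /Num.norm /= mx_normrE.
  exact: (le_bigmax _ (fun ij : 'I_1 * 'I_3 => `|(w - v) ij.1 ij.2|) (0, i)).
set h := w - v in ht *.
have cterm m : monomial_term (fun m => (P D)@_m) h m @[D --> \oo] --> monomial_term c h m.
  exact: (cvgM (cP m) (cvg_cst _)).
split.
  apply: nondecreasing_is_cvgn.
    apply/nondecreasing_seqP => N; rewrite /series /= big_nat_recr //= lerDl.
    by apply: sumr_ge0.
  exists (K / (1 - a)) => _ [N _ <-]; rewrite /series /=.
  have cv : \sum_(0 <= n < N) \sum_(m : 'X_{1..3 < n.+1} | mdeg m == n)
      `|monomial_term (fun m => (P D)@_m) h m| @[D --> \oo] -->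
      \sum_(0 <= n < N) \sum_(m : 'X_{1..3 < n.+1} | mdeg m == n) `|monomial_term c h m|.
    apply: (@cvg_bigsum _ _ _ (fun n D => \sum_(m : 'X_{1..3 < n.+1} | mdeg m == n)
      `|monomial_term (fun m => (P D)@_m) h m|)) => n.
    apply: (@cvg_bigsum _ _ _ (fun (m : 'X_{1..3 < n.+1}) D =>
      `|monomial_term (fun m => (P D)@_m) h m|)) => m.
    exact: (cvg_norm (cterm m)).
  rewrite -(cvg_lim (@Rhausdorff R) cv); apply: limr_le; first by apply/cvg_ex; eexists; exact: cv.
  by apply: nearW => D; apply: le_trans (nP D); exact: abs_trunc_le.
apply/cvgrPdist_le => e e0.
have [D0 hD0] : exists D0, K * a ^+ D0 / (1 - a) <= e.
  have c0 : (K * a ^+ D / (1 - a)) @[D --> \oo] --> K * 0 / (1 - a).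
    apply: (cvgM (cvgM (cvg_cst _) _) (cvg_cst _)).
    by apply: cvg_expr; rewrite ger0_norm.
  rewrite mulr0 mul0r in c0; move/cvgrPdist_le : c0 => /(_ e e0)[D0 _ h0].
  exists D0; have := h0 D0 (leqnn D0); rewrite sub0r normrN; apply: le_trans; exact: ler_norm.
exists (\max_(d < D0) msize (G d)) => // N /= hN.
have cT : trunc N h (P D) @[D --> \oo] -->
    series (fun n => \sum_(m : 'X_{1..3 < n.+1} | mdeg m == n) monomial_term c h m) N.
  apply: (@cvg_bigsum _ _ _ (fun n D => \sum_(m : 'X_{1..3 < n.+1} | mdeg m == n)
      monomial_term (fun m => (P D)@_m) h m)) => n.
  by apply: (@cvg_bigsum _ _ _ (fun (m : 'X_{1..3 < n.+1}) D =>
      monomial_term (fun m => (P D)@_m) h m)) => m; exact: cterm.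
have cd : `|\sum_(0 <= d < D) (G d).@[coords h] - trunc N h (P D)| @[D --> \oo] -->
   `|F w - series (fun n => \sum_(m : 'X_{1..3 < n.+1} | mdeg m == n) monomial_term c h m) N|.
  exact: (cvg_norm (cvgB (hF w wv) cT)).
rewrite -(cvg_lim (@Rhausdorff R) cd); apply: limr_le; first by apply/cvg_ex; eexists; exact: cd.
exists D0 => // D /= hD; apply: le_trans hD0.
rewrite /P trunc_sum -sumrB; apply: le_trans (ler_norm_sum _ _ _) _.
rewrite (big_cat_nat (n := D0)) //= big_nat_cond big1 ?add0r.
  apply: le_trans (tail D0 D); apply: ler_sum => d _; rewrite distrC; exact: trunc_err.
move=> d /andP[/andP[_ dD] _]; rewrite trunc_exact ?subrr ?normr0 //.
by apply: leq_trans hN; exact: (leq_bigmax (Ordinal dD)).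
Qed.
End AnalyticCriterion.

(** * Interpolation at equispaced nodes *)

Lemma absdiff_nat (R : realDomainType) (i j : nat) :
  `|i%:R - j%:R| = ((i - j) + (j - i))%:R :> R.
Proof.
have [ij|ji] := leqP i j.
  rewrite distrC -natrB // ger0_norm ?ler0n //; congr _%:R; lia.
rewrite -natrB ?(ltnW ji) // ger0_norm ?ler0n //; congr _%:R; lia.
Qed.

Lemma prod_dist_center n m : (0 < m)%N ->
  (\prod_(j < n.*2.+1) (m + ((j - n) + (n - j))) = m * ((m + n) ^_ n) ^ 2)%N.
Proof.
move=> m0; rewrite -(big_mkord xpredT (fun j => m + ((j - n) + (n - j)))%N).
rewrite (big_cat_nat (n := n)) ?leqnSn //=; last by lia.
rewrite (@big_ltn _ _ _ n) /=; last by lia.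
have -> : (\prod_(0 <= j < n) (m + (j - n + (n - j))) = (m + n) ^_ n)%N.
  rewrite ffact_prod big_mkord; apply: eq_bigr => j _; have := ltn_ord j; lia.
have -> : (\prod_(n.+1 <= j < n.*2.+1) (m + (j - n + (n - j))) = (m + n) ^_ n)%N.
  rewrite -{1}(add0n n.+1) big_addn (_ : n.*2.+1 - n.+1 = n)%N; last by lia.
  rewrite big_nat_rev ffact_prod big_mkord /=; apply: eq_bigr => j _; have := ltn_ord j; lia.
rewrite subnn addn0 addn0; lia.
Qed.

Lemma prod_dist_other N i : (i < N.+1)%N ->
  (\prod_(j < N.+1 | j != i :> nat) ((i - j) + (j - i)) = i`! * (N - i)`!)%N.
Proof.
move=> iN; rewrite big_mkcond /= -(big_mkord xpredT (fun j => if j != i then (i - j) + (j - i) else 1)%N).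
rewrite (big_cat_nat (n := i)) //=; last exact: ltnW.
rewrite (@big_ltn _ _ _ i) //= eqxx mul1n; congr (_ * _)%N.
  rewrite fact_prod big_nat_rev big_add1 /=; apply: eq_big_nat => j /andP[_ ji].
  rewrite ifT; last by apply/eqP; lia.
  lia.
rewrite -{1}(add0n i.+1) big_addn subSS fact_prod big_add1 /=; apply: eq_big_nat => j _.
rewrite ifT; last by apply/eqP; lia.
lia.
Qed.

Lemma fact_center n i : (i <= n.*2)%N -> (n`! ^ 2 <= i`! * (n.*2 - i)`!)%N.
Proof.
have key k : (k <= n)%N -> (n`! ^ 2 <= (n - k)`! * (n + k)`!)%N.
  move=> kn; have h : (n ^_ k <= (n + k) ^_ k)%N.
    rewrite !ffact_prod; apply: leq_prod => j _; lia.
  have e1 := ffact_fact kn; have e2 := ffact_fact (leq_addl n k); rewrite addnK in e2.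
  rewrite -e2 mulnCA mulnA -mulnn leq_mul2r; apply/orP; right.
  by rewrite -{1}e1 leq_mul2r h orbT.
move=> i2n; have [ni|ni] := leqP n i.
  have -> : (i`! * (n.*2 - i)`! = (n - (i - n))`! * (n + (i - n))`!)%N.
    rewrite mulnC; congr ((_)`! * (_)`!)%N; lia.
  by apply: key; lia.
have -> : (i`! * (n.*2 - i)`! = (n - (n - i))`! * (n + (n - i))`!)%N.
  congr ((_)`! * (_)`!)%N; lia.
by apply: key; lia.
Qed.

(** Comparison of the numerators m + |j - n| and denominators |i - j| that occur
    in the Lagrange basis at the nodes -n, ..., n: the worst case of the
    denominator is the central node. *)
Lemma prod_ratio n m i : (0 < m)%N -> (i < n.*2.+1)%N ->
  (\prod_(j < n.*2.+1 | j != i :> nat) (m + ((j - n) + (n - j)))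
   <= 'C(m + n, n) ^ 2 * \prod_(j < n.*2.+1 | j != i :> nat) ((i - j) + (j - i)))%N.
Proof.
move=> m0 i2n; rewrite prod_dist_other //.
apply: leq_trans (_ : (((m + n) ^_ n) ^ 2 <= _)%N); last first.
  rewrite -bin_ffact expnMn leq_mul2l fact_center ?orbT //.
have := prod_dist_center n m0; rewrite (bigD1 (Ordinal i2n)) //=.
rewrite (eq_bigl (fun j : 'I_n.*2.+1 => j != i :> nat)); last by [].
move=> e; rewrite -(leq_pmul2l m0) -e leq_mul2r leq_addr orbT //.
Qed.

Section Interpolation.
Variable R : realType.
Local Notation V := {mpoly R[3]}.

(** One term of the binomial expansion of 1; with y close to 1 it shows that the
    binomial coefficient grows slowly in n when m is a small fraction of n. *)
Lemma binomial_bound (n m : nat) (y : R) : 0 <= y -> y <= 1 ->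
  'C(m + n, n)%:R * (y ^+ n * (1 - y) ^+ m) <= 1.
Proof.
move=> y0 y1; rewrite [leRHS](_ : 1 = (1 - y + y) ^+ (m + n)); last by rewrite subrK expr1n.
have ni : (n < (m + n).+1)%N by rewrite ltnS leq_addl.
rewrite [leRHS]exprDn (bigD1 (Ordinal ni)) //= addnK mulr_natl [y ^+ n * _]mulrC lerDl.
by apply: sumr_ge0 => i _; rewrite mulrn_wge0 // mulr_ge0 // exprn_ge0 // subr_ge0.
Qed.

Lemma lagrange_interp (x : nat -> R) B (p : {poly R}) z : injective x -> (size p <= B)%N ->
  p.[z] = \sum_(i < B) p.[x i] * \prod_(j < B | j != i :> nat) ((x i - x j)^-1 * (z - x j)).
Proof.
move=> xI sp.
pose q : {poly R} := \sum_(i < B) p.[x i] *: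
  \prod_(j < B | j != i :> nat) ((x i - x j)^-1 *: ('X - (x j)%:P)).
have qE w : q.[w] = \sum_(i < B) p.[x i] * \prod_(j < B | j != i :> nat) ((x i - x j)^-1 * (w - x j)).
  rewrite /q horner_sum; apply: eq_bigr => i _; rewrite hornerZ horner_prod; congr (_ * _).
  by apply: eq_bigr => j _; rewrite hornerZ hornerXsubC.
have sq : (size q <= B)%N.
  apply: leq_trans (size_sum _ _ _) _; apply/bigmax_leqP => i _; apply: leq_trans (size_scale_leq _ _) _.
  apply: leq_trans (size_poly_prod_leq _ _) _.
  have hB : (0 < B)%N by apply: leq_ltn_trans (ltn_ord i).
  have c : #|[pred j : 'I_B | j != i :> nat]| = B.-1.
    have := cardC1 i; rewrite card_ord => <-; by apply: eq_card => j; rewrite !inE.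
  have : (\sum_(j < B | j != i :> nat) size ((x i - x j)^-1 *: ('X - (x j)%:P))
          <= \sum_(j < B | j != i :> nat) 2)%N.
    apply: leq_sum => j _; apply: leq_trans (size_scale_leq _ _) _; by rewrite size_XsubC.
  rewrite sum_nat_const [in X in (_ <= X -> _)%N]c => hs.
  rewrite [X in (_.+1 - X)%N]c leq_subLR.
  by apply: leq_trans (_ : (B.-1 * 2).+1 <= _)%N; [rewrite ltnS; exact: hs|lia].
suff e : p = q by rewrite -qE -e.
apply/eqP; rewrite -subr_eq0; apply/negPn/negP => nz.
have := @max_poly_roots _ (p - q) [seq x i | i <- iota 0 B] nz.
rewrite size_map size_iota map_inj_uniq // iota_uniq => /(_ _ isT) h.
have : (B < size (p - q)%R)%N.
  apply: h; apply/allP => _ /mapP[i + ->]; rewrite mem_iota add0n => /= iB.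
  rewrite rootE hornerD hornerN qE (bigD1 (Ordinal iB)) //=.
  rewrite [X in _ * X]big1; last first.
    by move=> j ji; rewrite mulVf // subr_eq0; apply: contraNneq ji => /xI ->.
  rewrite big1 ?mulr1 ?addr0 ?subrr // => k ki.
  rewrite (bigD1 (Ordinal iB)) /=; last by rewrite eq_sym.
  by rewrite subrr mulr0 mul0r mulr0.
apply/negP; rewrite -leqNgt; apply: leq_trans (size_polyD _ _) _.
by rewrite size_polyN geq_max sp.
Qed.

Lemma affine_prod_poly J (s : seq J) (al be : J -> R) : exists p : {poly R},
  (size p <= (size s).+1)%N /\ forall x, \prod_(j <- s) (be j + al j * x) = p.[x].
Proof.
exists (\prod_(j <- s) ((be j)%:P + al j *: 'X)); split.
  elim: s => [|j s IH]; first by rewrite big_nil size_poly1.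
  rewrite big_cons; apply: leq_trans (size_polyMleq _ _) _ => /=.
  have : (size ((be j)%:P + al j *: 'X)%R <= 2)%N.
    apply: leq_trans (size_polyD _ _) _; rewrite geq_max.
    rewrite (leq_trans (size_polyC_leq1 _)) //= (leq_trans (size_scale_leq _ _)) // size_polyX //.
  move=> h2; rewrite -subn1 leq_subLR; apply: leq_trans (leq_add h2 IH) _; lia.
by move=> x; rewrite horner_prod; apply: eq_bigr => j _; rewrite !hornerE.
Qed.

Section Basis.
Variables (x : nat -> R) (B : nat).
Hypothesis xI : injective x.

(** The Lagrange basis polynomial of the node x i, in the k-th variable. *)
Definition ell (i : nat) (k : 'I_3) : V :=
  \prod_(j < B | j != i :> nat) ((x i - x j)^-1 *: ('X_k - (x j)%:MP)).

Lemma ellE i k (h : 'rV[R]_3) : (ell i k).@[coords h] =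
  \prod_(j < B | j != i :> nat) ((x i - x j)^-1 * (h 0 k - x j)).
Proof.
rewrite /ell rmorph_prod; apply: eq_bigr => j _ /=.
by rewrite mevalZ mevalB mevalXU mevalC.
Qed.

Lemma mnorm_ell t i k : 0 < t -> mnorm t (ell i k) <=
  \prod_(j < B | j != i :> nat) (`|x i - x j|^-1 * (t + `|x j|)).
Proof.
move=> t0; apply: le_trans (mnorm_prod t0 _ _ _) _.
apply: ler_prod => j _; rewrite mnorm_ge0 //= mnormZ // normfV ler_wpM2l ?invr_ge0 //.
rewrite -mpolyCN; apply: le_trans (mnormD t0 _ _) _; rewrite mnormX mdeg1 expr1 lerD2l.
by rewrite -[_%:MP]mulr1 mul_mpolyC mnormZ // mnorm1 mulr1 normrN.
Qed.

(** Tensor product interpolation. *)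
Definition interp (g : R -> R -> R -> R) : V :=
  \sum_(i < B) \sum_(j < B) \sum_(k < B)
    g (x i) (x j) (x k) *: (ell i 0 * ell j 1 * ell k 2%:R).

Definition polyfun (f : R -> R) := exists p : {poly R}, (size p <= B)%N /\ forall y, f y = p.[y].

Lemma polyfun_lagrange f y : polyfun f -> f y =
  \sum_(i < B) f (x i) * \prod_(j < B | j != i :> nat) ((x i - x j)^-1 * (y - x j)).
Proof.
move=> [p [sp fp]]; rewrite fp (lagrange_interp _ xI sp).
by apply: eq_bigr => i _; rewrite fp.
Qed.

Lemma interpE g (h : 'rV[R]_3) :
  (forall b c, polyfun (fun a => g a b c)) -> (forall a c, polyfun (fun b => g a b c)) ->
  (forall a b, polyfun (fun c => g a b c)) ->
  (interp g).@[coords h] = g (h 0 0) (h 0 1) (h 0 2%:R).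
Proof.
move=> ga gb gc; rewrite (polyfun_lagrange _ (ga _ _)) /interp raddf_sum.
apply: eq_bigr => i _; rewrite (polyfun_lagrange _ (gb _ _)) mulr_suml raddf_sum.
apply: eq_bigr => j _; rewrite (polyfun_lagrange _ (gc _ _)) !mulr_suml raddf_sum.
apply: eq_bigr => k _ /=; rewrite mevalZ !mevalM !ellE; ring.
Qed.

(** Bounds the coefficients of a polynomial by its values at real points.  For a
    radius t that is small compared to the spread of the nodes the loss is
    exponential in the degree, but at an arbitrarily small rate, which the decay
    inside the ball absorbs. *)
Lemma mnorm_interp t g A lam : 0 < t -> 0 <= lam ->
  (forall i j k : 'I_B, `|g (x i) (x j) (x k)| <= A) ->
  (forall (i : 'I_B) k, mnorm t (ell i k) <= lam) ->
  mnorm t (interp g) <= A * (B%:R * lam) ^+ 3.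
Proof.
move=> t0 l0 gA el.
have -> : A * (B%:R * lam) ^+ 3 = \sum_(i < B) \sum_(j < B) \sum_(k < B) A * lam ^+ 3.
  rewrite !sumr_const !card_ord -!mulrnA -[RHS]mulr_natr !natrM; ring.
apply: le_trans (mnorm_sum t0 _ _) _; apply: ler_sum => i _.
apply: le_trans (mnorm_sum t0 _ _) _; apply: ler_sum => j _.
apply: le_trans (mnorm_sum t0 _ _) _; apply: ler_sum => k _.
rewrite mnormZ // ler_pM ?mnorm_ge0 //.
apply: le_trans (mnormM t0 _ _) _; rewrite exprSr ler_pM ?mnorm_ge0 //.
by apply: le_trans (mnormM t0 _ _) _; rewrite expr2 ler_pM ?mnorm_ge0.
Qed.
End Basis.

Definition node (rho : R) n (j : nat) : R := (j%:R - n%:R) * (rho / n%:R).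

Lemma node_inj rho n : 0 < rho -> (0 < n)%N -> injective (node rho n).
Proof.
move=> r0 n0 i j /mulIf h; have nz : rho / n%:R != 0.
  by rewrite mulf_neq0 ?invr_eq0 ?gt_eqF // ltr0n.
by have /addIr/eqP := h nz; rewrite eqr_nat => /eqP.
Qed.

Lemma node_le rho n (j : nat) : 0 < rho -> (0 < n)%N -> (j < n.*2.+1)%N -> `|node rho n j| <= rho.
Proof.
move=> r0 n0 jn; have n0' : 0 < n%:R :> R by rewrite ltr0n.
rewrite normrM absdiff_nat [`|rho / _|]ger0_norm; last by rewrite divr_ge0 // ltW.
rewrite mulrA ler_pdivrMr // mulrC ler_pM2l // ler_nat; lia.
Qed.

(** In units of rho / n the nodes are integers and the radius rho / T becomes
    n / T, which is at most m. *)
Lemma mnorm_ell_node rho T n m i k : 0 < rho -> (0 < T)%N -> (0 < n)%N -> (0 < m)%N ->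
  (n <= T * m)%N -> (i < n.*2.+1)%N ->
  mnorm (rho / T%:R) (ell (node rho n) n.*2.+1 i k) <= 'C(m + n, n)%:R ^+ 2.
Proof.
move=> r0 T0 n0 m0 nTm i2n.
have T0' : 0 < T%:R :> R by rewrite ltr0n.
have n0' : 0 < n%:R :> R by rewrite ltr0n.
apply: le_trans (mnorm_ell _ _ _ _ _) _; first by rewrite divr_gt0.
apply: le_trans (_ : \prod_(j < n.*2.+1 | j != i :> nat)
   ((m + ((j - n) + (n - j)))%:R / ((i - j) + (j - i))%:R) <= _).
  apply: ler_prod => j ji; apply/andP; split.
    by rewrite mulr_ge0 ?invr_ge0 // addr_ge0 // divr_ge0 // ltW.
  rewrite /node -mulrBl opprB addrA subrK.
  rewrite !normrM !absdiff_nat [`|rho|]ger0_norm ?(ltW r0) // [`|_^-1|]ger0_norm ?invr_ge0 //.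
  have d0 : 0 < ((i - j) + (j - i))%:R :> R.
    by rewrite ltr0n; move/eqP: ji; lia.
  have c0 : 0 < rho / n%:R by rewrite divr_gt0.
  have H : rho / T%:R <= m%:R * (rho / n%:R).
    rewrite mulrCA ler_pM2l // ler_pdivlMr // mulrC ler_pdivrMr // -natrM ler_nat mulnC //.
  rewrite mulrC ler_pdivrMr ?mulr_gt0 ?invr_gt0 //.
  by rewrite [leRHS]mulrA divfK ?gt_eqF // [(m + _)%:R]natrD mulrDl lerD2r.
rewrite prodf_div -!natr_prod ler_pdivrMr; last first.
  rewrite ltr0n prodn_cond_gt0 // => j /eqP; lia.
by rewrite -natrX -natrM ler_nat; exact: prod_ratio.
Qed.
End Interpolation.

(** * Extension to the ball *)

Section BallExtension.
Variable R : realType.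
Local Notation S2 := (S2 R).
Variables (f : S2 -> R) (lam : R) (L : forall d, 'I_d -> 'rV[R]_3).
Hypothesis hf : uniform_representation f lam L.

Definition hterm d (v : 'rV[R]_3) : R := \prod_(j < d) linform (@L d j) v.

(** Consecutive partial sums of a uniformly convergent series are eventually
    close; the finitely many remaining terms are continuous on a compact
    space. *)
Lemma hterm_bounded : exists M, 0 <= M /\ forall d p, `|hterm d (S2val p)| <= M.
Proof.
have [N0 _ hN0] : \forall N \near \oo, forall p, `|f p - partial_sum lam L N (S2val p)| < 1.
  by move/uniformP : hf => /(_ 1 ltr01).
have small : forall n, exists M, 0 <= M /\ forall d p, (d <= n)%N -> `|hterm d (S2val p)| <= M.
  have one d : exists M, 0 <= M /\ forall p, `|hterm d (S2val p)| <= M.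
    have [|B [B0 hB]] := @S2_bounded R (fun p => hterm d (S2val p)).
      by apply: continuous_prod => j; exact: continuous_linform.
    by exists B; split=> //; exact: ltW.
  elim=> [|n [M [M0 hM]]].
    have [M [M0 hM]] := one 0%N; exists M; split=> // d p; rewrite leqn0 => /eqP ->; exact: hM.
  have [M' [M'0 hM']] := one n.+1.
  exists (M + M'); split=> [|d p]; first exact: addr_ge0.
  rewrite leq_eqVlt => /orP[/eqP ->|]; last rewrite ltnS => dn.
    by rewrite (le_trans (hM' p)) // lerDr.
  by rewrite (le_trans (hM d p dn)) // lerDl.
have [M [M0 hM]] := small N0; exists (M + 2); split=> [|d p]; first by rewrite addr_ge0.
have [dN|Nd] := leqP d N0; first by rewrite (le_trans (hM d p dN)) // lerDl.
case: d Nd => // d; rewrite ltnS => Nd.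
have h1 := hN0 d Nd p; have h2 := hN0 d.+1 (leqW Nd) p.
have e : partial_sum lam L d.+1 (S2val p) = partial_sum lam L d (S2val p) + hterm d.+1 (S2val p).
  by rewrite /partial_sum big_nat_recr //= addrA.
move: h1 h2; rewrite e !ltr_norml ler_norml => /andP[a1 a2] /andP[b1 b2].
apply/andP; split; lra.
Qed.

Lemma hterm_ball M s d u : (forall d p, `|hterm d (S2val p)| <= M) -> 0 < s -> (0 < d)%N ->
  sqnorm u <= s ^+ 2 -> `|hterm d u| <= M * s ^+ d.
Proof.
move=> hM s0 d0 us; have M0 : 0 <= M by apply: le_trans (hM 0%N (spherical (0, 0))).
have [u0|/normalize[r [w [r0 rr v1 ->]]]] := eqVneq u 0.
  rewrite /hterm; case: d d0 => // d _; rewrite big_ord_recl u0.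
  rewrite [linform _ 0]big1 ?mul0r ?normr0; last by move=> i _; rewrite mxE mulr0.
  by rewrite mulr_ge0 // exprn_ge0 // ltW.
have -> : hterm d (r *: w) = r ^+ d * hterm d w.
  rewrite /hterm -[in r ^+ d](card_ord d) -prodr_const -big_split /=; apply: eq_bigr => j _.
  by rewrite /linform mulr_sumr; apply: eq_bigr => i _; rewrite mxE mulrCA.
rewrite normrM normrX (ger0_norm (ltW r0)) mulrC ler_pM ?exprn_ge0 ?(ltW r0) //.
  exact: (hM d (mkS2 v1)).
apply: lerXn2r; rewrite ?nnegrE ?(ltW r0) ?(ltW s0) //.
by rewrite -(@ler_pXn2r _ 2) ?nnegrE ?(ltW r0) ?(ltW s0) // rr.
Qed.

Definition sterm d v : R := if d is 0 then lam else hterm d v.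

Lemma partial_sum_series v :
  (fun N => partial_sum lam L N v) = (fun N => series (fun d => sterm d v) N.+1).
Proof.
by apply/funext => N; rewrite /partial_sum /series /= [RHS]big_nat_recl //= big_add1.
Qed.

Lemma extension_cvg v : open_ball v ->
  series (fun d => sterm d v) @ \oo --> canonical_extension lam L v.
Proof.
move=> hv; have [M [M0 hM]] := hterm_bounded.
pose s := (1 + sqnorm v) / 2.
have v0 := sqnorm_ge0 v; have s0 : 0 < s by rewrite divr_gt0 // ltr_wpDr.
have s1 : s < 1 by rewrite ltr_pdivrMr // mul1r; move: hv; rewrite /open_ball /=; lra.
have vs : sqnorm v <= s ^+ 2.
  have : 0 <= (1 - sqnorm v) ^+ 2 by exact: sqr_ge0.
  rewrite /s; lra.
have /cvg_ex[l hl] : cvgn (series (fun d => sterm d v)).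
  apply: (@geometric_cvg _ _ (M + `|lam|) s (ltW s0) s1) => -[|d].
    by rewrite expr0 mulr1 lerDr.
  apply: le_trans (hterm_ball hM s0 (ltn0Sn d) vs) _.
  by rewrite ler_wpM2r ?exprn_ge0 ?(ltW s0) // lerDl.
suff -> : canonical_extension lam L v = l by exact: hl.
by apply: (@cvg_lim _ (@Rhausdorff R)); rewrite partial_sum_series cvg_shiftS.
Qed.

Lemma partial_sum_cvg v : open_ball v -> cvgn (fun N => partial_sum lam L N v).
Proof.
move=> /extension_cvg h; apply/cvg_ex; exists (canonical_extension lam L v).
by rewrite partial_sum_series cvg_shiftS.
Qed.

Lemma hterm_polyfun d B (v w : 'rV[R]_3) : (d < B)%N ->
  polyfun B (fun y => hterm d (v + y *: w)).
Proof.
move=> dB; have [p [sp hp]] := affine_prod_poly (index_enum 'I_d)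
  (fun j => linform (@L d j) w) (fun j => linform (@L d j) v).
exists p; split.
  apply: leq_trans sp _; suff -> : size (index_enum 'I_d) = d by [].
  by rewrite -[in RHS](card_ord d) cardT enumT.
move=> y; rewrite -hp; apply: eq_bigr => j _.
rewrite /linform mulr_suml -big_split; apply: eq_bigr => i _ /=; rewrite !mxE; ring.
Qed.

Lemma bernoulli_ineq (x : R) n : 0 <= x -> x <= 1 -> 1 - n%:R * x <= (1 - x) ^+ n.
Proof.
move=> x0 x1; elim: n => [|n IH]; first by rewrite mul0r subr0 expr0.
rewrite exprS; apply: le_trans (_ : (1 - x) * (1 - n%:R * x) <= _); last first.
  by rewrite ler_wpM2l // subr_ge0.
have : 0 <= n%:R * x * x by rewrite !mulr_ge0.
rewrite -natr1; lra.
Qed.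

Lemma geometric_linear (a : R) d : 0 < a -> a < 1 -> d.*2.+1%:R * a ^+ d <= 2 / (1 - a).
Proof.
move=> a0 a1; have b0 : 0 < 1 - a by rewrite subr_gt0.
have h : d.+1%:R * a ^+ d <= (1 - a)^-1.
  have := geometric_tail 0 d.+1 (@ler01 R) (ltW a0) a1.
  rewrite expr0 !mul1r; apply: le_trans.
  have -> : d.+1%:R * a ^+ d = \sum_(0 <= i < d.+1) a ^+ d.
    by rewrite sumr_const_nat subn0 mulr_natl.
  rewrite !big_nat; apply: ler_sum => i /andP[_]; rewrite ltnS mul1r => id.
  by apply: ler_wiXn2l => //; exact: ltW.
apply: le_trans (_ : 2 * (d.+1%:R * a ^+ d) <= _); last by rewrite ler_pM2l.
rewrite mulrA ler_wpM2r ?exprn_ge0 ?(ltW a0) // -natrM ler_nat; lia.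
Qed.

(** The bookkeeping of exponents: the 16 powers of al = a^d provided by the decay
    of the d-th term pay 3 for the number of nodes, 12 for the six binomial
    factors, and leave one. *)
Lemma interp_decay (M b g al C B : R) : 0 <= M -> 0 < g -> 0 < al -> 0 <= C -> 0 <= B ->
  C * (al * (al * g)) <= 1 -> B * al <= b ->
  M * al ^+ 16 * (B * C ^+ 2) ^+ 3 <= M * b ^+ 3 * g^-1 ^+ 6 * al.
Proof.
move=> M0 g0 al0 C0 B0 hC hB.
have hC' : C * al ^+ 2 <= g^-1.
  by rewrite -[g^-1]mul1r ler_pdivlMr //; move: hC; rewrite expr2 !mulrA.
have -> : M * al ^+ 16 * (B * C ^+ 2) ^+ 3 = M * (B * al) ^+ 3 * (C * al ^+ 2) ^+ 6 * al by ring.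
have Ba : 0 <= B * al by rewrite mulr_ge0 // ltW.
have Ca : 0 <= C * al ^+ 2 by rewrite mulr_ge0 // exprn_ge0 // ltW.
have h3 : (B * al) ^+ 3 <= b ^+ 3 by rewrite lerXn2r // nnegrE; exact: le_trans hB.
have h6 : (C * al ^+ 2) ^+ 6 <= g^-1 ^+ 6 by rewrite lerXn2r // nnegrE; exact: le_trans hC'.
apply: ler_wpM2r; first exact: ltW.
apply: ler_pM h6; [|exact: exprn_ge0|exact: ler_wpM2l].
by rewrite mulr_ge0 // exprn_ge0.
Qed.

(** The expansion of the d-th term around v, obtained as its own interpolant. *)
Definition local_poly v rho d : {mpoly R[3]} :=
  interp (node rho d) d.*2.+1 (fun x y z => hterm d (v + row3 x y z)).

Lemma local_polyE v rho d (h : 'rV[R]_3) : 0 < rho -> (0 < d)%N ->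
  (local_poly v rho d).@[coords h] = hterm d (v + h).
Proof.
move=> r0 d0; have dd : (d < d.*2.+1)%N by rewrite ltnS -addnn leq_addr.
have r1 x y z : row3 x y z = row3 0 y z + x *: row3 1 0 0.
  by apply: row3P; rewrite !mxE /=; ring.
have r2 x y z : row3 x y z = row3 x 0 z + y *: row3 0 1 0.
  by apply: row3P; rewrite !mxE /=; ring.
have r3 x y z : row3 x y z = row3 x y 0 + z *: row3 0 0 1.
  by apply: row3P; rewrite !mxE /=; ring.
rewrite /local_poly interpE.
- by congr (hterm d (_ + _)); apply: row3P; rewrite mxE.
- exact: node_inj.
- move=> b c; have [p [sp hp]] := hterm_polyfun (v + row3 0 b c) (row3 1 0 0) dd.
  by exists p; split=> // y; rewrite -hp r1 addrA.
- move=> b c; have [p [sp hp]] := hterm_polyfun (v + row3 b 0 c) (row3 0 1 0) dd.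
  by exists p; split=> // y; rewrite -hp r2 addrA.
- move=> b c; have [p [sp hp]] := hterm_polyfun (v + row3 b c 0) (row3 0 0 1) dd.
  by exists p; split=> // y; rewrite -hp r3 addrA.
Qed.

(** The values at the nodes are at most M * (a^16)^d.  The basis polynomials cost
    a^(-12 d) up to a constant, because a^T <= 1 - a makes the binomial factors
    grow slowly, and the number of nodes costs a further a^(-3 d). *)
Lemma mnorm_local_poly M v rho a T d : (forall d p, `|hterm d (S2val p)| <= M) ->
  0 < rho -> 0 < a -> a < 1 -> (0 < T)%N -> a ^+ T <= 1 - a -> (0 < d)%N ->
  (forall h : 'rV[R]_3, (forall i, `|h 0 i| <= rho) -> sqnorm (v + h) <= (a ^+ 16) ^+ 2) ->
  mnorm (rho / T%:R) (local_poly v rho d) <=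
    M * (2 / (1 - a)) ^+ 3 * (a ^+ T)^-1 ^+ 6 * a ^+ d.
Proof.
move=> hM r0 a0 a1 T0 hT d0 in_ball.
have M0 : 0 <= M by apply: le_trans (hM 0%N (spherical (0, 0))).
(* m is at least d / T, and T * m is at most d + T. *)
pose m := (d %/ T).+1; pose C : R := 'C(m + d, d)%:R.
apply: le_trans (_ : M * (a ^+ 16) ^+ d * (d.*2.+1%:R * C ^+ 2) ^+ 3 <= _).
  apply: mnorm_interp => //.
  - by rewrite divr_gt0 // ltr0n.
  - by rewrite exprn_ge0 // ler0n.
  - move=> i j k; apply: hterm_ball => //; first by rewrite exprn_gt0.
    apply: in_ball => l; have hx (x : 'I_d.*2.+1) : `|node rho d x| <= rho by exact: node_le.
    by case: (ord3P l) => ->; rewrite mxE /=.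
  - move=> i k; apply: mnorm_ell_node => //.
    by rewrite /m mulnC; apply: ltnW; exact: ltn_ceil.
rewrite -exprM mulnC exprM; apply: interp_decay => //.
- by rewrite exprn_gt0.
- by rewrite exprn_gt0.
- have y1 : 1 - a ^+ T <= 1 by rewrite gerBl exprn_ge0 // ltW.
  have y0 : 0 <= 1 - a ^+ T by rewrite subr_ge0 exprn_ile1 // ltW.
  apply: le_trans (binomial_bound d m y0 y1); rewrite ler_wpM2l // subKr.
  rewrite ler_pM ?exprn_ge0 ?mulr_ge0 ?exprn_ge0 ?(ltW a0) //.
    by rewrite lerXn2r ?nnegrE ?(ltW a0) //; lra.
  rewrite -exprM -exprD; apply: ler_wiXn2l; [exact: ltW..|].
  by rewrite /m mulnS mulnC addnC leq_add2r leq_divM.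
- exact: geometric_linear.
Qed.

(** By homogeneity the d-th term is at most M * (a^16)^d near v, for some a < 1;
    its expansion around v then still decays like a^d in a small enough norm. *)
Lemma extension_analytic v : open_ball v -> real_analytic_at (canonical_extension lam L) v.
Proof.
move=> hv; have [M [M0 hM]] := hterm_bounded.
have q0 := sqnorm_ge0 v; have q1 : sqnorm v < 1 by [].
(* On the cube of half-side rho the squared length is at most (1 + |v|^2) / 2, and
   a is chosen so that the Bernoulli inequality gives a^32 at least this. *)
pose rho := (1 - sqnorm v) / 18; pose a := 1 - (1 - sqnorm v) / 64.
have rho0 : 0 < rho by rewrite /rho; lra.
have a0 : 0 < a by rewrite /a; lra.
have a1 : a < 1 by rewrite /a; lra.
have in_ball (h : 'rV[R]_3) : (forall i, `|h 0 i| <= rho) -> sqnorm (v + h) <= (a ^+ 16) ^+ 2.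
  move=> hh; apply: le_trans (_ : (1 + sqnorm v) / 2 <= _); last first.
    have h32 : 1 - 32%:R * ((1 - sqnorm v) / 64) <= a ^+ 32 by apply: bernoulli_ineq; lra.
    by rewrite -exprM; apply: le_trans h32; lra.
  have vi i : -1 <= v 0 i <= 1.
    have := coord_le_sqnorm v i => h1.
    by rewrite -ler_norml -(expr_le1 (n := 2)) // real_normK ?num_real //; lra.
  have one i : (v 0 i + h 0 i) ^+ 2 <= v 0 i ^+ 2 + 3 * rho.
    have := hh i; have := vi i; rewrite ler_norml => /andP[v1 v2] /andP[h1 h2].
    have r1 : rho <= 1 by rewrite /rho; lra.
    nra.
  rewrite /sqnorm sum3 !mxE; have := one 0; have := one 1; have := one 2%:R.
  rewrite /rho {1}/sqnorm -/(sqnorm v) /sqnorm !sum3; lra.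
have [T T0 hT] : exists2 T, (0 < T)%N & a ^+ T <= 1 - a.
  have b0 : 0 < 1 - a by rewrite subr_gt0.
  have := @cvg_expr R a; rewrite (ger0_norm (ltW a0)) => /(_ a1).
  move/cvgrPdist_le/(_ _ b0) => [T _ hT]; exists T.+1 => //.
  have := hT T.+1 (leqnSn T); rewrite sub0r normrN; apply: le_trans; exact: ler_norm.
pose t := rho / T%:R; have t0 : 0 < t by rewrite divr_gt0 // ltr0n.
have trho : t <= rho.
  by rewrite ler_pdivrMr ?ltr0n // ler_pMr // ler1n.
pose G d : {mpoly R[3]} := if d is 0 then lam%:MP else local_poly v rho d.
pose K := M * (2 / (1 - a)) ^+ 3 * (a ^+ T)^-1 ^+ 6.
have b0 : 0 < 1 - a by rewrite subr_gt0.
have K0 : 0 <= K by rewrite !mulr_ge0 ?exprn_ge0 ?mulr_ge0 ?invr_ge0 ?exprn_ge0 ?(ltW a0) ?(ltW b0).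
have mnG d : mnorm t (G d) <= (K + `|lam|) * a ^+ d.
  case: d => [|d].
    by rewrite /G -[_%:MP]mulr1 mul_mpolyC mnormZ // mnorm1 expr0 !mulr1 lerDr.
  apply: le_trans (@mnorm_local_poly M v rho a T d.+1 _ _ _ _ _ _ _ _) _ => //.
  by rewrite ler_wpM2r ?exprn_ge0 ?(ltW a0) // lerDl.
apply: (@analytic_criterion _ _ _ t (K + `|lam|) a G) => //; first exact: ltW.
move=> w wv.
have hw i : `|(w - v) 0 i| <= rho.
  apply: le_trans trho; apply: le_trans (ltW wv); rewrite /Num.norm /= mx_normrE.
  exact: (le_bigmax _ (fun ij : 'I_1 * 'I_3 => `|(w - v) ij.1 ij.2|) (0, i)).
have ow : open_ball w.
  have := in_ball _ hw; rewrite addrC subrK /open_ball /= => h; apply: le_lt_trans h _.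
  by rewrite -exprM exprn_ilt1 // ltW.
have := extension_cvg ow; rewrite (_ : series _ = fun D => \sum_(0 <= d < D) (G d).@[coords (w - v)]) //.
apply/funext => D; apply: eq_bigr => -[|d] _; first by rewrite mevalC.
by rewrite local_polyE // addrC subrK.
Qed.
End BallExtension.

Theorem theorem3 (R : realType) :
  (forall f : S2 R -> R, f \in Lfun surface_measure 2%:E ->
    [/\ exists (lam : nat -> R) (L : nat -> forall k, 'I_k -> 'rV[R]_3),
          L2_representation f lam L,
        forall (lam : nat -> R) (L : nat -> forall k, 'I_k -> 'rV[R]_3),
          L2_representation f lam L ->
          forall d e : nat, d <> e ->
            (\int[surface_measure]_p
               (brace lam L d (S2val p) * brace lam L e (S2val p))%:E = 0)%E
      & forall (lam lam' : nat -> R)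
               (L L' : nat -> forall k, 'I_k -> 'rV[R]_3),
          L2_representation f lam L -> L2_representation f lam' L' ->
          (forall d, lam d = lam' d) /\
          (forall d k : nat, (1 <= k <= d)%N ->
             same_factors (L d k) (L' d k))]) /\
  [/\ forall f : S2 R -> R, calF f -> continuous f,
      forall g : S2 R -> R, continuous g -> forall eps : R, 0 < eps ->
        exists f : S2 R -> R, calF f /\ forall p, `|g p - f p| < eps,
      forall (A : 'M[R]_3) (hA : A *m A^T = 1%:M) (f : S2 R -> R),
        calF f -> calF (fun p => f (orthact hA p))
    & forall (f : S2 R -> R) (lam : R) (L : forall d, 'I_d -> 'rV[R]_3),
        uniform_representation f lam L ->
        [/\ forall p : S2 R, canonical_extension lam L (S2val p) = f p,
            forall v, open_ball v -> cvgn (fun N => partial_sum lam L N v)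
          & forall v, open_ball v ->
              real_analytic_at (canonical_extension lam L) v]].
Proof.
split=> [f /Lfun2P[mf intf]|].
  split.
  - exact: L2_representation_exists mf intf.
  - exact: brace_orth mf intf.
  - move=> lam lam' L L'; exact: (representation_unique mf intf).
split.
- exact: calF_continuous.
- exact: calF_dense.
- exact: calF_orthact.
- move=> f lam L hf; split.
  + exact: extension_sphere.
  + exact: partial_sum_cvg hf.
  + exact: extension_analytic hf.
Qed.
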